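(* Under the unequal-cluster-size setting in the context (null log-linear model true), for any admissible $\phi_1,\phi_2$, \[ \frac{T^{\phi_1}(\boldsymbol{Y},\widehat{\boldsymbol{\theta}}_{\phi_2})}{\widetilde{\vartheta}_{\widehat{n}^*,N,\phi_2}}\xrightarrow[N\to\infty]{\mathcal{L}}\chi^2_{M-M_0-1},\qquad T^{\phi_1}(\boldsymbol{Y},\widehat{\boldsymbol{\theta}}_{\phi_2})=\frac{2\sum_{g=1}^GN_gn_g}{\phi_1''(1)}d_{\phi_1}\big(\widehat{\boldsymbol{p}},\boldsymbol{p}(\widehat{\boldsymbol{\theta}}_{\phi_2})\big). \]
   Context: Let $M\ge 3$ and $1\le M_0<M-1$. Let $\boldsymbol{W}$ be a real $M\times M_0$ matrix of full column rank whose columns, together with $\boldsymbol{1}_M$, are linearly independent; $\boldsymbol{p}(\boldsymbol{\theta})=\exp\{\boldsymbol{W}\boldsymbol{\theta}\}/(\boldsymbol{1}_M^T\exp\{\boldsymbol{W}\boldsymbol{\theta}\})$ for $\boldsymbol{\theta}\in\mathbb{R}^{M_0}$; $\boldsymbol{D}_{\boldsymbol{p}}=\mathrm{diag}(\boldsymbol{p})$, $\boldsymbol{\Sigma}_{\boldsymbol{p}}=\boldsymbol{D}_{\boldsymbol{p}}-\boldsymbol{p}\boldsymbol{p}^T$. Unequal cluster sizes: there are $G$ groups of clusters; group $g$ contains $N_g$ clusters, each of size $n_g\ge2$ (distinct $n_g$); $N=\sum_{g=1}^G N_g$, and $N_g/N\to N_g^*\in(0,1]$ as $N\to\infty$. The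 cluster frequency vectors $\boldsymbol{Y}^{(g,\ell)}$, $\ell=1,\dots,N_g$, $g=1,\dots,G$, are independent, with nonnegative integer entries summing to $n_g$, identically distributed within each group, $\mathrm{E}[\boldsymbol{Y}^{(g,\ell)}]=n_g\boldsymbol{p}(\boldsymbol{\theta}_0)$, $\mathrm{Var}[\boldsymbol{Y}^{(g,\ell)}]=\vartheta_{n_g}n_g\boldsymbol{\Sigma}_{\boldsymbol{p}(\boldsymbol{\theta}_0)}$, $\vartheta_{n_g}=1+(n_g-1)\rho^2$, $\rho^2\ge0$, $\boldsymbol{\theta}_0$ the unknown true parameter. Let $\boldsymbol{Y}=\sum_g\sum_\ell\boldsymbol{Y}^{(g,\ell)}$, $\widehat{\boldsymbol{p}}=\boldsymbol{Y}/\sum_{h}n_hN_h$, $\widehat{\boldsymbol{p}}^{(g,\ell)}=\boldsymbol{Y}^{(g,\ell)}/n_g$, $\widehat{\boldsymbol{p}}^{(g)}=\frac{1}{n_gN_g}\sum_{\ell=1}^{N_g}\boldsymbol{Y}^{(g,\ell)}$, $w_g=n_gN_g/\sum_hn_hN_h$, $\widehat{n}^*=\sum_gw_gn_g$. Admissible $\phi:(0,\infty)\to\mathbb{R}$: convex, twice continuously differentiable, $\phi(1)=\phi'(1)=0$, $\phi''(1)>0$, conventions $0\phi(0/0)=0$, $0\phi(p/0)=p\lim_{u\to\infty}\phi(u)/u$; $d_\phi(\boldsymbol{p},\boldsymbol{q})=\sum_r q_r\phi(p_r/q_r)$; QM$\phi$E $\widehat{\boldsymbol{\theta}}_\phi=\arg\min_{\boldsymbol{\theta}}d_\phi(\widehat{\boldsymbol{p}},\boldsymbol{p}(\boldsymbol{\theta}))$.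 Semi-parametric design effect estimator: $\widetilde{\vartheta}_{\widehat{n}^*,N,\phi}=\sum_{g=1}^Gw_g\widetilde{\vartheta}_{n_g,N_g,\phi}$, where $\widetilde{\vartheta}_{n_g,N_g,\phi}=\frac{n_g}{(N_g-1)(M-1)}\sum_{r=1}^M\frac{1}{p_r(\widehat{\boldsymbol{\theta}}_\phi)}\sum_{\ell=1}^{N_g}(\widehat{p}^{(g,\ell)}_r-\widehat{p}^{(g)}_r)^2$. *)

(* Defs.v *)
From HB Require Import structures.
From mathcomp Require Import all_boot all_order all_algebra.
From mathcomp Require Import all_classical all_reals all_analysis.
Set Implicit Arguments. Unset Strict Implicit. Unset Printing Implicit Defensive.
Import Order.TTheory GRing.Theory Num.Theory.
Import numFieldNormedType.Exports.
Local Open Scope classical_set_scope.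
Local Open Scope ring_scope.

Section Defs.
Variable R : realType.

Definition admissible (phi : R -> R) : Prop :=
  [/\ (forall x y t : R, 0 < x -> 0 < y -> 0 <= t <= 1 ->
         phi (t * x + (1 - t) * y) <= t * phi x + (1 - t) * phi y),
      (forall x : R, 0 < x -> derivable phi x 1),
      (forall x : R, 0 < x -> derivable (derive1 phi) x 1),
      (forall x : R, 0 < x -> {for x, continuous (derive1n 2 phi)}) &
      [/\ phi 1 = 0, derive1 phi 1 = 0 & 0 < derive1n 2 phi 1]].

(* phi extended to [0,oo) with values in \bar R: phi(0) := lim_{u->0+} phi(u),
   which (phi being convex with phi'(1)=0, hence nonincreasing on (0,1])
   equals sup_{0<u<1} phi(u) (possibly +oo). *)
Definition phiE (phi : R -> R) (u : R) : \bar R :=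
  if 0 < u then (phi u)%:E
  else ereal_sup ((fun v => (phi v)%:E) @` `]0, 1[%classic).

(* phi-divergence d_phi(p, q) = sum_r q_r phi(p_r / q_r).  It is only
   applied with q = p(theta), whose entries are all > 0, so the conventions
   for q_r = 0 are never needed. *)
Definition dphi (M : nat) (phi : R -> R) (p q : 'I_M -> R) : \bar R :=
  (\sum_(r < M) (q r)%:E * phiE phi (p r / q r))%E.

Definition pmodel (M M0 : nat) (W : 'M[R]_(M, M0)) (th : 'cV[R]_M0)
  : 'I_M -> R :=
  fun r => expR ((W *m th) r ord0) / \sum_(s < M) expR ((W *m th) s ord0).

Definition chi2_kernel (k : nat) (t : R) : R :=
  powR t (k%:R / 2 - 1) * expR (- t / 2).

Definition chi2_cdf (k : nat) (x : R) : R :=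
  if x < 0 then 0 else
  fine (\int[lebesgue_measure]_(t in (`[(0%R:R), x]%classic : set R))
          (chi2_kernel k t)%:E)%E /
  fine (\int[lebesgue_measure]_(t in (`[(0%R:R), +oo[%classic : set R))
          (chi2_kernel k t)%:E)%E.

Definition cvec (M n : nat) := {ffun 'I_M -> 'I_n.+1}.

Definition dataset (G M : nat) (n : 'I_G -> nat) (Ng : 'I_G -> nat) :=
  {dffun forall g : 'I_G, {ffun 'I_(Ng g) -> cvec M (n g)}}.

Section Data.
Variables (G M : nat) (n Ng : 'I_G -> nat).
Variable d : dataset M n Ng.

Definition ntot : nat := (\sum_(g < G) n g * Ng g)%N.
Definition Ytot (r : 'I_M) : R :=
  \sum_(g < G) \sum_(l < Ng g) ((d g l r : nat)%:R).
Definition phat (r : 'I_M) : R := Ytot r / (ntot%:R).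
Definition phat_gl (g : 'I_G) (l : 'I_(Ng g)) (r : 'I_M) : R :=
  (d g l r : nat)%:R / (n g)%:R.
Definition phat_g (g : 'I_G) (r : 'I_M) : R :=
  (\sum_(l < Ng g) (d g l r : nat)%:R) / ((n g)%:R * (Ng g)%:R).
Definition wgt (g : 'I_G) : R := ((n g)%:R * (Ng g)%:R) / (ntot%:R).

(* semi-parametric design-effect estimators, given the model probabilities
   pth = p(hat theta_phi) *)
Definition deff_g (pth : 'I_M -> R) (g : 'I_G) : R :=
  (n g)%:R / (((Ng g)%:R - 1) * (M%:R - 1)) *
  \sum_(r < M) (pth r)^-1 *
     \sum_(l < Ng g) (phat_gl l r - phat_g g r) ^+ 2.
Definition deff (pth : 'I_M -> R) : R :=
  \sum_(g < G) wgt g * deff_g pth g.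

(* probability of the data set under independent clusters, cluster vectors
   of group g having probability mass function q g *)
Definition data_prob (q : forall g : 'I_G, cvec M (n g) -> R) : R :=
  \prod_(g < G) \prod_(l < Ng g) q g (d g l).
End Data.

Definition Tstat (G M M0 : nat) (n Ng : 'I_G -> nat) (W : 'M[R]_(M, M0))
  (phi1 : R -> R) (d : dataset M n Ng) (th : 'cV[R]_M0) : \bar R :=
  ((2 * (ntot n Ng)%:R / derive1n 2 phi1 1)%:E *
    dphi phi1 (phat d) (pmodel W th))%E.

End Defs.

(* Main.v *)
(* With [z] the deviation of the observed proportions from the true ones, the
   statistic is asymptotically n |P D^(-1/2) z|^2 / vartheta, where P is the
   orthogonal projector on the complement of sqrt p and of the tangent space of the
   model, and has trace M - M0 - 1.  No expansion of the estimator itself is needed: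
   near the true probabilities both divergences are the weighted square distance up
   to a factor 1 + o(1), so the minimizer is compared with the linear least squares
   parameter from above and with the tangent space from below.

   The covariance of every cluster is a multiple of the same matrix, which after
   projection acts as a multiple of P.  Hence Lindeberg's replacement argument,
   applied to exp (- l |.|^2), only involves the Gaussian smoothings of this function,
   which are explicit; it gives the Laplace transform (1 + 2 l)^(-k/2) of the limit.
   Convergence of Laplace transforms yields convergence of distribution functions
   because the polynomials (1 - v^n)^(2^n) in v = exp (- l q) approximate the
   indicator of q > x when exp (- l x) = 1/2. *)
Require Import Defs.
From HB Require Import structures.
From mathcomp Require Import all_boot all_order all_algebra.
From mathcomp Require Import all_classical all_reals all_analysis.
From mathcomp Require Import measurable_realfun ring lra.
Set Implicit Arguments.
Unset Strict Implicit.
Unset Printing Implicit Defensive.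
Import Order.TTheory GRing.Theory Num.Theory.
Import numFieldNormedType.Exports.
Local Open Scope classical_set_scope.
Local Open Scope ring_scope.

(** * The chi-squared law and its Laplace transform *)

(** All randomness lives on finite data sets, so expectations are finite sums and the only integrals
    are those of the chi-squared kernel. No Gaussian variable is constructed: a replaced cluster
    survives only as elapsed time in [heat]. The obstacle is uniformity in the current partial sum
    u: Taylor remainders grow like a cubic in |u|^2 times exp (d K |u|^2), d being the size of one
    increment, and they are absorbed by the factor exp (- b |u|^2) carried by [heat] itself. Each
    step then costs C d^3 with d of order N^(-1/2), hence O(N^(-1/2)) in all. Groups enter only
    through variances that sum to 1 after normalization by the deterministic [SV]. The random design
    effect comes in afterwards. On an event [good] of probability close to 1, obtained from
    Chebyshev's inequality alone, it is near [SV] / [ntot], the observed proportions are near the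
    true ones, a minimizer exists and all divergences in play are finite. Off this event nothing is
    claimed about the estimator. *)

Section Chi2Kernel.
Variable R : realType.
Notation mu := (@lebesgue_measure R).

Lemma chi2_kernel_ge0 (k : nat) (t : R) : 0 <= chi2_kernel k t.
Proof. by rewrite /chi2_kernel mulr_ge0 ?powR_ge0 ?expR_ge0. Qed.

Lemma continuous_chi2_kernel (k : nat) (t : R) : 0 < t ->
  {for t, continuous (chi2_kernel k)}.
Proof.
move=> t0; rewrite /chi2_kernel.
apply: (@continuousM _ R^o (fun t => t `^ (k%:R / 2 - 1)) (fun x => expR (- x / 2))).
  apply: differentiable_continuous; apply/derivable1_diffP.
  by apply: derivable_powR; rewrite in_itv/= t0.
apply: continuous_comp; last exact: continuous_expR.
apply: (@continuousM _ R^o); last exact: cst_continuous.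
exact: (@continuousN _ R^o).
Qed.

Lemma measurable_chi2_kernel (k : nat) : measurable_fun setT (@chi2_kernel R k).
Proof.
rewrite /chi2_kernel; apply: measurable_funM; first exact: measurable_powR.
apply: measurableT_comp; first exact: measurable_expR.
by apply: measurable_funM => //; exact: measurable_oppr.
Qed.

(** Monotone convergence along compact intervals that avoid 0, near which the kernel with k = 1 is
    unbounded. The parameter [c] is there because scaling by c carries the exhaustion with parameter
    1 to the one with parameter c. *)
Lemma exhaust_itv0y_integral (c : R) (f : R -> R) : 0 < c ->
  measurable_fun setT f -> (forall t, 0 <= f t) ->
  (\int[mu]_(t in `[(c / j.+1%:R)%R, (c * j.+1%:R)%R]) (f t)%:E)%E @[j --> \oo]
    --> (\int[mu]_(t in `[0%R, +oo[) (f t)%:E)%E.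
Proof.
move=> c0 mf f0.
have mfE D : measurable_fun D (EFin \o f) by apply/measurable_EFinP/measurable_funTS.
rewrite -integral_itv_obnd_cbnd; last by [].
have -> : `]0%R, +oo[%classic = \bigcup_(j in [set: nat]) (`[(c / j.+1%:R)%R, (c * j.+1%:R)%R]%classic : set R).
  apply/seteqP; split => t /=; rewrite in_itv/= andbT.
    move=> t0; exists (Num.bound (t / c + c / t)) => //=.
    set j := Num.bound _.
    have h : t / c + c / t < j%:R.
      by have := archi_boundP (_ : 0 <= t / c + c / t); apply; rewrite addr_ge0 // divr_ge0 // ltW.
    have tc : 0 < t / c by rewrite divr_gt0.
    have ct : 0 < c / t by rewrite divr_gt0.
    have jj : j%:R < j.+1%:R :> R by rewrite ltr_nat.
    rewrite in_itv/=; apply/andP; split.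
      by rewrite ler_pdivrMr ?ltr0Sn// -ler_pdivrMl// mulrC; lra.
    by rewrite -ler_pdivrMl// mulrC; lra.
  move=> [j _] /=; rewrite in_itv/= => /andP[h _].
  by rewrite (lt_le_trans _ h)// divr_gt0.
apply: ge0_nondecreasing_set_cvg_integral => //.
- move=> i j ij; apply/subsetPset => t /=; rewrite !in_itv/= => /andP[h1 h2].
  have ij' : (i.+1%:R : R) <= j.+1%:R by rewrite ler_nat.
  apply/andP; split.
    by apply: le_trans h1; rewrite ler_pM2l// lef_pV2// posrE ltr0Sn.
  by apply: (le_trans h2); rewrite ler_pM2l.
- by move=> i; exact: mfE.
- by move=> i x _; rewrite lee_fin.
Qed.

Lemma integral_itv_cc_scale (c a b : R) (f : R -> R) : 0 < c -> 0 < a -> a < b ->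
  (forall t, 0 < t -> {for t, continuous f}) ->
  (\int[mu]_(t in `[(c * a)%R, (c * b)%R]) (f t)%:E =
   c%:E * \int[mu]_(t in `[a, b]) (f (c * t)%R)%:E)%E.
Proof.
move=> c0 a0 ab cf.
have cw (u v : R) : 0 < u -> {within `[u, v], continuous f}.
  move=> u0; apply: continuous_in_subspaceT => t; rewrite inE/= in_itv/= => /andP[ut _].
  exact/cf/(lt_le_trans u0 ut).
have dF (x : R) : is_derive x 1 ( *%R c) c.
  by apply: is_derive_eq; rewrite [LHS]mulr1.
have dFE : derive1 ( *%R c) = cst c.
  by apply/funext => x; rewrite derive1E; exact: derive_val.
rewrite (@integration_by_substitution_increasing _ ( *%R c) f a b).
- rewrite dFE; under eq_integral do rewrite /= mulrC EFinM.
  rewrite integralZl//.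
  apply: continuous_compact_integrable; first exact: segment_compact.
  apply: continuous_in_subspaceT => t; rewrite inE/= in_itv/= => /andP[at_ _].
  apply: continuous_comp; first exact: mulrl_continuous.
  by apply: cf; rewrite mulr_gt0// (lt_le_trans a0).
- exact: ltW.
- by move=> x y _ _ xy; rewrite ltr_pM2l.
- by rewrite dFE => x _; exact: cst_continuous.
- by rewrite dFE; exact: is_cvg_cst.
- by rewrite dFE; exact: is_cvg_cst.
- split.
  + by move=> x _; exact: ex_derive.
  + by apply/cvg_at_right_filter; exact: mulrl_continuous.
  + by apply/cvg_at_left_filter; exact: mulrl_continuous.
- by apply: cw; rewrite mulr_gt0.
Qed.

Lemma expX_le_expR (n : nat) (s : R) : 0 <= s -> s ^+ n <= n`!%:R * expR s.
Proof.
move=> s0; case: n => [|n].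
  by rewrite expr0 fact0 mul1r -expR0 ler_expR.
have := expR_ge1Dxn n s0; rewrite -ler_pdivrMl ?ltr0n ?fact_gt0//.
by rewrite mulrC; lra.
Qed.

(* The bound is a multiple of the derivative of [- exp (- sqrt t)]. *)
Lemma chi2_kernel_le (k : nat) (t : R) : (0 < k)%N -> 0 < t ->
  chi2_kernel k t <= (2 * (k.-1)`!%:R * expR 2) *
     (2^-1 * t `^ (2^-1 - 1) * expR (- t `^ (2^-1))).
Proof.
move=> k0 t0; rewrite /chi2_kernel.
set s := t `^ (2^-1); have s0 : 0 < s by rewrite powR_gt0.
have tE : t = s ^+ 2.
  by rewrite /s -powR_mulrn ?powR_ge0// -powRrM mulVf ?powRr1// ltW.
have -> : t `^ (k%:R / 2 - 1) = t `^ (2^-1 - 1) * s ^+ k.-1.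
  rewrite /s -powR_mulrn ?powR_ge0// -powRrM -powRD; last by rewrite (gt_eqF t0) implybT.
  congr (_ `^ _); rewrite -[in LHS](prednK k0) -natr1; by field.
have h := @expX_le_expR k.-1 s (ltW s0).
(* With t = s^2 this is (s - 2)^2 >= 0; exp 2 is the maximum of exp (2 s - s^2 / 2). *)
have h2 : expR s * expR (- t / 2) <= expR 2 * expR (- s).
  rewrite -!expRD ler_expR tE.
  have := sqr_ge0 (s - 2); rewrite !expr2; lra.
have pt := powR_ge0 t (2^-1 - 1).
have -> : 2 * (k.-1)`!%:R * expR 2 * (2^-1 * t `^ (2^-1 - 1) * expR (- s)) =
  t `^ (2^-1 - 1) * ((k.-1)`!%:R * (expR 2 * expR (- s))) by field.
rewrite -mulrA ler_wpM2l//.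
apply: (@le_trans _ _ ((k.-1)`!%:R * expR s * expR (- t / 2))).
  by rewrite ler_wpM2r// expR_ge0.
by rewrite -mulrA ler_wpM2l// ler0n.
Qed.

(** The dominating function has an explicit primitive [F] whose increments are at most 1, so the
    integrals over the compact exhaustion are all bounded by [C]. *)
Lemma chi2_kernel_integrable (k : nat) : (0 < k)%N ->
  mu.-integrable `[0%R, +oo[ (EFin \o @chi2_kernel R k).
Proof.
move=> k0; apply/integrableP; split.
  by apply/measurable_EFinP; apply: measurable_funTS; exact: measurable_chi2_kernel.
under eq_integral do rewrite /= ger0_norm ?chi2_kernel_ge0//.
set C : R := 2 * (k.-1)`!%:R * expR 2.
have C0 : 0 <= C by rewrite mulr_ge0 ?mulr_ge0 ?expR_ge0.
suff h : (\int[mu]_(t in `[0%R, +oo[) (chi2_kernel k t)%:E <= C%:E)%E.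
  exact: (le_lt_trans h (ltry _)).
have cv := @exhaust_itv0y_integral 1 (chi2_kernel k) ltr01 (measurable_chi2_kernel k)
  (chi2_kernel_ge0 k).
apply: (cvge_to_le cv); near=> j.
pose f t : R := 2^-1 * t `^ (2^-1 - 1) * expR (- t `^ (2^-1)).
pose F t : R := - expR (- t `^ (2^-1)).
set a : R := 1 / j.+1%:R; set b : R := 1 * j.+1%:R.
have a0 : 0 < a by rewrite divr_gt0.
have ab : a < b.
  rewrite /a /b !mul1r (@lt_trans _ _ 1)// ?invf_lt1 ?ltr0Sn// ltr1n ltnS;
  by near: j; exists 1%N.
have dF (t : R) : 0 < t -> is_derive t 1 F (f t).
  move=> t0; rewrite /F /f.
  have d1 := is_derive1_powR (2^-1 : R) t0.
  by apply: is_derive_eq; rewrite /GRing.scale/=; ring.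
have cp (p t : R) : 0 < t -> {for t, continuous (fun u : R => u `^ p)}.
  move=> t0; apply: differentiable_continuous; apply/derivable1_diffP.
  by apply: derivable_powR; rewrite in_itv/= t0.
have cF (t : R) : 0 < t -> {for t, continuous F}.
  move=> t0; apply: differentiable_continuous; apply/derivable1_diffP.
  exact: (@ex_derive _ _ _ _ _ _ _ (dF t t0)).
have cf (t : R) : 0 < t -> {for t, continuous f}.
  move=> t0; rewrite /f.
  apply: (@continuousM _ R^o); first by apply: (@continuousM _ R^o); [exact: cst_continuous|exact: cp].
  apply: continuous_comp; last exact: continuous_expR.
  by apply: (@continuousN _ R^o); exact: cp.
have cfw : {within `[a, b], continuous f}.
  apply: continuous_in_subspaceT => t; rewrite inE/= in_itv/= => /andP[at_ _].
  exact/cf/(lt_le_trans a0 at_).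
have intf : (\int[mu]_(t in `[a, b]) (f t)%:E = (F b)%:E - (F a)%:E)%E.
  apply: continuous_FTC2 => //.
  - split.
    + move=> t; rewrite in_itv/= => /andP[at_ _].
      exact: (@ex_derive _ _ _ _ _ _ _ (dF t (lt_trans a0 at_))).
    + exact/cvg_at_right_filter/cF.
    + exact/cvg_at_left_filter/cF/(lt_trans a0).
  - move=> t; rewrite in_itv/= => /andP[at_ _].
    by rewrite derive1E; exact: (@derive_val _ _ _ _ _ _ _ (dF t (lt_trans a0 at_))).
apply: (@le_trans _ _ (\int[mu]_(t in `[a, b]) (C%:E * (f t)%:E))%E).
  apply: ge0_le_integral => //=.
  - by move=> t _; rewrite lee_fin chi2_kernel_ge0.
  - by apply/measurable_EFinP; apply: measurable_funTS; exact: measurable_chi2_kernel.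
  - apply: measurable_funeM; apply/measurable_EFinP.
    exact: subspace_continuous_measurable_fun.
  - move=> t; rewrite in_itv/= => /andP[at_ _].
    by rewrite -EFinM lee_fin chi2_kernel_le// (lt_le_trans a0).
rewrite integralZl//; last first.
  apply: continuous_compact_integrable => //; exact: segment_compact.
rewrite intf -EFinB -EFinM lee_fin ler_piMr// /F opprK.
have := expR_gt0 (- b `^ 2^-1); have : expR (- a `^ 2^-1) <= 1.
  by rewrite expR_le1 oppr_le0 powR_ge0.
lra.
Unshelve. all: by end_near. Qed.

Definition chi2_mass (k : nat) : R := \int[mu]_(t in `[0%R, +oo[) chi2_kernel k t.

(** An exponentially tilted Gamma density is a rescaled one. The substitution later contributes one
    more factor (1 + 2 l)^-1, which turns the exponent into - k / 2. *)
Lemma chi2_kernel_scale (k : nat) (l t : R) : 0 <= l -> 0 < t ->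
  expR (- (l * t)) * chi2_kernel k t =
  (1 + 2 * l) `^ (1 - k%:R / 2) * chi2_kernel k ((1 + 2 * l) * t).
Proof.
move=> l0 t0; rewrite /chi2_kernel; set c := 1 + 2 * l.
have c0 : 0 < c by rewrite /c; lra.
have cc : c `^ (1 - k%:R / 2) * c `^ (k%:R / 2 - 1) = 1.
  rewrite -powRD; last by rewrite (gt_eqF c0) implybT.
  by rewrite (_ : 1 - k%:R / 2 + (k%:R / 2 - 1) = 0) ?powRr0//; ring.
have ee : expR (- (l * t)) * expR (- t / 2) = expR (- (c * t) / 2).
  by rewrite -expRD; congr expR; rewrite /c; field.
rewrite powRM ?ltW// -ee mulrCA; set X := expR _ * expR _.
by rewrite -!mulrA mulrA cc mul1r.
Qed.

Lemma chi2_laplace_integral (k : nat) (l : R) : 0 <= l ->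
  (\int[mu]_(t in `[0%R, +oo[) (expR (- (l * t)) * chi2_kernel k t)%:E =
   ((1 + 2 * l) `^ (- (k%:R / 2)))%:E * \int[mu]_(t in `[0%R, +oo[) (chi2_kernel k t)%:E)%E.
Proof.
move=> l0; set c := 1 + 2 * l; have c0 : 0 < c by rewrite /c; lra.
have mk : measurable_fun setT (fun t : R => expR (- (l * t)) * chi2_kernel k t).
  apply: measurable_funM; last exact: measurable_chi2_kernel.
  apply: measurableT_comp; first exact: measurable_expR.
  by apply: measurableT_comp => //; exact: mulrl_measurable.
have pk (t : R) : 0 <= expR (- (l * t)) * chi2_kernel k t.
  by rewrite mulr_ge0 ?expR_ge0 ?chi2_kernel_ge0.
have L1 := @exhaust_itv0y_integral 1 _ ltr01 mk pk.
have L2 := @exhaust_itv0y_integral c _ c0 (measurable_chi2_kernel k) (chi2_kernel_ge0 k).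
have L3 : (((c `^ (- (k%:R / 2)))%:E * \int[mu]_(t in `[(c / j.+1%:R)%R, (c * j.+1%:R)%R]) (chi2_kernel k t)%:E)%E @[j --> \oo]
    --> ((c `^ (- (k%:R / 2)))%:E * \int[mu]_(t in `[0%R, +oo[) (chi2_kernel k t)%:E)%E).
  exact: cvgeZl.
apply: (cvg_unique (@ereal_hausdorff R) L1); apply: cvg_trans L3; apply: near_eq_cvg.
near=> j; rewrite div1r mul1r.
have a0 : 0 < j.+1%:R^-1 :> R by rewrite invr_gt0 ltr0Sn.
rewrite (@integral_itv_cc_scale c (j.+1%:R^-1) j.+1%:R (chi2_kernel k))//; last 2 first.
- rewrite (@lt_trans _ _ 1)// ?invf_lt1 ?ltr0Sn// ltr1n ltnS; by near: j; exists 1%N.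
- by move=> t; exact: continuous_chi2_kernel.
under [RHS]eq_integral.
  move=> t; rewrite inE/= in_itv/= => /andP[at_ _].
  rewrite chi2_kernel_scale// ?(lt_le_trans a0)// -/c EFinM.
  over.
rewrite ge0_integralZl//=; last 3 first.
- apply/measurable_EFinP; apply: measurable_funTS.
  by apply: measurableT_comp; [exact: measurable_chi2_kernel|exact: mulrl_measurable].
- by move=> t _; rewrite lee_fin chi2_kernel_ge0.
- by rewrite lee_fin powR_ge0.
rewrite muleA -EFinM; congr (_%:E * _)%E.
rewrite -[X in _ * X](powRr1 (ltW c0)) -powRD; last by rewrite (gt_eqF c0) implybT.
by rewrite addrC.
Unshelve. all: by end_near. Qed.

Lemma chi2_laplace_integrable (k : nat) (l : R) : (0 < k)%N -> 0 <= l ->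
  mu.-integrable `[0%R, +oo[ (fun t => (expR (- (l * t)) * chi2_kernel k t)%:E).
Proof.
move=> k0 l0; apply: (le_integrable _ _ _ (chi2_kernel_integrable k0)) => //=.
  apply/measurable_EFinP; apply: measurable_funTS.
  apply: measurable_funM; last exact: measurable_chi2_kernel.
  apply: measurableT_comp; first exact: measurable_expR.
  by apply: measurableT_comp => //; exact: mulrl_measurable.
move=> t; rewrite in_itv/= andbT => t0; rewrite lee_fin normrM ler_piMl//.
by rewrite ger0_norm ?expR_ge0// expR_le1 oppr_le0 mulr_ge0.
Qed.

Lemma chi2_laplace (k : nat) (l : R) : (0 < k)%N -> 0 <= l ->
  \int[mu]_(t in `[0%R, +oo[) (expR (- (l * t)) * chi2_kernel k t) =
  (1 + 2 * l) `^ (- (k%:R / 2)) * chi2_mass k.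
Proof.
move=> k0 l0; rewrite /chi2_mass /Rintegral chi2_laplace_integral//.
by rewrite fineM//; exact/integrable_fin_num/chi2_kernel_integrable.
Qed.

Lemma chi2_mass_gt0 (k : nat) : (0 < k)%N -> 0 < chi2_mass k.
Proof.
move=> k0.
have i1 : mu.-integrable `[1%R, 2%R] (EFin \o @chi2_kernel R k).
  apply: integrableS (chi2_kernel_integrable k0) => // t /=; rewrite !in_itv/= andbT.
  by move=> /andP[h _]; rewrite (le_trans _ h).
have [c c12 cmin] : exists2 c : R, c \in `[1, 2] & forall t, t \in `[1, 2] -> chi2_kernel k c <= chi2_kernel k t.
  apply: EVT_min; first by rewrite ler1n.
  apply: continuous_in_subspaceT => t; rewrite inE/= in_itv/= => /andP[t1 _].
  exact/continuous_chi2_kernel/(lt_le_trans ltr01 t1).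
have kc : 0 < chi2_kernel k c.
  rewrite /chi2_kernel mulr_gt0 ?expR_gt0// powR_gt0//.
  by move: c12; rewrite in_itv/= => /andP[h _]; rewrite (lt_le_trans _ h).
apply: (lt_le_trans kc).
apply: (@le_trans _ _ (\int[mu]_(t in `[1%R, 2%R]) chi2_kernel k t)).
  have -> : chi2_kernel k c = \int[mu]_(t in `[1%R, 2%R]) cst (chi2_kernel k c) t.
    rewrite Rintegral_cst//= lebesgue_measure_itv/= lte_fin ltr1n/=.
    by rewrite (_ : 2 - 1 = 1 :> R) ?mulr1//; ring.
  apply: le_Rintegral => //.
    apply: continuous_compact_integrable; first exact: segment_compact.
    by apply: continuous_subspaceT => x; exact: cst_continuous.
rewrite /chi2_mass /Rintegral fine_le//.
- exact: integrable_fin_num.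
- exact/integrable_fin_num/chi2_kernel_integrable.
- apply: ge0_subset_integral => //.
  + by apply/measurable_EFinP; apply: measurable_funTS; exact: measurable_chi2_kernel.
  + by move=> t _; rewrite lee_fin chi2_kernel_ge0.
  + move=> t /=; rewrite !in_itv/= andbT => /andP[h _]; by rewrite (le_trans _ h).
Qed.

Lemma chi2_cdfE (k : nat) (x : R) : 0 <= x ->
  chi2_cdf k x = (\int[mu]_(t in `[0%R, x]) chi2_kernel k t) / chi2_mass k.
Proof. by move=> x0; rewrite /chi2_cdf ltNge x0. Qed.

(** Continuity of the integral in its upper bound, among nonnegative points; at x = 0 it is
    continuity from the right. *)
Lemma chi2_cdf_continuous (k : nat) (x e : R) : (0 < k)%N -> 0 <= x -> 0 < e ->
  exists2 d, 0 < d & forall y, 0 <= y -> `|x - y| <= d -> `|chi2_cdf k x - chi2_cdf k y| <= e.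
Proof.
move=> k0 x0 e0.
have Z0 := chi2_mass_gt0 k0.
have ix : mu.-integrable `[0%R, (x + 1)%R] (EFin \o @chi2_kernel R k).
  apply: integrableS (chi2_kernel_integrable k0) => // t /=; rewrite !in_itv/= andbT.
  by move=> /andP[h _].
have x1 : 0 <= x + 1 by lra.
have := parameterized_integral_continuous x1 ix.
have x1' : 0 < x + 1 by lra.
move/(continuous_within_itvP _ x1') => [cin c0 _].
suff [d d0 hd] : exists2 d, 0 < d & forall y, 0 <= y -> `|x - y| < d ->
    `|\int[mu]_(t in `[0%R, x]) chi2_kernel k t - \int[mu]_(t in `[0%R, y]) chi2_kernel k t| <= e * chi2_mass k.
  exists (d / 2); first by rewrite divr_gt0.
  move=> y y0 xy; rewrite !chi2_cdfE// -mulrBl normrM.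
  rewrite (gtr0_norm (_ : 0 < (chi2_mass k)^-1)) ?invr_gt0//.
  by rewrite ler_pdivrMr//; apply: hd => //; lra.
have eZ := mulr_gt0 e0 Z0.
move: x0; rewrite le_eqVlt => /predU1P[x0|x0].
  rewrite -x0 in c0 *; move/cvgrPdist_le: c0 => /(_ _ eZ) /nbhs_ballP[d /= d0 hd].
  exists d => // y; rewrite le_eqVlt => /predU1P[<- _|y0 yd].
    by rewrite subrr normr0 ltW.
  exact: hd.
have xin : x \in `]0, (x + 1)%R[ by rewrite in_itv/= x0; lra.
have := cin _ xin; move/cvgrPdist_le => /(_ _ eZ) /nbhs_ballP[d /= d0 hd].
by exists d => // y y0 yd; exact: hd.
Qed.

(** * From Laplace transforms to distribution functions by polynomial steps *)

Lemma Bernoulli_ler (y : R) (m : nat) : 0 <= y <= 1 -> 1 - m%:R * y <= (1 - y) ^+ m.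
Proof.
move=> /andP[y0 y1]; elim: m => [|m IH]; first by rewrite expr0 mul0r subr0.
have my : 0 <= m%:R * y by rewrite mulr_ge0.
rewrite exprS -natr1; apply: (@le_trans _ _ ((1 - y) * (1 - m%:R * y))).
  by have := mulr_ge0 y0 my; lra.
by rewrite ler_wpM2l// subr_ge0.
Qed.

(* For [v] in [0, 1], [(1 - v ^ n) ^ (2 ^ n)] tends to 1 if [v < 1/2] and to 0 if
   [v > 1/2]; [l] is chosen so that [exp (- l x) = 1/2]. *)
Lemma step_poly (x d e : R) : 0 < x -> 0 < d -> 0 < e ->
  exists2 l : R, 0 < l & exists p : {poly R}, forall t, 0 <= t ->
    [/\ 0 <= p.[expR (- (l * t))] <= 1,
        t <= x - d -> 1 - e <= p.[expR (- (l * t))] &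
        x + d <= t -> p.[expR (- (l * t))] <= e].
Proof.
move=> x0 d0 e0; have l2 : 0 < ln (2 : R) by rewrite ln_gt0// ltr1n.
set l := ln 2 / x; have l0 : 0 < l by rewrite divr_gt0.
exists l => //.
have ld : 0 < l * d by rewrite mulr_gt0.
have [n hn] : exists n : nat, e^-1 <= (l * d) * n%:R.
  exists (Num.bound (e^-1 / (l * d))); rewrite mulrC -ler_pdivrMr//; apply/ltW.
  by have := archi_boundP (_ : 0 <= e^-1 / (l * d)); apply; rewrite divr_ge0 ?invr_ge0 ?ltW.
have hE : expR (- (l * d * n%:R)) <= e.
  rewrite expRN -[leRHS]invrK lef_pV2 ?posrE ?expR_gt0 ?invr_gt0//.
  have := expR_ge1Dx (l * d * n%:R); lra.
(* The complement is taken so as to approximate the indicator of t <= x. *)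
exists (1 - (1 - 'X^n) ^+ (2 ^ n)) => t t0.
set v := expR _; have v0 : 0 < v := expR_gt0 _.
have v1 : v <= 1 by rewrite expR_le1 oppr_le0 mulr_ge0// ltW.
have vn : 0 <= v ^+ n <= 1.
  by apply/andP; split; [exact/exprn_ge0/ltW|apply: exprn_ile1 => //; exact: ltW].
have -> : (1 - (1 - 'X^n) ^+ (2 ^ n)).[v] = 1 - (1 - v ^+ n) ^+ (2 ^ n).
  by rewrite !hornerE.
have y01 : 0 <= 1 - v ^+ n <= 1.
  by move: vn => /andP[vn0 vn1]; rewrite subr_ge0 vn1 gerBl.
have q01 : 0 <= (1 - v ^+ n) ^+ (2 ^ n) <= 1.
  by rewrite exprn_ge0 ?exprn_ile1//; move: y01 => /andP[].
(* Since exp (l x) = 2, this quantity is at least exp (n l d) on one side of the window and at most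
   exp (- n l d) on the other. It controls (1 - v^n)^(2^n), which is at most exp (- 2^n v^n) and, by
   Bernoulli, at least 1 - 2^n v^n. *)
have v2 : (2 ^ n)%:R * v ^+ n = expR ((l * (x - t)) * n%:R).
  rewrite natrX -exprMn expRM_natr; congr (_ ^+ _).
  rewrite -{1}[2]lnK ?posrE// /v -expRD; congr expR.
  by rewrite /l; field; rewrite gt_eqF.
split; first by move: q01 => /andP[q0 q1]; rewrite subr_ge0 q1 gerBl.
- move=> tx; rewrite lerD2l lerN2.
  apply: (@le_trans _ _ (expR (- ((2 ^ n)%:R * v ^+ n)))).
    rewrite -mulrN expRM_natl; apply: lerXn2r.
    + by rewrite nnegrE; move: y01 => /andP[].
    + by rewrite nnegrE expR_ge0.
    + by have := expR_ge1Dx (- v ^+ n).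
  rewrite v2 expRN -[leRHS]invrK lef_pV2 ?posrE ?expR_gt0 ?invr_gt0//.
  apply: (@le_trans _ _ (l * (x - t) * n%:R)); last first.
    by have := expR_ge1Dx (l * (x - t) * n%:R); have := expR_ge1Dx (expR (l * (x - t) * n%:R)); lra.
  apply: (le_trans hn); rewrite ler_wpM2r// ler_pM2l//; lra.
- move=> tx; have := @Bernoulli_ler (v ^+ n) (2 ^ n) vn; rewrite v2 => h.
  rewrite lerBlDr -lerBlDl; apply: le_trans h; rewrite lerD2l lerN2.
  apply: le_trans hE; rewrite ler_expR -mulNr ler_wpM2r// -mulrN ler_pM2l//; lra.
Qed.

Lemma chi2_poly_integrable (k : nat) (l : R) (p : {poly R}) : (0 < k)%N -> 0 <= l ->
  mu.-integrable `[0%R, +oo[ (fun t => (p.[expR (- (l * t))] * chi2_kernel k t)%:E) /\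
  \int[mu]_(t in `[0%R, +oo[) (p.[expR (- (l * t))] * chi2_kernel k t) =
  (\sum_(j < size p) p`_j * (1 + 2 * (l * j%:R)) `^ (- (k%:R / 2))) * chi2_mass k.
Proof.
move=> k0 l0.
pose f (j : nat) (t : R) : R := p`_j * (expR (- (l * j%:R * t)) * chi2_kernel k t).
have fi j : mu.-integrable `[0%R, +oo[ (fun t => (f j t)%:E).
  rewrite (_ : (fun t => (f j t)%:E) = (fun t => ((p`_j)%:E * (expR (- (l * j%:R * t)) * chi2_kernel k t)%:E)%E)); last by apply/funext => t; rewrite -EFinM.
  by apply: integrableZl => //; apply: chi2_laplace_integrable => //; rewrite mulr_ge0.
have E (t : R) : p.[expR (- (l * t))] * chi2_kernel k t = \sum_(j < size p) f j t.
  rewrite horner_coef mulr_suml; apply: eq_bigr => j _; rewrite /f -mulrA.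
  by rewrite -expRM_natr; congr (_ * (expR _ * _)); ring.
split.
  rewrite (_ : (fun t => _) = (fun t : R => (\sum_(j < size p) (f j t)%:E)%E)); last first.
    by apply/funext => t; rewrite E -sumEFin.
  by apply: integrable_sum => // j _; exact: fi.
rewrite /Rintegral; under eq_integral do rewrite E -sumEFin.
rewrite integral_sum//.
rewrite -sum_fine; last by move=> j _; apply: integrable_fin_num.
rewrite mulr_suml; apply: eq_bigr => j _.
rewrite -[LHS]/(\int[mu]_(t in `[0%R, +oo[) (f j t)) /f RintegralZl//; last first.
  by apply: chi2_laplace_integrable => //; rewrite mulr_ge0.
by rewrite chi2_laplace ?mulr_ge0// mulrA.
Qed.

(** The indicators of t <= x - d and t <= x + d bound p up to e; both inequalities are integrated
    against the normalized kernel. The middle sum is the integral of p, as powers of exp (- l t) are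
    again exponentials. For x - d < 0 the lower bound is just p >= 0. *)
Lemma chi2_cdf_poly_sandwich (k : nat) (x d e l : R) (p : {poly R}) : (0 < k)%N ->
  0 <= l -> 0 <= e -> 0 <= x + d ->
  (forall t, 0 <= t ->
    [/\ 0 <= p.[expR (- (l * t))] <= 1,
        t <= x - d -> 1 - e <= p.[expR (- (l * t))] &
        x + d <= t -> p.[expR (- (l * t))] <= e]) ->
  chi2_cdf k (x - d) - e <=
  \sum_(j < size p) p`_j * (1 + 2 * (l * j%:R)) `^ (- (k%:R / 2)) <=
  chi2_cdf k (x + d) + e.
Proof.
move=> k0 l0 e0 xd0 hp.
have [ip Ip] := @chi2_poly_integrable k l p k0 l0.
have Z0 := chi2_mass_gt0 k0.
have ik := chi2_kernel_integrable k0.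
have iek : mu.-integrable `[0%R, +oo[ (fun t => (e * chi2_kernel k t)%:E).
  rewrite (_ : (fun t => _) = (fun t : R => (e%:E * (chi2_kernel k t)%:E)%E)); last first.
    by apply/funext => t; rewrite -EFinM.
  exact: integrableZl.
have sub y : (`[0%R, y] : set R) `<=` `[0%R, +oo[ .
  by move=> t /=; rewrite !in_itv/= andbT => /andP[].
have ind y : mu.-integrable `[0%R, +oo[ (fun t => ((chi2_kernel k \_ `[0%R, y]) t)%:E) /\
   \int[mu]_(t in `[0%R, +oo[) ((chi2_kernel k \_ `[0%R, y]) t) = \int[mu]_(t in `[0%R, y]) chi2_kernel k t.
  split; last first.
    by rewrite -Rintegral_mkcondr; congr (Rintegral _ _ _); apply/setIidr.
  have -> : (fun t => ((chi2_kernel k \_ `[0%R, y]) t)%:E) = (EFin \o @chi2_kernel R k) \_ `[0%R, y].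
    by rewrite restrict_EFin.
  apply/integrable_restrict => //; rewrite (setIidr (@sub y)).
  by apply: integrableS ik.
have ind_in y (t : R) : 0 <= t <= y -> (chi2_kernel k \_ `[0%R, y]) t = chi2_kernel k t.
  by move=> h; rewrite patchE mem_set//= in_itv.
have ind_out y (t : R) : y < t -> (chi2_kernel k \_ `[0%R, y]) t = 0.
  by move=> h; rewrite patchE memNset//= in_itv/= => /andP[_]; rewrite leNgt h.
have kp := chi2_kernel_ge0 k.
apply/andP; split.
  have [xd|xd] := ltP (x - d) 0.
    rewrite /chi2_cdf xd sub0r -(ler_pM2r Z0) -Ip.
    apply: (@le_trans _ _ 0); first by rewrite mulNr oppr_le0 mulr_ge0// ltW.
    apply: Rintegral_ge0 => t /=; rewrite in_itv/= andbT => t0.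
    by rewrite mulr_ge0//; have [/andP[]] := hp t t0.
  rewrite chi2_cdfE// -(ler_pM2r Z0) -Ip mulrBl mulfVK ?gt_eqF//.
  rewrite -RintegralZl// -(ind (x - d)).2 -RintegralB//; last exact: (ind _).1.
  apply: le_Rintegral => //=.
    exact: (integrableB _ (ind (x - d)).1 iek).
  move=> t; rewrite in_itv/= andbT => t0; have [/andP[p0 p1] hp1 hp2] := hp t t0.
  have [tx|tx] := leP t (x - d).
    rewrite ind_in ?t0// -[X in X - _]mul1r -mulrBl ler_wpM2r//; exact: hp1.
  rewrite ind_out// sub0r; have := mulr_ge0 e0 (kp t); have := mulr_ge0 p0 (kp t); lra.
rewrite chi2_cdfE// -(ler_pM2r Z0) -Ip mulrDl mulfVK ?gt_eqF//.
rewrite -RintegralZl// -(ind (x + d)).2 -RintegralD//; last exact: (ind _).1.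
apply: le_Rintegral => //=.
  exact: (integrableD _ (ind (x + d)).1 iek).
move=> t; rewrite in_itv/= andbT => t0; have [/andP[p0 p1] hp1 hp2] := hp t t0.
have [tx|tx] := leP t (x + d).
  rewrite ind_in ?t0// -[X in X + _]mul1r -mulrDl ler_wpM2r//; lra.
rewrite ind_out// add0r ler_wpM2r//; exact/hp2/ltW.
Qed.


Lemma cvgr_bigsum (U I : Type) (F : set_system U) {FF : Filter F} (r : seq I)
    (f : I -> U -> R) (a : I -> R) :
  (forall i, f i @ F --> a i) -> (\sum_(i <- r) f i u)%R @[u --> F] --> (\sum_(i <- r) a i)%R.
Proof.
move=> fa; elim: r => [|i r IH].
  rewrite big_nil (_ : (fun u => _) = cst 0); first exact: cvg_cst.
  by apply/funext => u; rewrite big_nil.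
rewrite big_cons (_ : (fun u => _) = (fun u => f i u + \sum_(j <- r) f j u)).
  exact: cvgD.
by apply/funext => u; rewrite big_cons.
Qed.

(** The step polynomial is sandwiched in the same way under the laws [P] and under the chi-squared
    law, and its expectations converge, being linear combinations of Laplace transforms. Continuity
    of the limit closes the window. *)
Lemma laplace_cvg_cdf (T : nat -> finType) (P Q : forall N, T N -> R) (k : nat) :
  (0 < k)%N -> (forall N w, 0 <= P N w) -> (forall N, \sum_w P N w = 1) ->
  (forall N w, 0 <= Q N w) ->
  (forall l, 0 < l ->
    (\sum_w P N w * expR (- (l * Q N w))) @[N --> \oo] --> (1 + 2 * l) `^ (- (k%:R / 2))) ->
  forall x : R, 0 <= x ->
    (\sum_w P N w * (Q N w <= x)%R%:R)%R @[N --> \oo] --> chi2_cdf k x.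
Proof.
move=> k0 P0 P1 Q0 hL x x0.
have E_cst N (c : R) : \sum_w P N w * c = c by rewrite -mulr_suml P1 mul1r.
have E_le N (f g : T N -> R) : (forall w, f w <= g w) ->
    \sum_w P N w * f w <= \sum_w P N w * g w.
  by move=> fg; apply: ler_sum => w _; rewrite ler_wpM2l.
have hp (l : R) (p : {poly R}) : 0 < l ->
    (\sum_w P N w * p.[expR (- (l * Q N w))]) @[N --> \oo] -->
    \sum_(j < size p) p`_j * (1 + 2 * (l * j%:R)) `^ (- (k%:R / 2)).
  move=> l0.
  rewrite (_ : (fun N => _) = (fun N => \sum_(j < size p) p`_j *
     \sum_w P N w * expR (- (l * j%:R * Q N w)))); last first.
    apply/funext => N.
    under eq_bigr => w _ do rewrite horner_coef mulr_sumr.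
    rewrite exchange_big; apply: eq_bigr => j _; rewrite mulr_sumr.
    apply: eq_bigr => w _; rewrite mulrCA -expRM_natr; congr (_ * (_ * expR _)); ring.
  apply: cvgr_bigsum => j; apply: cvgM; first exact: cvg_cst.
  (* [hL] asks for a positive rate, so the constant coefficient, of expectation 1, is treated
     apart. *)
  case: j => [[|j] jp] /=; last by apply: hL; rewrite mulr_gt0.
  rewrite mulr0 mulr0 addr0 powR1.
  rewrite (_ : (fun N => _) = cst 1); first exact: cvg_cst.
  by apply/funext => N; under eq_bigr do rewrite mul0r oppr0 expR0; exact: E_cst.
(* The error 3 e gathers the two sandwiches and the convergence of the expectations. *)
have key (y d e : R) : 0 < y -> 0 < d -> 0 < e ->
    \forall N \near \oo,
      \sum_w P N w * (Q N w <= y - d)%R%:R <= chi2_cdf k (y + d) + 3 * e /\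
      chi2_cdf k (y - d) - 3 * e <= \sum_w P N w * (Q N w <= y + d)%R%:R.
  move=> y0 d0 e0; have [l l0 [p pP]] := step_poly y0 d0 e0.
  have yd : 0 <= y + d by lra.
  have /andP[s1 s2] := chi2_cdf_poly_sandwich k0 (ltW l0) (ltW e0) yd pP.
  have /cvgrPdist_le /(_ e e0) := hp l p l0.
  apply: filterS => N; set L := \sum_(j < _) _ in s1 s2 *; set EN := \sum_w _ => LE.
  have u1 : \sum_w P N w * (Q N w <= y - d)%R%:R - e <= EN.
    rewrite -[X in _ - X](E_cst N) -sumrB; under eq_bigr do rewrite -mulrBr.
    apply: E_le => w; have [/andP[p0 p1] h1 h2] := pP _ (Q0 N w).
    by case: (leP (Q N w) (y - d)) => [/h1|] /=; lra.
  have u2 : EN <= \sum_w P N w * (Q N w <= y + d)%R%:R + e.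
    rewrite -[X in _ <= _ + X](E_cst N) -big_split/=; under [leRHS]eq_bigr do rewrite -mulrDr.
    apply: E_le => w; have [/andP[p0 p1] h1 h2] := pP _ (Q0 N w).
    case: (leP (Q N w) (y + d)) => [_|/ltW/h2] /=; lra.
  move: LE; rewrite ler_distl => /andP[LE1 LE2]; lra.
apply/cvgrPdist_le => e e0.
have e4 : 0 < e / 4 by lra.
have [d d0 hd] := chi2_cdf_continuous k0 x0 e4.
have d2 : 0 < d / 2 by lra.
have xd2 : 0 < x + d / 2 by lra.
(* The window is centred at x + d / 2 so that its left end is exactly x; for the lower bound its
   right end will be x. *)
have up := key (x + d / 2) (d / 2) (e / 4) xd2 d2 e4.
have Fd (y : R) : 0 <= y -> `|x - y| <= d -> 
    chi2_cdf k y - e / 4 <= chi2_cdf k x <= chi2_cdf k y + e / 4.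
  by move=> y0 yd; rewrite -ler_distl; exact: hd.
have /andP[Fu _] : chi2_cdf k (x + d) - e / 4 <= chi2_cdf k x <= chi2_cdf k (x + d) + e / 4.
  by apply: Fd; [lra|rewrite opprD addNKr normrN gtr0_norm].
have lo : \forall N \near \oo, chi2_cdf k x - e <= \sum_w P N w * (Q N w <= x)%R%:R.
  move: (x0); rewrite le_eqVlt => /predU1P[x00|xp].
    near=> N; apply: (@le_trans _ _ 0); last by apply: sumr_ge0 => w _; rewrite mulr_ge0.
    by rewrite -x00 chi2_cdfE// set_itv1 Rintegral_set1 mul0r sub0r oppr_le0 ltW.
  pose d' := Num.min d x.
  have d'0 : 0 < d' by rewrite lt_min d0.
  have d'd : d' <= d by rewrite ge_min lexx.
  have d'x : d' <= x by rewrite ge_min lexx orbT.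
  have xd' : 0 < x - d' / 2 by lra.
  have d'2 : 0 < d' / 2 by lra.
  have := key (x - d' / 2) (d' / 2) (e / 4) xd' d'2 e4.
  have /andP[_ Fl] : chi2_cdf k (x - d') - e / 4 <= chi2_cdf k x <= chi2_cdf k (x - d') + e / 4.
    by apply: Fd; [lra|rewrite opprB subrKC gtr0_norm].
  apply: filterS => N [_].
  rewrite (_ : x - d' / 2 - d' / 2 = x - d'); last by lra.
  rewrite subrK; lra.
near=> N; rewrite ler_distl; apply/andP; split; last first.
  have : chi2_cdf k x - e <= \sum_w P N w * (Q N w <= x)%R%:R by near: N.
  lra.
have [+ _] : \sum_w P N w * (Q N w <= x + d / 2 - d / 2)%R%:R <= chi2_cdf k (x + d / 2 + d / 2) + 3 * (e / 4) /\
      chi2_cdf k (x + d / 2 - d / 2) - 3 * (e / 4) <= \sum_w P N w * (Q N w <= x + d / 2 + d / 2)%R%:R.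
  by near: N.
rewrite addrK (_ : x + d / 2 + d / 2 = x + d); last by lra.
lra.
Unshelve. all: by end_near. Qed.

End Chi2Kernel.

(** * Lindeberg replacement along an explicit heat flow *)

Section HeatStep.
Variable R : realType.

(** Mean value theorem. Iterated from exp, it gives Taylor remainders valid on the whole line; the
    factorials are given up for simplicity. *)
Lemma derive_bound_pow_expR (f df : R -> R) (n : nat) :
  (forall x : R, is_derive x 1 f (df x)) -> f 0 = 0 ->
  (forall x, `|df x| <= `|x| ^+ n * expR `|x|) ->
  forall x, `|f x| <= `|x| ^+ n.+1 * expR `|x|.
Proof.
move=> fd f0 dfb x.
have cf : continuous f.
  move=> y; apply: differentiable_continuous; apply/derivable1_diffP.
  exact: (@ex_derive _ _ _ _ _ _ _ (fd y)).
suff [c cx ->] : exists2 c, `|c| <= `|x| & f x = df c * x.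
  rewrite normrM exprSr -mulrAC ler_wpM2r//; apply: (le_trans (dfb c)).
  by rewrite ler_pM ?exprn_ge0 ?expR_ge0// ?lerXn2r ?nnegrE// ler_expR.
have [x0|x0|->] := ltgtP x 0.
- have [c] := @MVT_segment R f df x 0 (ltW x0) (fun y _ => fd y) (continuous_subspaceT cf).
  rewrite in_itv/= f0 !sub0r => /andP[c1 c2] E; exists c.
    by rewrite !ler0_norm ?lerN2// ltW.
  by apply: oppr_inj; rewrite E mulrN.
- have [c] := @MVT_segment R f df 0 x (ltW x0) (fun y _ => fd y) (continuous_subspaceT cf).
  rewrite in_itv/= f0 !subr0 => /andP[c1 c2] E; exists c => //.
  by rewrite !ger0_norm// ltW.
- by exists 0; rewrite ?mulr0.
Qed.

Lemma expR_taylor0 (x : R) : `|expR x - 1| <= `|x| * expR `|x|.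
Proof.
have := @derive_bound_pow_expR (fun x => expR x - 1) expR 0 _ _ _ x.
rewrite expr1; apply.
- by move=> y; apply: is_derive_eq; rewrite subr0.
- by rewrite expR0 subrr.
- by move=> y; rewrite expr0 mul1r ger0_norm ?expR_ge0// ler_expR ler_norm.
Qed.

Lemma expR_taylor1 (x : R) : `|expR x - 1 - x| <= `|x| ^+ 2 * expR `|x|.
Proof.
apply: (@derive_bound_pow_expR (fun x => expR x - 1 - x) (fun x => expR x - 1) 1).
- by move=> y; apply: is_derive_eq; rewrite subr0.
- by rewrite expR0 subrr subr0.
- by move=> y; rewrite expr1; exact: expR_taylor0.
Qed.

Lemma expR_taylor2 (x : R) :
  `|expR x - 1 - x - x ^+ 2 / 2| <= `|x| ^+ 3 * expR `|x|.
Proof.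
apply: (@derive_bound_pow_expR (fun x => expR x - 1 - x - x ^+ 2 / 2) (fun x => expR x - 1 - x) 2).
- by move=> y; apply: is_derive_eq; rewrite subr0 /GRing.scale/=; field.
- by rewrite expR0 expr0n/= mul0r !subr0 subrr.
- exact: expR_taylor1.
Qed.

Lemma ln1D_bounds (t : R) : 0 <= t -> t - t ^+ 2 <= ln (1 + t) <= t.
Proof.
move=> t0; have t1 : 0 < 1 + t by lra.
apply/andP; split; last by rewrite -ler_expR lnK ?posrE// expR_ge1Dx.
have h : ln (1 + t)^-1 <= (1 + t)^-1 - 1.
  rewrite -ler_expR lnK ?posrE ?invr_gt0//.
  by have := expR_ge1Dx ((1 + t)^-1 - 1); rewrite subrKC.
rewrite lnV ?posrE// in h.
suff : (1 + t)^-1 - 1 <= t ^+ 2 - t by lra.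
rewrite -(ler_pM2r t1) mulrBl mulVf ?gt_eqF//.
have := exprn_ge0 3 t0; rewrite !exprS expr0 mulr1; lra.
Qed.

(* [heat k l (1 + 2 l s) |u|^2] is the value at [u] of the Gaussian smoothing of
   variance [s] of [exp (- l |.|^2)] in dimension [k]. *)
Definition heat (k : nat) (l a w : R) : R := expR (- (k%:R / 2 * ln a) - l * w / a).

Lemma heat_shift (k : nat) (l a w x : R) : 0 < a ->
  heat k l a (w + x) = heat k l a w * expR (- (l / a * x)).
Proof. by move=> a0; rewrite /heat -expRD; congr expR; field; rewrite gt_eqF. Qed.

Lemma heat_flow (k : nat) (l a w c : R) : 0 < l -> 0 < a -> 0 <= c ->
  heat k l (a + 2 * l * c) w = heat k l a w *
   expR (- (k%:R / 2 * ln (1 + 2 * (l / a) * c)) +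
           l / a * w * (2 * (l / a) * c / (1 + 2 * (l / a) * c))).
Proof.
move=> l0 a0 c0; set b := l / a; have b0 : 0 < b by rewrite divr_gt0.
have t0 : 0 <= 2 * b * c.
 by rewrite mulr_ge0 ?mulr_ge0 ?invr_ge0 ?(ltW l0) ?(ltW a0).
have t1 : 0 < 1 + 2 * b * c by lra.
have -> : a + 2 * l * c = a * (1 + 2 * b * c) by rewrite /b; field; rewrite gt_eqF.
rewrite /heat lnM ?posrE// -expRD; congr expR; rewrite -(_ : b * a = l); last first.
  by rewrite /b mulfVK// gt_eqF.
by field; rewrite !gt_eqF.
Qed.

Lemma heat_le (k : nat) (l a w : R) : 1 <= a -> heat k l a w <= expR (- (l / a * w)).
Proof.
move=> a1; rewrite ler_expR.
have : 0 <= k%:R / 2 * ln a by rewrite mulr_ge0 ?ln_ge0 ?divr_ge0.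
have -> : l * w / a = l / a * w by rewrite mulrAC.
lra.
Qed.

(** Here w = |u|^2 for the partial sum u, [s v] is the inner product of u with the increment and
    [m v] the squared norm of the increment, so the exponent is the change of - b |u|^2. At second
    order only the square of s contributes to the main term; the products s m and m^2 are already of
    order d^3. *)
Lemma heat_step_space (b K c d w : R) (k : nat) (T : finType) (p s m : T -> R) :
  0 < b -> b <= K -> 0 <= w -> 0 <= d <= 1 ->
  (forall v, 0 <= p v) -> \sum_v p v = 1 -> \sum_v p v * s v = 0 ->
  \sum_v p v * s v ^+ 2 = c * w -> \sum_v p v * m v = k%:R * c ->
  (forall v, 0 <= m v <= d ^+ 2) -> (forall v, 2 * `|s v| <= d * (w + 1)) ->
  `|\sum_v p v * expR (- (b * (2 * s v + m v))) - (1 - b * k%:R * c + 2 * b ^+ 2 * c * w)|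
  <= (b ^+ 3 + 2 * b ^+ 2) * (d ^+ 3 * (w + 2) ^+ 3 * expR (d * K * (w + 2))).
Proof.
move=> b0 bK w0 /andP[d0 d1] p0 p1 Es Es2 Em m0 sb.
set y := w + 2; set Ex := expR _.
have y1 : 1 <= y by rewrite /y; lra.
have Ex1 : 1 <= Ex.
  rewrite -expR0 ler_expR !mulr_ge0//; [exact: le_trans (ltW b0) bK|lra].
pose z v := - (b * (2 * s v + m v)).
pose r v := expR (z v) - 1 - z v - z v ^+ 2 / 2.
have -> : \sum_v p v * expR (z v) - (1 - b * k%:R * c + 2 * b ^+ 2 * c * w) =
    \sum_v p v * (r v + b ^+ 2 * (2 * s v * m v + m v ^+ 2 / 2)).
  rewrite (_ : 1 - b * k%:R * c + 2 * b ^+ 2 * c * w = \sum_v p v * (1 - b * (2 * s v + m v) + 2 * b ^+ 2 * s v ^+ 2)).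
    by rewrite -sumrB; apply: eq_bigr => v _; rewrite /r /z; field.
  transitivity (\sum_v p v - 2 * b * (\sum_v p v * s v) - b * (\sum_v p v * m v) + 2 * b ^+ 2 * \sum_v p v * s v ^+ 2).
    by rewrite p1 Es Es2 Em; ring.
  by rewrite !mulr_sumr -!sumrB -big_split/=; apply: eq_bigr => v _; ring.
apply: (le_trans (ler_norm_sum _ _ _)).
set B := (X in _ <= X).
have -> : B = \sum_v p v * B by rewrite -mulr_suml p1 mul1r.
apply: ler_sum => v _.
rewrite normrM (ger0_norm (p0 v)) ler_wpM2l//.
have /andP[mv0 mv1] := m0 v; have sv := sb v.
have d2d : d ^+ 2 <= d by rewrite expr2 ler_piMr.
have zb : `|z v| <= b * d * y.
  rewrite /z normrN normrM gtr0_norm// -mulrA ler_pM2l//.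
  apply: (le_trans (ler_normD _ _)); rewrite normrM (ger0_norm mv0) ger0_norm//.
  rewrite /y; lra.
have bdy : 0 <= b * d * y by rewrite !mulr_ge0 ?(ltW b0)//; lra.
have rb : `|r v| <= b ^+ 3 * (d ^+ 3 * y ^+ 3 * Ex).
  apply: (le_trans (expR_taylor2 (z v))).
  have -> : b ^+ 3 * (d ^+ 3 * y ^+ 3 * Ex) = (b * d * y) ^+ 3 * Ex by ring.
  apply: ler_pM; rewrite ?exprn_ge0 ?expR_ge0//; first by rewrite lerXn2r ?nnegrE.
  rewrite ler_expR; apply: (le_trans zb).
  by rewrite ler_wpM2r ?(le_trans ler01)// mulrC ler_wpM2l.
have y3 : y <= y ^+ 3 * Ex.
  apply: (@le_trans _ _ (y * 1 * 1)); first by rewrite !mulr1.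
  have y0 : 0 <= y by lra.
  rewrite [y ^+ 3]exprS; apply: ler_pM => //; first by rewrite mulr1.
  by rewrite ler_wpM2l// exprn_ege1.
have qb : `|b ^+ 2 * (2 * s v * m v + m v ^+ 2 / 2)| <= 2 * b ^+ 2 * (d ^+ 3 * y ^+ 3 * Ex).
  have -> : 2 * b ^+ 2 * (d ^+ 3 * y ^+ 3 * Ex) = b ^+ 2 * (2 * (d ^+ 3 * y ^+ 3 * Ex)) by ring.
  rewrite normrM (ger0_norm (exprn_ge0 2 (ltW b0))).
  rewrite ler_wpM2l ?exprn_ge0 ?(ltW b0)//.
  apply: (@le_trans _ _ (2 * (d ^+ 3 * y))); last first.
    by rewrite -mulrA ler_wpM2l// ler_wpM2l ?exprn_ge0.
  apply: (le_trans (ler_normD _ _)).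
  have h1 : `|2 * s v * m v| <= d ^+ 3 * (w + 1).
    rewrite normrM normrM (ger0_norm mv0) ger0_norm//.
    have -> : d ^+ 3 * (w + 1) = d * (w + 1) * d ^+ 2 by ring.
    by apply: ler_pM => //; rewrite mulr_ge0.
  have h2 : `|m v ^+ 2 / 2| <= d ^+ 3 / 2.
    rewrite normrM normrX (ger0_norm mv0) [X in _ * X]ger0_norm// ler_wpM2r//.
    apply: (@le_trans _ _ ((d ^+ 2) ^+ 2)); first by rewrite lerXn2r ?nnegrE// (le_trans mv0).
    by rewrite -exprM ler_wiXn2l.
  have h3 : 0 <= d ^+ 3 by rewrite exprn_ge0.
  have h4 : 0 <= d ^+ 3 * w by rewrite mulr_ge0.
  by rewrite /y; lra.
by apply: (le_trans (ler_normD _ _)); rewrite /B [leRHS]mulrDl; apply: lerD.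
Qed.

(** The factor gained by [heat] in time c has the same main term as the spatial step: with t = 2 b c
    it is 1 - k t / 2 + b w t, up to order c^2, and c^2 <= d^4 <= d^3. *)
Lemma heat_step_time (b c d w : R) (k : nat) :
  0 < b -> 0 <= c <= d ^+ 2 -> 0 <= w -> 0 <= d <= 1 ->
  `|expR (- (k%:R / 2 * ln (1 + 2 * b * c)) + b * w * (2 * b * c / (1 + 2 * b * c)))
    - (1 - b * k%:R * c + 2 * b ^+ 2 * c * w)|
  <= (2 * k%:R * b ^+ 2 + 4 * b ^+ 3 + (k%:R * b + 2 * b ^+ 2) ^+ 2) *
     (d ^+ 3 * (w + 2) ^+ 3 * expR (d * (k%:R * b + 2 * b ^+ 2) * (w + 2))).
Proof.
move=> b0 /andP[c0 cd] w0 /andP[d0 d1].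
set K := k%:R * b + 2 * b ^+ 2; set y := w + 2; set Ex := expR (d * K * y).
set z := - _ + _.
have y1 : 1 <= y by rewrite /y; lra.
have y0 : 0 <= y by lra.
have k0 : 0 <= k%:R :> R by [].
have K0 : 0 <= K by rewrite addr_ge0 ?mulr_ge0 ?exprn_ge0 ?(ltW b0).
have Ex1 : 1 <= Ex by rewrite -expR0 ler_expR !mulr_ge0.
set t := 2 * b * c; have t0 : 0 <= t by rewrite mulr_ge0 ?mulr_ge0 ?(ltW b0).
have t1 : 0 < 1 + t by lra.
have /andP[ln1 ln2] := ln1D_bounds t0.
have q1 : t / (1 + t) <= t by rewrite ler_pdivrMr// ler_peMr//; lra.
have q2 : t - t ^+ 2 <= t / (1 + t).
  by rewrite ler_pdivlMr//; have := exprn_ge0 3 t0; rewrite !exprS expr0 mulr1; lra.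
have bw0 : 0 <= b * w by rewrite mulr_ge0// ltW.
have c2 : c ^+ 2 <= d ^+ 3.
  apply: (@le_trans _ _ ((d ^+ 2) ^+ 2)); first by rewrite lerXn2r ?nnegrE ?exprn_ge0.
  by rewrite -exprM ler_wiXn2l.
have y3 : y <= y ^+ 3 by rewrite exprS ler_peMr// exprn_ege1.
have y23 : y ^+ 2 <= y ^+ 3 by rewrite ler_weXn2l.
have d3 : 0 <= d ^+ 3 by rewrite exprn_ge0.
have yE : y ^+ 3 <= y ^+ 3 * Ex by rewrite ler_peMr// exprn_ge0.
have AE : 1 - b * k%:R * c + 2 * b ^+ 2 * c * w = 1 + (- (k%:R / 2 * t) + b * w * t).
  by rewrite /t; field.
have h1 : `|z - (- (k%:R / 2 * t) + b * w * t)| <= (2 * k%:R * b ^+ 2 + 4 * b ^+ 3) * (d ^+ 3 * y ^+ 3 * Ex).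
  apply: (@le_trans _ _ ((2 * k%:R * b ^+ 2 + 4 * b ^+ 3) * (c ^+ 2 * y))); last first.
    apply: ler_wpM2l; first by rewrite addr_ge0 ?mulr_ge0 ?exprn_ge0 ?(ltW b0).
    rewrite -mulrA; apply: ler_pM; rewrite ?exprn_ge0//; exact: le_trans yE.
  have e1 : 0 <= k%:R / 2 * (t - ln (1 + t)) <= k%:R / 2 * t ^+ 2.
    have kk : 0 <= k%:R / 2 :> R by rewrite divr_ge0.
    apply/andP; split; first by rewrite mulr_ge0//; lra.
    by rewrite ler_wpM2l//; lra.
  have e2 : 0 <= b * w * (t - t / (1 + t)) <= b * w * t ^+ 2.
    apply/andP; split; first by rewrite mulr_ge0//; lra.
    by rewrite ler_wpM2l//; lra.
  have -> : z - (- (k%:R / 2 * t) + b * w * t) = k%:R / 2 * (t - ln (1 + t)) - b * w * (t - t / (1 + t)).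
    by rewrite /z -/t; ring.
  apply: (@le_trans _ _ (k%:R / 2 * t ^+ 2 + b * w * t ^+ 2)).
    by rewrite ler_norml; move: e1 e2; lra.
  have -> : k%:R / 2 * t ^+ 2 + b * w * t ^+ 2 = 2 * k%:R * b ^+ 2 * c ^+ 2 + 4 * b ^+ 3 * c ^+ 2 * w.
    by rewrite /t; field.
  have -> : (2 * k%:R * b ^+ 2 + 4 * b ^+ 3) * (c ^+ 2 * y) =
      2 * k%:R * b ^+ 2 * c ^+ 2 * y + 4 * b ^+ 3 * c ^+ 2 * y by ring.
  have g1 : 0 <= 2 * k%:R * b ^+ 2 * c ^+ 2 by rewrite !mulr_ge0 ?exprn_ge0 ?(ltW b0).
  have g2 : 0 <= 4 * b ^+ 3 * c ^+ 2 by rewrite !mulr_ge0 ?exprn_ge0 ?(ltW b0).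
  by apply: lerD; [rewrite ler_peMr|rewrite ler_wpM2l// /y; lra].
have zb : `|z| <= c * (K * y).
  have z1 : 0 <= k%:R / 2 * ln (1 + t) <= k%:R / 2 * t.
    have kk : 0 <= k%:R / 2 :> R by rewrite divr_ge0.
    by rewrite mulr_ge0 ?ln_ge0 ?ler_wpM2l//; lra.
  have z2 : 0 <= b * w * (t / (1 + t)) <= b * w * t.
    by rewrite mulr_ge0 ?ler_wpM2l ?divr_ge0// ltW.
  apply: (@le_trans _ _ (k%:R / 2 * t + b * w * t)).
    by rewrite /z -/t ler_norml; move: z1 z2; lra.
  have -> : k%:R / 2 * t + b * w * t = c * (k%:R * b + 2 * b ^+ 2 * w) by rewrite /t; field.
  rewrite ler_wpM2l// (_ : K * y = k%:R * b * y + 2 * b ^+ 2 * y); last by rewrite /K; ring.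
  have g1 : 0 <= k%:R * b by rewrite mulr_ge0 ?(ltW b0).
  have g2 : 0 <= 2 * b ^+ 2 by rewrite mulr_ge0 ?exprn_ge0 ?(ltW b0).
  by apply: lerD; [rewrite ler_peMr|rewrite ler_wpM2l// /y; lra].
have h2 : `|expR z - 1 - z| <= K ^+ 2 * (d ^+ 3 * y ^+ 3 * Ex).
  apply: (le_trans (expR_taylor1 z)).
  rewrite (_ : K ^+ 2 * (d ^+ 3 * y ^+ 3 * Ex) = K ^+ 2 * (d ^+ 3 * y ^+ 3) * Ex); last by ring.
  apply: ler_pM; rewrite ?exprn_ge0 ?expR_ge0//; last first.
    rewrite ler_expR; apply: (le_trans zb); rewrite -mulrA ler_wpM2r ?mulr_ge0//.
    by apply: (le_trans cd); rewrite expr2 ler_piMr.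
  apply: (@le_trans _ _ ((c * (K * y)) ^+ 2)); first by rewrite lerXn2r ?nnegrE ?mulr_ge0.
  have -> : (c * (K * y)) ^+ 2 = K ^+ 2 * (c ^+ 2 * y ^+ 2) by ring.
  rewrite ler_wpM2l ?exprn_ge0//.
  by apply: ler_pM; rewrite ?exprn_ge0.
rewrite AE mulrDl; set A := - _ + _ in h1 *.
rewrite (_ : expR z - (1 + A) = (z - A) + (expR z - 1 - z)); last by ring.
by apply: (le_trans (ler_normD _ _)); apply: lerD.
Qed.

(** The common main term cancels, and exp (- b w) absorbs the remainder uniformly in w. As [a] stays
    between 1 and 1 + 2 l, the rate b = l / a stays between l / (1 + 2 l) and l, which makes the
    constants uniform along the flow. *)
Lemma heat_step (k : nat) (l : R) : (0 < k)%N -> 0 < l ->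
  exists C d0 : R, [/\ 0 <= C, 0 < d0 &
   forall (T : finType) (p s m : T -> R) (a c d w : R),
    1 <= a <= 1 + 2 * l -> 0 <= c -> 0 <= w -> 0 <= d <= d0 ->
    (forall v, 0 <= p v) -> \sum_v p v = 1 -> \sum_v p v * s v = 0 ->
    \sum_v p v * s v ^+ 2 = c * w -> \sum_v p v * m v = k%:R * c ->
    (forall v, 0 <= m v <= d ^+ 2) -> (forall v, 2 * `|s v| <= d * (w + 1)) ->
    `|\sum_v p v * heat k l a (w + 2 * s v + m v) - heat k l (a + 2 * l * c) w| <= C * d ^+ 3].
Proof.
move=> k0 l0.
have kk1 : 1 <= k%:R :> R by rewrite ler1n.
pose K := l ^+ 3 + 2 * l ^+ 2 + (2 * k%:R * l ^+ 2 + 4 * l ^+ 3 + (k%:R * l + 2 * l ^+ 2) ^+ 2).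
have l0' : 0 <= l := ltW l0.
have K0 : 0 <= K.
  by rewrite /K; do ?[apply: addr_ge0|apply: exprn_ge0|apply: mulr_ge0].
have l2 : 0 < 1 + 2 * l by lra.
(* With y = w + 2, the number 48 = 8 . 3! comes from (b y / 2)^3 <= 3! exp (b y / 2). The bound on d
   gives d (k b + 2 b^2) <= b / 2, and exp (2 l) bounds what is left of exp (- b w) exp (b y). *)
exists (K * (48 * ((1 + 2 * l) / l) ^+ 3 * expR (2 * l))), (2 * (k%:R + 2 * l))^-1.
split.
- by do ?[apply: mulr_ge0|apply: expR_ge0]; rewrite ?(ltW l2) ?invr_ge0.
- by rewrite invr_gt0; lra.
move=> T p s m a c d w /andP[a1 a2] c0 w0 /andP[d0 dd] p0 p1 Es Es2 Em m0 sb.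
have a0 : 0 < a by lra.
set b := l / a; have b0 : 0 < b by rewrite divr_gt0.
have bl : b <= l by rewrite ler_pdivrMr// ler_peMr// ltW.
have dk : d * (2 * (k%:R + 2 * l)) <= 1 by rewrite -ler_pdivlMr ?div1r//; lra.
have d1 : d <= 1.
  apply: le_trans dk; rewrite ler_peMr//; lra.
have cd : 0 <= c <= d ^+ 2.
  rewrite c0 /=; apply: (@le_trans _ _ (k%:R * c)); first by rewrite ler_peMl.
  rewrite -Em; have -> : d ^+ 2 = \sum_v p v * d ^+ 2 by rewrite -mulr_suml p1 mul1r.
  apply: ler_sum => v _.
  by rewrite ler_wpM2l//; have /andP[] := m0 v.
set Kb := k%:R * b + 2 * b ^+ 2.
have bKb : b <= Kb.
  rewrite /Kb; have := exprn_ge0 2 (ltW b0).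
  have : b <= k%:R * b by rewrite ler_peMl// ltW.
  lra.
have d01 : 0 <= d <= 1 by rewrite d0.
set y := w + 2; have y1 : 1 <= y by rewrite /y; lra.
have S1 := heat_step_space b0 bKb w0 d01 p0 p1 Es Es2 Em m0 sb.
have S2 := heat_step_time k b0 cd w0 d01.
rewrite heat_flow// -/b.
under eq_bigr => v _ do rewrite -addrA heat_shift// mulrCA.
rewrite -mulr_sumr -mulrBr normrM ger0_norm ?expR_ge0//.
set X := \sum_v _ in S1 *; set Y := expR (- _ + _) in S2 *; set A := 1 - _ + _ in S1 S2.
set Ex := expR (d * Kb * (w + 2)) in S1 S2.
set F := d ^+ 3 * _ * Ex in S1 S2.
have F0 : 0 <= F by rewrite !mulr_ge0 ?exprn_ge0 ?expR_ge0//; lra.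
have b0' : 0 <= b := ltW b0.
have u2 : b ^+ 2 <= l ^+ 2 by apply: lerXn2r; rewrite ?nnegrE.
have u3 : b ^+ 3 <= l ^+ 3 by apply: lerXn2r; rewrite ?nnegrE.
have XY : `|X - Y| <= K * F.
  rewrite (_ : X - Y = (X - A) - (Y - A)); last by ring.
  apply: (le_trans (ler_normB _ _)).
  rewrite /K mulrDl; apply: lerD.
    apply: (le_trans S1); rewrite ler_wpM2r//.
    by apply: lerD => //; rewrite ler_wpM2l.
  apply: (le_trans S2); rewrite ler_wpM2r//.
  have Kbl : Kb <= k%:R * l + 2 * l ^+ 2 by apply: lerD; rewrite ler_wpM2l.
  apply: lerD; first by apply: lerD; rewrite ler_wpM2l ?mulr_ge0.
  have Kb0 : 0 <= Kb := le_trans b0' bKb.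
  by apply: lerXn2r => //; rewrite nnegrE// (le_trans Kb0).
apply: (@le_trans _ _ (expR (- (b * w)) * (K * F))).
  by apply: ler_pM; rewrite ?expR_ge0//; exact: heat_le.
have -> : expR (- (b * w)) * (K * F) = K * (d ^+ 3 * (expR (- (b * w)) * (y ^+ 3 * Ex))).
  by rewrite /F -/y; ring.
rewrite -[leRHS]mulrA ler_wpM2l// [leRHS]mulrC ler_wpM2l ?exprn_ge0//.
have b48 : y ^+ 3 <= 48 / b ^+ 3 * expR (b * y / 2).
  have y0 : 0 <= y by lra.
  have by0 : 0 <= b * y / 2 by apply: divr_ge0 => //; apply: mulr_ge0.
  have := @expX_le_expR R 3 _ by0.
  rewrite (_ : (3`!)%:R = 6 :> R)// [48 / _ * _]mulrAC ler_pdivlMr ?exprn_gt0//.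
  rewrite (_ : (b * y / 2) ^+ 3 = y ^+ 3 * b ^+ 3 / 8); last by field.
  lra.
have ExE : Ex <= expR (b * y / 2).
  rewrite ler_expR -/y.
  rewrite [b * y / 2]mulrAC ler_wpM2r//; first by lra.
  rewrite (_ : d * Kb = (d * (2 * (k%:R + 2 * b))) * (b / 2)); last by rewrite /Kb; field.
  have b20 : 0 <= b / 2 by apply: divr_ge0.
  by apply: ler_piMl => //; apply: le_trans dk; apply: ler_wpM2l => //; lra.
apply: (@le_trans _ _ (expR (- (b * w)) * (48 / b ^+ 3 * expR (b * y / 2) * expR (b * y / 2)))).
  rewrite ler_wpM2l ?expR_ge0//; apply: ler_pM => //; rewrite ?expR_ge0// exprn_ge0//; lra.
have -> : expR (- (b * w)) * (48 / b ^+ 3 * expR (b * y / 2) * expR (b * y / 2)) = 48 / b ^+ 3 * expR (2 * b).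
  rewrite mulrCA -!mulrA; congr (_ * (_ * _)); rewrite -!expRD; congr expR.
  by rewrite /y /b; field; rewrite gt_eqF.
have -> : (1 + 2 * l) / l = (l / (1 + 2 * l))^-1 by rewrite invf_div.
have bb : l / (1 + 2 * l) <= b by rewrite ler_pM2l// lef_pV2 ?posrE.
apply: ler_pM; rewrite ?mulr_ge0 ?invr_ge0 ?exprn_ge0 ?expR_ge0 ?(ltW b0)//; last first.
  by rewrite ler_expR; lra.
rewrite exprVn ler_pM2l// lef_pV2 ?posrE ?exprn_gt0 ?divr_gt0//.
by apply: lerXn2r => //; rewrite nnegrE divr_ge0// ltW.
Qed.

End HeatStep.

(** * Replacement of all clusters *)

Section Lindeberg.
Variables (R : realType) (M : nat).
Implicit Types u y : 'cV[R]_M.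

Definition dotc u y : R := \sum_r u r ord0 * y r ord0.
Definition nsq u : R := dotc u u.

Lemma dotcC u y : dotc u y = dotc y u.
Proof. by apply: eq_bigr => r _; rewrite mulrC. Qed.

Lemma dotcDl u y (x : 'cV[R]_M) : dotc (u + y) x = dotc u x + dotc y x.
Proof. by rewrite -big_split; apply: eq_bigr => r _; rewrite mxE mulrDl. Qed.

Lemma nsqD u (x : 'cV[R]_M) : nsq (u + x) = nsq u + 2 * dotc u x + nsq x.
Proof.
rewrite /nsq dotcDl !(dotcC _ (u + x)) !dotcDl (dotcC x u); ring.
Qed.

Lemma nsq_ge0 u : 0 <= nsq u.
Proof. by apply: sumr_ge0 => r _; rewrite -expr2 sqr_ge0. Qed.

Lemma nsq0 : nsq 0 = 0.
Proof. by rewrite /nsq /dotc big1// => r _; rewrite mxE mul0r. Qed.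

(** Expand |d u + b x|^2 >= 0 for b = 1 and b = -1. Unlike Cauchy-Schwarz, this is linear in |u|^2,
    the variable of [heat]. *)
Lemma dotc_bound (d : R) u (x : 'cV[R]_M) : 0 < d -> nsq x <= d ^+ 2 ->
  2 * `|dotc u x| <= d * (nsq u + 1).
Proof.
move=> d0 xd; have e (b : R) : b = 1 \/ b = -1 -> 0 <= d ^+ 2 * nsq u + 2 * d * (b * dotc u x) + nsq x.
  move=> hb; suff -> : d ^+ 2 * nsq u + 2 * d * (b * dotc u x) + nsq x =
    \sum_r (d * u r ord0 + b * x r ord0) ^+ 2 by apply: sumr_ge0 => r _; rewrite sqr_ge0.
  rewrite /nsq /dotc !mulr_sumr -!big_split/=; apply: eq_bigr => r _.
  by case: hb => ->; ring.
rewrite -(ler_pM2l d0).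
have := e 1 (or_introl erefl); have := e (-1) (or_intror erefl).
have [h|h] := ger0P (dotc u x); rewrite expr2 in xd *; nra.
Qed.

(* Each cluster vector has covariance [c i] times the identity on the subspace [V],
   so replacing it amounts to running the heat flow for time [c i]. *)
Lemma lindeberg_heat (k : nat) (l : R) : (0 < k)%N -> 0 < l ->
  exists C d0 : R, [/\ 0 <= C, 0 < d0 &
  forall (W : finType) (P : W -> R) (I : eqType) (T : I -> finType)
    (pr : forall i, W -> T i) (p : forall i, T i -> R) (x : forall i, T i -> 'cV[R]_M)
    (V : 'cV[R]_M -> Prop) (c : I -> R) (d : R),
  (forall w, 0 <= P w) -> \sum_w P w = 1 ->
  (forall i v, 0 <= p i v) -> (forall i, \sum_v p i v = 1) ->
  (forall i r, \sum_v p i v * x i v r ord0 = 0) ->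
  V 0 -> (forall i u v, V u -> V (u + x i v)) ->
  (forall i u, V u -> \sum_v p i v * dotc u (x i v) ^+ 2 = c i * nsq u) ->
  (forall i, \sum_v p i v * nsq (x i v) = k%:R * c i) ->
  (forall i, 0 <= c i) -> (forall i v, nsq (x i v) <= d ^+ 2) -> 0 < d <= d0 ->
  (forall i s, i \notin s -> forall H : 'cV[R]_M -> R,
    \sum_w P w * H (\sum_(j <- s) x j (pr j w) + x i (pr i w)) =
    \sum_w P w * \sum_v p i v * H (\sum_(j <- s) x j (pr j w) + x i v)) ->
  forall s r, uniq s -> 0 <= r -> r + \sum_(i <- s) c i <= 1 ->
  `|\sum_w P w * heat k l (1 + 2 * l * r) (nsq (\sum_(j <- s) x j (pr j w))) -
    heat k l (1 + 2 * l * (r + \sum_(i <- s) c i)) 0| <= (size s)%:R * (C * d ^+ 3)].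
Proof.
move=> k0 l0; have [C [d0 [C0 d00 step]]] := heat_step k0 l0.
exists C, d0; split => // W P I T pr p x V c d P0 P1 p0 p1 Ex V0 VD Es Em c0 xd /andP[dp dd0] res.
have ne N : \sum_w P w * N = N by rewrite -mulr_suml P1 mul1r.
have VS s w : V (\sum_(j <- s) x j (pr j w)).
  by elim: s => [|j s IH]; rewrite ?big_nil// big_cons addrC; exact: VD.
(* [r] is the variance of the clusters already replaced; it varies in the induction, since removing
   cluster [i] adds [c i] to the time. *)
elim => [|i s IH] r.
  move=> _ r0 _; rewrite !big_nil addr0 mul0r; under eq_bigr do rewrite big_nil nsq0.
  by rewrite ne subrr normr0.
rewrite /= !big_cons => /andP[nis us] r0 rc.
have cs0 : 0 <= \sum_(j <- s) c j by apply: sumr_ge0.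
under eq_bigr do rewrite big_cons [x i _ + _]addrC.
(* The independent copy decouples cluster [i] from the others, so the one-step estimate applies with
   the partial sum fixed. *)
have /= -> := res i s nis (fun u => heat k l (1 + 2 * l * r) (nsq u)).
rewrite addrA; have rci : 0 <= r + c i by rewrite addr_ge0.
have := IH (r + c i) us rci; rewrite -addrA => /(_ rc).
set B := heat _ _ _ 0.
set A' := \sum_w P w * heat _ _ _ _ => hA'.
set A := \sum_w _.
rewrite (_ : A - B = (A - A') + (A' - B)); last by rewrite addrA subrK.
apply: (le_trans (ler_normD _ _)); rewrite -[_.+1]add1n natrD mulrDl mul1r; apply: lerD => //.
rewrite /A /A' -sumrB; under eq_bigr do rewrite -mulrBr.
apply: (le_trans (ler_norm_sum _ _ _)); rewrite -[leRHS]ne; apply: ler_sum => w _.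
rewrite normrM (ger0_norm (P0 w)) ler_wpM2l//.
set u := \sum_(j <- s) _.
have -> : 1 + 2 * l * (r + c i) = 1 + 2 * l * r + 2 * l * c i by ring.
under eq_bigr do rewrite nsqD.
apply: step => //.
- have lr : 0 <= l * r by rewrite mulr_ge0// ltW.
  have lr1 : l * r <= l by rewrite ler_piMr ?(ltW l0)//; move: (c0 i) cs0 rc; lra.
  lra.
- exact: nsq_ge0.
- by rewrite (ltW dp) dd0.
- under eq_bigr => v _ do rewrite mulr_sumr.
  rewrite exchange_big big1//= => t _.
  under eq_bigr => v _ do rewrite mulrCA.
  by rewrite -mulr_sumr Ex mulr0.
- exact/Es/VS.
- by move=> v; rewrite nsq_ge0 xd.
- by move=> v; exact: dotc_bound.
Qed.

End Lindeberg.

(** * Independent clusters *)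

Lemma sum_dffun_prod (R : realType) (I : finType) (T_ : I -> finType) (F : forall i, T_ i -> R) :
  \sum_(f : {dffun forall i, T_ i}) \prod_i F i (f i) = \prod_i \sum_t F i t.
Proof.
rewrite (reindex (@dffun_of_fprod I T_))/=; last exact/onW_bij/dffun_of_fprod_bij.
pose P_ i := [ffun t => F i t].
transitivity (\sum_(t : fprod T_) \prod_(i in I) P_ i (t i)).
  by apply: eq_bigr => f _; apply: eq_bigr => i _; rewrite /P_ !ffunE.
rewrite big_fprod -(bigA_distr_big_dep _ (fun i u => untag 0 (P_ i) u)).
apply: eq_bigr => i _; transitivity (\sum_t P_ i t); last first.
  by apply: eq_bigr => t _; rewrite ffunE.
exact/esym/(big_tag (fun i t => P_ i t)).
Qed.

Section Resampling.
Variables (R : realType) (G M : nat) (n Ng : 'I_G -> nat).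
Variable q : forall g : 'I_G, cvec M (n g) -> R.
Hypothesis q0 : forall g v, 0 <= q (g := g) v.
Hypothesis q1 : forall g, \sum_(v : cvec M (n g)) q v = 1.
Notation data := (dataset M n Ng).

(** Dependent pairs, as the number of clusters varies with the group: all clusters become one finite
    independent family. *)
Definition cluster_ix := {g : 'I_G & 'I_(Ng g)}.
Definition cluster_val (i : cluster_ix) (d : data) : cvec M (n (tag i)) := d (tag i) (tagged i).
Definition cluster_set (i : cluster_ix) (d : data) (v : cvec M (n (tag i))) : data :=
  finfun (eqtype.dfwith (fun g => d g) (finfun (@eqtype.dfwith _ (fun=> cvec M (n (tag i))) (d (tag i)) (tagged i) v))).

Lemma cluster_set_in i d v : cluster_val i (@cluster_set i d v) = v.
Proof. by rewrite /cluster_val /cluster_set ffunE eqtype.dfwith_in ffunE eqtype.dfwith_in. Qed.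

Lemma cluster_set_out i j d (v : cvec M (n (tag i))) : j != i ->
  cluster_val j (@cluster_set i d v) = cluster_val j d.
Proof.
case: i v => g l v; case: j => g' l' /= ne; rewrite /cluster_val /cluster_set/= ffunE.
have [E|gg] := eqVneq g g'; last by rewrite eqtype.dfwith_out.
move: l' ne; rewrite -E => l' ne; rewrite eqtype.dfwith_in ffunE eqtype.dfwith_out//.
by apply: contra ne => /eqP ->.
Qed.

Lemma data_eq (d d' : data) : (forall i, cluster_val i d = cluster_val i d') -> d = d'.
Proof.
move=> h; apply/ffunP => g; apply/ffunP => l.
exact: (h (Tagged (fun g => 'I_(Ng g)) l)).
Qed.

Lemma cluster_setK i d (v : cvec M (n (tag i))) :
  @cluster_set i (@cluster_set i d v) (cluster_val i d) = d.
Proof.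
apply: data_eq => j; have [->|ji] := eqVneq j i; first by rewrite cluster_set_in.
by rewrite !cluster_set_out.
Qed.

Lemma data_probE (d : data) : data_prob d q = \prod_(i : cluster_ix) q (cluster_val i d).
Proof. by rewrite /data_prob (sig_big_dep _ (fun _ _ => true))/=. Qed.

Lemma sum_cluster (V : nmodType) (F : forall g, 'I_(Ng g) -> V) :
  \sum_(g < G) \sum_(l < Ng g) F g l = \sum_(i : cluster_ix) F (tag i) (tagged i).
Proof. by rewrite (sig_big_dep _ (fun _ _ => true))/=. Qed.

Lemma data_prob_ge0 (d : data) : 0 <= data_prob d q.
Proof. by rewrite data_probE prodr_ge0. Qed.

Lemma data_prob_neq0 (d : data) i : data_prob d q != 0 -> q (cluster_val i d) != 0.
Proof. by rewrite data_probE; move/prodf_neq0; apply. Qed.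

Lemma data_prob_set i d (v : cvec M (n (tag i))) :
  data_prob (@cluster_set i d v) q * q (cluster_val i d) = data_prob d q * q v.
Proof.
rewrite !data_probE (bigD1 i)//= cluster_set_in [in RHS](bigD1 i)//=.
rewrite (eq_bigr (fun j => q (cluster_val j d))); first by ring.
by move=> j ji; rewrite cluster_set_out.
Qed.

(* Swapping the [i]-th cluster with an independent copy is a measure-preserving
   involution. *)
Lemma resample (i : cluster_ix) (F : data -> cvec M (n (tag i)) -> R) :
  (forall d v w, F (@cluster_set i d v) w = F d w) ->
  \sum_d data_prob d q * F d (cluster_val i d) =
  \sum_d data_prob d q * \sum_v q v * F d v.
Proof.
move=> hF.
under [RHS]eq_bigr do rewrite mulr_sumr.
rewrite pair_big/=.
pose h (z : data * cvec M (n (tag i))) := (@cluster_set i z.1 z.2, cluster_val i z.1).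
have hK : involutive h by move=> [d v]; rewrite /h/= cluster_setK cluster_set_in.
rewrite (reindex_inj (inv_inj hK))/=.
(* The independent copy has total mass 1, so it can be inserted into the left-hand side. *)
transitivity (\sum_(z : data * cvec M (n (tag i))) data_prob z.1 q * (q z.2 * F z.1 (cluster_val i z.1))).
  rewrite -(pair_big predT predT (fun d v => data_prob d q * (q v * F d (cluster_val i d))))/=.
  by apply: eq_bigr => d _; rewrite -mulr_sumr -mulr_suml q1 mul1r.
by apply: eq_bigr => z _; rewrite hF !mulrA data_prob_set.
Qed.

Lemma data_prob_sum : \sum_(d : data) data_prob d q = 1.
Proof.
rewrite (@sum_dffun_prod R 'I_G (fun g => {ffun 'I_(Ng g) -> cvec M (n g)})
  (fun g f => \prod_(l < Ng g) q (f l))) big1// => g _.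
by rewrite -(bigA_distr_bigA (fun _ v => q v)) big1// => l _; exact: q1.
Qed.

(** Resampling in the form required by [lindeberg_heat]: a sum over clusters other than [i] does not
    see an update at [i]. *)
Lemma resample_sum (i : cluster_ix) (s : seq cluster_ix) (V : zmodType)
    (f : forall j : cluster_ix, cvec M (n (tag j)) -> V) (H : V -> R) : i \notin s ->
  \sum_d data_prob d q * H (\sum_(j <- s) f j (cluster_val j d) + f i (cluster_val i d)) =
  \sum_d data_prob d q * \sum_v q v * H (\sum_(j <- s) f j (cluster_val j d) + f i v).
Proof.
move=> nis; rewrite -(@resample i (fun d v => H (\sum_(j <- s) f j (cluster_val j d) + f i v)))//.
move=> d v w; congr (H (_ + _)); rewrite !big_seq; apply: eq_bigr => j js.
by rewrite cluster_set_out//; apply: contraNneq nis => <-.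
Qed.

Lemma expectation_cst (c : R) : \sum_(d : data) data_prob d q * c = c.
Proof. by rewrite -mulr_suml data_prob_sum mul1r. Qed.

(** Clusters are peeled off one at a time; by resampling, the cross term with the remaining sum is a
    multiple of the mean of [f i], which is 0. *)
Lemma centered_second_moment (f : forall j : cluster_ix, cvec M (n (tag j)) -> R) :
  (forall i, \sum_v q v * f i v = 0) ->
  \sum_d data_prob d q * (\sum_i f i (cluster_val i d)) ^+ 2 =
  \sum_i \sum_v q v * f i v ^+ 2.
Proof.
move=> Ef.
elim: (index_enum _) (index_enum_uniq cluster_ix) => [_|i s IH /= /andP[nis us]].
  by rewrite big_nil; under eq_bigr do rewrite big_nil expr0n/=; exact: expectation_cst.
rewrite big_cons -(IH us).
under eq_bigr do rewrite big_cons addrC.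
rewrite (resample_sum f (fun x => x ^+ 2) nis) addrC.
rewrite -[X in _ = _ + X]expectation_cst -big_split/=; apply: eq_bigr => d _.
rewrite -mulrDr; congr (_ * _); set S := \sum_(j <- s) _.
transitivity (S ^+ 2 * (\sum_(v : cvec M (n (tag i))) q v) + S * 2 * (\sum_v q v * f i v) + \sum_v q v * f i v ^+ 2).
  by rewrite !mulr_sumr -!big_split/=; apply: eq_bigr => v _; ring.
by rewrite q1 Ef; ring.
Qed.

Lemma chebyshev_data (f : forall j : cluster_ix, cvec M (n (tag j)) -> R) (C t : R) :
  (forall i, \sum_v q v * f i v = 0) ->
  (forall i v, f i v ^+ 2 <= C) -> 0 < t ->
  \sum_d data_prob d q * (t < `|\sum_i f i (cluster_val i d)|)%R%:R <=
  (\sum_(g < G) (Ng g)%:R) * C / t ^+ 2.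
Proof.
move=> Ef fC t0; rewrite ler_pdivlMr ?exprn_gt0// mulr_suml.
apply: (@le_trans _ _ (\sum_d data_prob d q * (\sum_i f i (cluster_val i d)) ^+ 2)).
  apply: ler_sum => d _; rewrite -mulrA ler_wpM2l ?data_prob_ge0//.
  case: ltP => h /=; last by rewrite mul0r sqr_ge0.
  by rewrite mul1r -[leRHS]real_normK ?num_real// lerXn2r ?nnegrE// ltW.
rewrite centered_second_moment//.
apply: (@le_trans _ _ (\sum_(i : cluster_ix) C)).
  apply: ler_sum => i _; rewrite -[leRHS]mul1r -(q1 (tag i)) mulr_suml.
  by apply: ler_sum => v _; rewrite ler_wpM2l.
rewrite mulr_suml -(sum_cluster (fun _ _ => C)).
by apply: ler_sum => g _; rewrite sumr_const card_ord mulr_natl.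
Qed.

End Resampling.

(** * Residual projector *)

Section Projector.
Variables (R : realType) (M M0 : nat) (s : 'cV[R]_M) (B : 'M[R]_(M, M0)).
Hypothesis ss : s^T *m s = 1%:M.
Hypothesis sB : s^T *m B = 0.
Hypothesis BB : B^T *m B \in unitmx.

Lemma dotcE (u v : 'cV[R]_M) : (dotc u v)%:M = u^T *m v.
Proof.
apply/matrixP => i j; rewrite !ord1 !mxE eqxx mulr1n; apply: eq_bigr => r _.
by rewrite mxE.
Qed.

(* orthogonal projector on the complement of the span of [s] and the columns of [B] *)
Definition resproj : 'M[R]_M := 1%:M - s *m s^T - B *m invmx (B^T *m B) *m B^T.

Lemma resproj_sym : resproj^T = resproj.
Proof.
rewrite /resproj !linearB/= trmx1 !trmx_mul !trmxK trmx_inv !trmx_mul trmxK.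
by rewrite mulmxA.
Qed.

Lemma resproj_s : resproj *m s = 0.
Proof.
rewrite /resproj !mulmxBl mul1mx -[s *m _ *m s]mulmxA ss mulmx1 subrr sub0r.
have Bs : B^T *m s = 0 by rewrite -[LHS]trmxK trmx_mul trmxK sB trmx0.
by rewrite -[_ *m B^T *m s]mulmxA Bs mulmx0 oppr0.
Qed.

Lemma resproj_B : resproj *m B = 0.
Proof.
rewrite /resproj !mulmxBl mul1mx -[s *m _ *m B]mulmxA sB mulmx0 subr0.
by rewrite -[B *m _ *m B^T *m B]mulmxA mulmxKV// subrr.
Qed.

Lemma resproj_idem : resproj *m resproj = resproj.
Proof.
rewrite {2}/resproj !mulmxBr mulmx1 !mulmxA resproj_s resproj_B !mul0mx.
by rewrite !subr0.
Qed.

Lemma resproj_trace : \tr resproj = M%:R - 1 - M0%:R.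
Proof.
rewrite /resproj !linearB/= mxtrace1 mxtrace_mulC ss mxtrace1.
by rewrite [X in _ - X]mxtrace_mulC mulmxA mulmxV// mxtrace1.
Qed.

Lemma dotc_resproj (u v : 'cV[R]_M) : dotc u (resproj *m v) = dotc (resproj *m u) v.
Proof.
have : ((dotc u (resproj *m v))%:M : 'M[R]_1) = (dotc (resproj *m u) v)%:M.
  by rewrite !dotcE trmx_mul resproj_sym mulmxA.
by move=> /matrixP/(_ ord0 ord0); rewrite !mxE eqxx !mulr1n.
Qed.

(** The squared Frobenius norm of a symmetric idempotent matrix is its trace. *)
Lemma sum_nsq_col_resproj : \sum_r nsq (col r resproj) = M%:R - 1 - M0%:R.
Proof.
have symE a b : resproj a b = resproj b a by rewrite -{1}resproj_sym mxE.
rewrite -resproj_trace -[in RHS]resproj_idem /mxtrace.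
apply: eq_bigr => r _; rewrite mxE; apply: eq_bigr => t _.
by rewrite [col _ _ _ _]mxE (symE r t).
Qed.

(** Pythagoras: subtracting B beta leaves the projection unchanged, and the rest is orthogonal to
    it. *)
Lemma nsq_resproj_le (y : 'cV[R]_M) (beta : 'cV[R]_M0) : 
  nsq (resproj *m y) <= nsq (y - B *m beta).
Proof.
set z := y - B *m beta.
have Pz : resproj *m y = resproj *m z.
  by rewrite /z mulmxBr [resproj *m (B *m beta)]mulmxA resproj_B mul0mx subr0.
rewrite Pz.
have zE : z = resproj *m z + (z - resproj *m z) by rewrite subrKC.
have E : resproj *m (z - resproj *m z) = 0 by rewrite mulmxBr mulmxA resproj_idem subrr.
rewrite [X in _ <= nsq X]zE nsqD -dotc_resproj E.
rewrite (_ : dotc z 0 = 0) ?mulr0 ?addr0 ?lerDl ?nsq_ge0//.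
by rewrite /dotc big1// => r _; rewrite [X in _ * X]mxE mulr0.
Qed.

(** The least squares coefficient attains the preceding bound. Orthogonality to [s] enters because
    the projector removes that direction too. *)
Lemma resproj_lsq (y : 'cV[R]_M) : s^T *m y = 0 ->
  y - B *m (invmx (B^T *m B) *m B^T *m y) = resproj *m y.
Proof.
move=> sy; rewrite /resproj !mulmxBl mul1mx -[s *m _ *m y]mulmxA sy mulmx0 subr0.
by rewrite !mulmxA.
Qed.

End Projector.

(** * Local behaviour of phi-divergences *)

Section Divergence.
Variable R : realType.

Lemma MVT_pow_bound (f df : R -> R) (K d a : R) (n : nat) :
  0 <= K -> f a = 0 ->
  (forall x, `|x - a| <= d -> is_derive x 1 f (df x)) ->
  (forall x, `|x - a| <= d -> `|df x| <= K * `|x - a| ^+ n) ->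
  forall x, `|x - a| <= d -> `|f x| <= K * `|x - a| ^+ n.+1.
Proof.
move=> K0 fa fd dfb x xd.
have nearer c : `|c - a| <= `|x - a| -> `|c - a| <= d by move=> /le_trans; apply.
suff [c cx E] : exists2 c, `|c - a| <= `|x - a| & `|f x| = `|df c| * `|x - a|.
  rewrite E exprSr mulrA ler_wpM2r//; apply: (le_trans (dfb c (nearer c cx))).
  by rewrite ler_wpM2l// lerXn2r ?nnegrE.
have cont u v : (forall y, y \in `[u, v] -> `|y - a| <= d) -> {within `[u, v], continuous f}.
  move=> h; apply: derivable_within_continuous => y yuv.
  exact: (@ex_derive _ _ _ _ _ _ _ (fd y (h y yuv))).
have [xa|xa|->] := ltgtP x a; last by exists a; rewrite // fa normr0 subrr normr0 mulr0.
- have near y : y \in `[x, a] -> `|y - a| <= `|x - a|.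
    rewrite in_itv/= => /andP[y1 y2]; rewrite !ler0_norm ?subr_le0//; lra.
  have [c cxa] := @MVT_segment R f df x a (ltW xa) (fun y h => fd y (nearer y (near y (subset_itv_oo_cc h)))) (cont _ _ (fun y h => nearer y (near y h))).
  rewrite fa sub0r => E; exists c; first exact: near.
  by rewrite -normrN E normrM distrC.
- have near y : y \in `[a, x] -> `|y - a| <= `|x - a|.
    rewrite in_itv/= => /andP[y1 y2]; rewrite !ger0_norm ?subr_ge0//; lra.
  have [c cxa] := @MVT_segment R f df a x (ltW xa) (fun y h => fd y (nearer y (near y (subset_itv_oo_cc h)))) (cont _ _ (fun y h => nearer y (near y h))).
  rewrite fa subr0 => E; exists c; first exact: near.
  by rewrite E normrM.
Qed.

Lemma phi_quadratic (phi : R -> R) (e : R) : admissible phi -> 0 < e ->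
  exists2 d, 0 < d < 1 & forall u, `|u - 1| <= d ->
    `|phi u - derive1n 2 phi 1 / 2 * (u - 1) ^+ 2| <= e * (u - 1) ^+ 2.
Proof.
move=> [_ d1 d2 c2 [phi1 dphi1 _]] e0; set c := derive1n 2 phi 1.
have /cvgrPdist_le/(_ e e0) /nbhs_ballP[d /= d0 hd] := c2 1 ltr01.
(* Half the radius gives a closed ball inside the open one; 1 / 2 keeps u positive. *)
pose d' := Num.min (d / 2) (1 / 2).
have d'0 : 0 < d' by rewrite lt_min; lra.
have d'1 : d' <= 1 / 2 by rewrite ge_min lexx orbT.
have d'd : d' <= d / 2 by rewrite ge_min lexx.
exists d'; first by rewrite d'0/=; lra.
have pos u : `|u - 1| <= d' -> 0 < u by rewrite ler_distl; lra.
have D1 u : `|u - 1| <= d' -> is_derive u 1 phi (derive1 phi u).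
  by move=> /pos u0; split; [exact: d1|rewrite derive1E].
have D2 u : `|u - 1| <= d' -> is_derive u 1 (derive1 phi) (derive1n 2 phi u).
  by move=> /pos u0; split; [exact: d2|rewrite -derive1E].
have b1 u : `|u - 1| <= d' -> `|derive1 phi u - c * (u - 1)| <= e * `|u - 1| ^+ 1.
  apply: (@MVT_pow_bound (fun u => derive1 phi u - c * (u - 1)) (fun u => derive1n 2 phi u - c)).
  - exact: ltW.
  - by rewrite dphi1 subrr mulr0 subr0.
  - move=> x xd; have := D2 x xd => h.
    by apply: is_derive_eq; rewrite /GRing.scale/= subr0 mulr1.
  - move=> x xd; rewrite expr0 mulr1 distrC; apply: hd.
    by rewrite /ball/= distrC; lra.
move=> u ud; have := @MVT_pow_bound (fun u => phi u - c / 2 * (u - 1) ^+ 2)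
   (fun u => derive1 phi u - c * (u - 1)) e d' 1 1 (ltW e0) _ _ b1 u ud.
rewrite real_normK ?num_real//; apply.
- by rewrite phi1 subrr expr0n/= mulr0 subr0.
- move=> x xd; have := D1 x xd => h.
  by apply: is_derive_eq; rewrite /GRing.scale/= subr0; field.
Qed.

(** Near 1 this is the quadratic behaviour, with a quarter of the second derivative in place of
    half. Farther away convexity takes over: as [phi] vanishes at 1, it lies above the ray from 1
    through its value at distance d, and grows at least linearly. *)
Lemma phi_lower (phi : R -> R) : admissible phi ->
  exists2 d, 0 < d < 1 & forall h u, 0 <= h <= d -> 0 < u -> h <= `|u - 1| ->
    derive1n 2 phi 1 / 4 * h * `|u - 1| <= phi u.
Proof.
move=> adm; have [cvx _ _ _ [phi1 _ c0]] := adm.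
set c := derive1n 2 phi 1 in c0 *.
have c4 : 0 < c / 4 by lra.
have [d /andP[d0 d1] hd] := phi_quadratic adm c4.
have low u : `|u - 1| <= d -> c / 4 * `|u - 1| ^+ 2 <= phi u.
  move=> ud; rewrite real_normK ?num_real//.
  by have := hd u ud; rewrite ler_distl -/c; lra.
exists d; first by rewrite d0 d1.
move=> h u /andP[h0 hd'] u0 hu.
have [ud|ud] := leP `|u - 1| d.
  apply: le_trans (low u ud); rewrite -mulrA ler_pM2l// expr2 ler_wpM2r//.
set a := `|u - 1| in ud hu *; have a0 : 0 < a by exact: lt_trans ud.
pose t := d / a.
have t01 : 0 <= t <= 1.
  by apply/andP; split; [apply: divr_ge0; exact: ltW|rewrite ler_pdivrMr// mul1r ltW].
have := cvx u 1 t u0 ltr01 t01; rewrite phi1 mulr0 addr0 => tb.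
have E : `|(t * u + (1 - t) * 1) - 1| = d.
  rewrite (_ : _ - 1 = t * (u - 1)); last by ring.
  by rewrite normrM -/a ger0_norm ?(andP t01).1// /t mulfVK// gt_eqF.
have := low (t * u + (1 - t) * 1); rewrite E lexx => /(_ isT) l1.
have l2 : c / 4 * d ^+ 2 <= t * phi u := le_trans l1 tb.
have l3 : c / 4 * d * a <= phi u.
  have : c / 4 * d ^+ 2 * (a / d) <= t * phi u * (a / d) by rewrite ler_wpM2r// divr_ge0 ?ltW.
  rewrite (_ : c / 4 * d ^+ 2 * (a / d) = c / 4 * d * a); last by field; rewrite gt_eqF.
  by rewrite /t (_ : d / a * phi u * (a / d) = phi u)//; field; rewrite !gt_eqF.
apply: le_trans l3; rewrite ler_pM2r//; rewrite ler_wpM2l// ltW//.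
Qed.

Lemma phi_ge0 (phi : R -> R) (u : R) : admissible phi -> 0 < u -> 0 <= phi u.
Proof.
move=> adm u0; have [d /andP[d0 _] hd] := phi_lower adm.
by have := hd 0 u; rewrite lexx (ltW d0) mulr0 mul0r; apply.
Qed.

Variable M : nat.
Implicit Types p q : 'I_M -> R.

Definition dreal (phi : R -> R) p q : R := \sum_r q r * phi (p r / q r).

Lemma dphiE (phi : R -> R) p q : (forall r, 0 < p r) -> (forall r, 0 < q r) ->
  dphi phi p q = (dreal phi p q)%:E.
Proof.
move=> p0 q0; rewrite /dphi /dreal -sumEFin; apply: eq_bigr => r _.
by rewrite /phiE divr_gt0.
Qed.

Lemma pos_lower_bound p : (forall r, 0 < p r) -> exists2 m, 0 < m & forall r, m <= p r.
Proof.
move=> p0; exists (\big[Num.min/1]_r p r).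
  by apply: (big_ind (fun x => 0 < x)) => // x y x0 y0; rewrite lt_min x0.
by move=> r; exact: bigmin_le_cond.
Qed.

(* the norm of Pearson's statistic *)
Definition wnorm2 (p z : 'I_M -> R) : R := \sum_r z r ^+ 2 / p r.

(** The error is relative to the distance between [p] and [q], not to their distances from [p0];
    this allows fits at different parameters to be compared. *)
Lemma dreal_quadratic (phi : R -> R) (p0 : 'I_M -> R) (e : R) :
  admissible phi -> (forall r, 0 < p0 r) -> 0 < e <= 1 ->
  exists2 d, 0 < d & forall p q, (forall r, `|p r - p0 r| <= d) ->
    (forall r, `|q r - p0 r| <= d) ->
    [/\ forall r, 0 < p r, forall r, 0 < q r &
     `|2 / derive1n 2 phi 1 * dreal phi p q - wnorm2 p0 (fun r => p r - q r)|
       <= e * wnorm2 p0 (fun r => p r - q r)].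
Proof.
move=> adm p00 /andP[e0 e1]; have [_ _ _ _ [_ _ c0]] := adm.
set c := derive1n 2 phi 1 in c0 *.
have [m m0 hm] := pos_lower_bound p00.
have ce : 0 < c * e / 8 by rewrite divr_gt0// mulr_gt0.
have [dp /andP[dp0 dp1] hdp] := phi_quadratic adm ce.
(* The first bound keeps p / q within [dp] of 1; the second makes the replacement of 1 / q by 1 / p0
   cost a relative e / 2. The other half is the e / 4 from [phi], at most doubled by that
   replacement. *)
pose d := Num.min (m * dp / 4) (m * (e / 2) / 2).
have d0 : 0 < d by rewrite lt_min !divr_gt0// mulr_gt0// divr_gt0.
have dd1 : d <= m * dp / 4 by rewrite ge_min lexx.
have dd2 : d <= m * (e / 2) / 2 by rewrite ge_min lexx orbT.
have dm : d <= m / 2.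
  apply: (le_trans dd1); have : m * dp <= m by rewrite ler_piMr// ltW.
  lra.
exists d => // p q pd qd.
have qm r : m / 2 <= q r by have := qd r; rewrite ler_distl; have := hm r; lra.
have q0 r : 0 < q r by apply: lt_le_trans (qm r); lra.
have pp0 r : 0 < p r by have := pd r; rewrite ler_distl; have := hm r; lra.
split => //.
rewrite /dreal /wnorm2 [2 / c * _]mulr_sumr -sumrB [e * _]mulr_sumr.
apply: (le_trans (ler_norm_sum _ _ _)); apply: ler_sum => r _.
set x := p r - q r.
have u1 : p r / q r - 1 = x / q r by rewrite /x mulrBl divff// gt_eqF.
have ub : `|p r / q r - 1| <= dp.
  rewrite u1 normrM (gtr0_norm (_ : 0 < (q r)^-1)) ?invr_gt0// ler_pdivrMr//.
  have : `|x| <= 2 * d.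
    rewrite (_ : x = (p r - p0 r) - (q r - p0 r)); last by rewrite /x; ring.
    by apply: (le_trans (ler_normB _ _)); have := pd r; have := qd r; lra.
  have : dp * (m / 2) <= dp * q r by rewrite ler_pM2l.
  lra.
have := hdp _ ub; rewrite u1 -/c => h1.
have h2 : `|2 / c * (q r * phi (p r / q r)) - x ^+ 2 / q r| <= e / 4 * (x ^+ 2 / q r).
  rewrite (_ : _ - _ = 2 / c * q r * (phi (p r / q r) - c / 2 * (x / q r) ^+ 2)); last first.
    by field; rewrite !gt_eqF.
  have g : 0 < 2 / c * q r by rewrite mulr_gt0// divr_gt0.
  rewrite normrM (gtr0_norm g) -ler_pdivlMl//; apply: (le_trans h1).
  by rewrite le_eqVlt; apply/orP; left; apply/eqP; field; rewrite !gt_eqF.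
have h3 : `|x ^+ 2 / q r - x ^+ 2 / p0 r| <= e / 2 * (x ^+ 2 / p0 r).
  have p0r := p00 r.
  rewrite (_ : _ - _ = (x ^+ 2 / p0 r) * ((p0 r - q r) / q r)); last first.
    by field; rewrite !gt_eqF.
  rewrite normrM ger0_norm ?divr_ge0 ?sqr_ge0 ?(ltW p0r)// mulrC ler_wpM2r ?divr_ge0 ?sqr_ge0 ?(ltW p0r)//.
  rewrite normrM (gtr0_norm (_ : 0 < (q r)^-1)) ?invr_gt0// ler_pdivrMr//.
  rewrite distrC; apply: (le_trans (qd r)); apply: (le_trans dd2).
  have : e / 2 * (m / 2) <= e / 2 * q r by rewrite ler_pM2l// divr_gt0.
  lra.
have xq : x ^+ 2 / q r <= 2 * (x ^+ 2 / p0 r).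
  move: h3; rewrite ler_distl => /andP[_ h3].
  have s0 : 0 <= x ^+ 2 / p0 r by rewrite divr_ge0 ?sqr_ge0// ltW.
  have : e / 2 * (x ^+ 2 / p0 r) <= 1 * (x ^+ 2 / p0 r) by rewrite ler_wpM2r//; lra.
  lra.
rewrite (_ : _ - _ = (2 / c * (q r * phi (p r / q r)) - x ^+ 2 / q r) + (x ^+ 2 / q r - x ^+ 2 / p0 r)); last by ring.
apply: (le_trans (ler_normD _ _)).
have : e / 4 * (x ^+ 2 / q r) <= e / 4 * (2 * (x ^+ 2 / p0 r)).
  by rewrite ler_wpM2l// divr_ge0// ltW.
lra.
Qed.

(** As q r <= 1, a gap between p r and q r is at most the gap between their ratio and 1, where the
    linear bound for [phi] applies; the weight q r cancels. The other coordinates contribute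
    nonnegative terms. *)
Lemma dreal_away (phi : R -> R) (d : R) : admissible phi -> 0 < d ->
  exists2 b, 0 < b & forall p q r, (forall t, 0 < p t) -> (forall t, 0 < q t) ->
    q r <= 1 -> d <= `|p r - q r| -> b <= dreal phi p q.
Proof.
move=> adm d0; have [_ _ _ _ [_ _ c0]] := adm.
have [d1 /andP[d10 _] hd1] := phi_lower adm.
pose h := Num.min d d1.
have h0 : 0 < h by rewrite lt_min d0.
have hd : h <= d by rewrite ge_min lexx.
have hdd : 0 <= h <= d1 by rewrite ltW//= ge_min lexx orbT.
exists (derive1n 2 phi 1 / 4 * h * d); first by rewrite !mulr_gt0// invr_gt0.
move=> p q r p0 q0 q1 pq.
have qi : 0 < (q r)^-1 by rewrite invr_gt0.
have nE : `|p r / q r - 1| = `|p r - q r| / q r.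
  rewrite (_ : p r / q r - 1 = (p r - q r) / q r); last by field; rewrite gt_eqF.
  by rewrite normrM (gtr0_norm qi).
have hu : h <= `|p r / q r - 1|.
  rewrite nE ler_pdivlMr//; apply: le_trans pq; apply: le_trans hd.
  by rewrite ler_piMr// ltW.
have := hd1 h _ hdd (divr_gt0 (p0 r) (q0 r)) hu; rewrite nE => lb.
rewrite /dreal (bigD1 r)//=; apply: (@le_trans _ _ (q r * phi (p r / q r))); last first.
  rewrite lerDl sumr_ge0// => t _; rewrite mulr_ge0 ?(ltW (q0 t))//.
  by apply: phi_ge0 => //; rewrite divr_gt0.
apply: le_trans (ler_wpM2l (ltW (q0 r)) lb).
rewrite (_ : q r * _ = derive1n 2 phi 1 / 4 * h * `|p r - q r|); last by field; rewrite gt_eqF.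
by rewrite ler_wpM2l// mulr_ge0 ?divr_ge0// ltW.
Qed.

End Divergence.

(** * The log-linear model and the minimum divergence estimator *)

Section Model.
Variables (R : realType) (M M0 : nat) (W : 'M[R]_(M, M0)).
Hypothesis M_gt0 : (0 < M)%N.
Implicit Types th b : 'cV[R]_M0.

Lemma model_norm_gt0 th : 0 < \sum_s expR ((W *m th) s ord0).
Proof.
case: M M_gt0 W => // m _ W'; rewrite (bigD1 ord0)//= ltr_pwDl ?expR_gt0//.
by apply: sumr_ge0 => s _; exact: expR_ge0.
Qed.

Lemma pmodel_gt0 th r : 0 < pmodel W th r.
Proof. by rewrite divr_gt0 ?expR_gt0// model_norm_gt0. Qed.

Lemma pmodel_sum1 th : \sum_r pmodel W th r = 1.
Proof. by rewrite -mulr_suml divff// gt_eqF// model_norm_gt0. Qed.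

Lemma pmodel_le1 th r : pmodel W th r <= 1.
Proof.
rewrite -(pmodel_sum1 th) (bigD1 r)//= lerDl sumr_ge0// => s _.
exact/ltW/pmodel_gt0.
Qed.

Lemma mulmx_entry_bound (m k : nat) (A : 'M[R]_(m, k)) (v : 'cV[R]_k) (e : R) (K : R) :
  K = \sum_i \sum_j `|A i j| -> 0 <= e ->
  (forall j, `|v j ord0| <= e) -> forall i, `|(A *m v) i ord0| <= K * e.
Proof.
move=> -> e0 ve i; rewrite mxE; apply: (le_trans (ler_norm_sum _ _ _)).
rewrite mulr_suml (bigD1 i)//= -[leLHS]addr0; apply: lerD; last first.
  by apply: sumr_ge0 => r _; rewrite mulr_ge0// sumr_ge0.
by rewrite mulr_suml; apply: ler_sum => j _; rewrite normrM ler_wpM2l.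
Qed.

Lemma ln_ratio_bound (a b m d : R) : 0 < m -> m <= b -> 0 < a -> `|a - b| <= d ->
  d <= m / 2 -> `|ln a - ln b| <= 2 / m * d.
Proof.
move=> m0 mb a0 abd dm; have b0 : 0 < b by lra.
have d0 : 0 <= d := le_trans (normr_ge0 _) abd.
have am : m / 2 <= a by move: abd; rewrite ler_distl; lra.
have up (x y : R) : 0 < x -> m / 2 <= y -> `|x - y| <= d -> ln x - ln y <= 2 / m * d.
  move=> x0 my xyd; have y0 : 0 < y by lra.
  rewrite -ln_div ?posrE//; apply: (@le_trans _ _ (x / y - 1)).
    have : -1 < x / y - 1 by rewrite ltrBrDl subrr divr_gt0.
    by move/le_ln1Dx; rewrite subrKC.
  rewrite (_ : x / y - 1 = (x - y) / y); last by field; rewrite gt_eqF.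
  rewrite ler_pdivrMr//; apply: (le_trans (ler_norm _)); apply: (le_trans xyd).
  have : 2 / m * d * (m / 2) <= 2 / m * d * y by rewrite ler_wpM2l// mulr_ge0// divr_ge0// ltW.
  by rewrite (_ : 2 / m * d * (m / 2) = d)//; field; rewrite gt_eqF.
rewrite ler_norml; apply/andP; split.
  by rewrite -[leRHS]opprB lerN2; apply: up => //; rewrite distrC.
by apply: up => //; lra.
Qed.

(** The log-ratio of two model vectors is W (th - th0) plus a constant vector [kap], the difference
    of the log-normalizers. A left inverse of the matrix (W, 1) recovers th - th0 from it, and the
    logarithm is Lipschitz away from 0. *)
Lemma pmodel_inverse_bound (th0 : 'cV[R]_M0) :
  \rank (row_mx W (const_mx 1 : 'cV[R]_M)) = M0.+1 ->
  exists C d0 : R, [/\ 0 < C, 0 < d0 & forall th d, d <= d0 ->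
    (forall r, `|pmodel W th r - pmodel W th0 r| <= d) ->
    forall j, `|(th - th0) j ord0| <= C * d].
Proof.
move=> rk; set F := row_mx _ _ in rk.
have : row_full F by rewrite /row_full rk addn1.
move=> /row_fullP[L LF].
have [m m0 hm] := pos_lower_bound (pmodel_gt0 th0).
pose K := \sum_i \sum_j `|L i j| + 1.
have K0 : 0 < K by rewrite ltr_pwDr// sumr_ge0// => i _; apply: sumr_ge0.
exists (K * (2 / m)), (m / 2); split; [by rewrite mulr_gt0// divr_gt0|lra|].
move=> th d dm pd j.
have d0 : 0 <= d.
  have r : 'I_M by exact: (Ordinal M_gt0).
  exact: le_trans (pd r).
pose lr : 'cV[R]_M := \col_r (ln (pmodel W th r) - ln (pmodel W th0 r)).
pose kap := ln (\sum_s expR ((W *m th0) s ord0)) - ln (\sum_s expR ((W *m th) s ord0)).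
have E : F *m col_mx (th - th0) (kap%:M) = lr.
  apply/colP => r; rewrite mul_row_col mulmxBr !mxE/= big_ord1 !mxE eqxx mulr1n mul1r.
  have n1 := model_norm_gt0 th; have n2 := model_norm_gt0 th0.
  rewrite /pmodel !ln_div ?posrE ?expR_gt0// !expRK /kap.
  rewrite !mxE; ring.
have lb (r : 'I_M) : `|lr r ord0| <= 2 / m * d.
  by rewrite mxE; apply: ln_ratio_bound => //; exact: pmodel_gt0.
have e0 : 0 <= 2 / m * d by rewrite mulr_ge0// divr_ge0// ltW.
have := @mulmx_entry_bound _ _ L lr _ _ erefl e0 lb (lshift 1 j).
rewrite -E mulmxA LF mul1mx col_mxEu => h.
apply: (le_trans h); rewrite -[K * _ * d]mulrA ler_wpM2r// lerDl//.
Qed.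

(** The coordinates of Sigma_p W b, the derivative of the model in direction [b]. *)
Definition tangent (p : 'I_M -> R) b (r : 'I_M) : R :=
  p r * ((W *m b) r ord0 - \sum_s p s * (W *m b) s ord0).

(** Exponential tilting: p(th + b) depends on [th] only through p(th), so its expansion reduces to
    moments of W b under that law. *)
Lemma pmodelD th b r :
  pmodel W (th + b) r = pmodel W th r * expR ((W *m b) r ord0) /
    \sum_s pmodel W th s * expR ((W *m b) s ord0).
Proof.
rewrite /pmodel.
have n1 := model_norm_gt0 th; have n2 := model_norm_gt0 (th + b).
set S := \sum_s expR ((W *m th) s ord0) in n1 *.
have EE s : expR ((W *m (th + b)) s ord0) = expR ((W *m th) s ord0) * expR ((W *m b) s ord0).
  by rewrite mulmxDr mxE expRD.
have -> : \sum_s expR ((W *m th) s ord0) / S * expR ((W *m b) s ord0) =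
   (\sum_s expR ((W *m (th + b)) s ord0)) / S.
  by rewrite mulr_suml; apply: eq_bigr => s _; rewrite EE; ring.
rewrite EE; field; rewrite !gt_eqF//.
Qed.

Lemma pmodel_expansion (th0 : 'cV[R]_M0) :
  exists2 C : R, 0 < C & forall b e, 0 <= e <= 1 -> (forall j, `|b j ord0| <= e) ->
    forall r, `|pmodel W (th0 + b) r - pmodel W th0 r - tangent (pmodel W th0) b r| <= C * e ^+ 2 /\
              `|pmodel W (th0 + b) r - pmodel W th0 r| <= C * e.
Proof.
pose K : R := \sum_i \sum_j `|W i j|.
have K0 : 0 <= K by apply: sumr_ge0 => i _; apply: sumr_ge0.
pose a : R := K ^+ 2 * expR K; have a0 : 0 <= a by rewrite mulr_ge0 ?exprn_ge0 ?expR_ge0.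
pose c : R := K * expR K; have c0 : 0 <= c by rewrite mulr_ge0 ?expR_ge0.
pose C : R := (2 * a + 2 * K * c) * expR K.
have C0 : 0 <= C by rewrite mulr_ge0 ?expR_ge0// addr_ge0 ?mulr_ge0.
exists (C + 2 * K + 1); first by lra.
move=> b e /andP[e0 e1] be r.
pose x s := (W *m b) s ord0; set p := pmodel W th0.
have p0 s : 0 <= p s by exact/ltW/pmodel_gt0.
have p1 : \sum_s p s = 1 by exact: pmodel_sum1.
have avg (f : 'I_M -> R) (y : R) : (forall s, `|f s| <= y) -> `|\sum_s p s * f s| <= y.
  move=> fy; apply: (le_trans (ler_norm_sum _ _ _)).
  have -> : y = \sum_s p s * y by rewrite -mulr_suml p1 mul1r.
  by apply: ler_sum => s _; rewrite normrM (ger0_norm (p0 s)) ler_wpM2l.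
have xe s : `|x s| <= K * e by exact: (@mulmx_entry_bound _ _ W b e K).
have Ke : K * e <= K by rewrite ler_piMr.
have Ke0 : 0 <= K * e by rewrite mulr_ge0.
have ex1 s : `|expR (x s) - 1 - x s| <= a * e ^+ 2.
  apply: (le_trans (expR_taylor1 _)).
  rewrite /a (_ : K ^+ 2 * expR K * e ^+ 2 = (K * e) ^+ 2 * expR K); last by ring.
  apply: ler_pM; rewrite ?exprn_ge0 ?expR_ge0//; first by rewrite lerXn2r ?nnegrE.
  by rewrite ler_expR (le_trans (xe s)).
have ex0 s : `|expR (x s) - 1| <= c * e.
  apply: (le_trans (expR_taylor0 _)).
  rewrite /c (_ : K * expR K * e = (K * e) * expR K); last by ring.
  by apply: ler_pM; rewrite ?expR_ge0// ler_expR (le_trans (xe s)).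
pose D := \sum_s p s * expR (x s); pose m := \sum_s p s * x s.
have Dlow : expR (- K) <= D.
  rewrite -[leLHS]mul1r -p1 mulr_suml; apply: ler_sum => s _; rewrite ler_wpM2l// ler_expR.
  by have := le_trans (xe s) Ke; rewrite ler_norml => /andP[].
have D0 : 0 < D := lt_le_trans (expR_gt0 _) Dlow.
have D1 : `|D - 1| <= c * e.
  rewrite -p1 -sumrB (eq_bigr (fun s => p s * (expR (x s) - 1))); first exact: avg.
  by move=> s _; ring.
have D2 : `|D - 1 - m| <= a * e ^+ 2.
  rewrite -p1 -!sumrB (eq_bigr (fun s => p s * (expR (x s) - 1 - x s))); first exact: avg.
  by move=> s _; ring.
have mb : `|m| <= K * e by exact: avg.
have xm : `|x r - m| <= 2 * K * e.
  by apply: (le_trans (ler_normB _ _)); have := xe r; lra.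
have main : `|pmodel W (th0 + b) r - p r - tangent p b r| <= C * e ^+ 2.
  rewrite pmodelD -/p /tangent -/(x r) -/m -/D.
  (* An exact identity: the second-order remainders of numerator and normalizer and a product of two
     first-order terms, over D >= exp (- K). *)
  rewrite (_ : p r * expR (x r) / D - p r - p r * (x r - m) =
     p r * ((expR (x r) - 1 - x r) - (D - 1 - m) - (x r - m) * (D - 1)) / D); last first.
    by field; rewrite gt_eqF.
  rewrite normrM (gtr0_norm (_ : 0 < D^-1)) ?invr_gt0// ler_pdivrMr// normrM (ger0_norm (p0 r)).
  apply: (@le_trans _ _ ((2 * a + 2 * K * c) * e ^+ 2)).
    rewrite -[leRHS]mul1r; apply: ler_pM => //; first exact: pmodel_le1.
    apply: (le_trans (ler_normB _ _)).
    have h1 : `|(x r - m) * (D - 1)| <= (2 * K * e) * (c * e) by rewrite normrM ler_pM.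
    have := ler_normB (expR (x r) - 1 - x r) (D - 1 - m).
    have := ex1 r; move: h1 D2; rewrite expr2; lra.
  have Q1 : 1 <= expR K * D.
    by apply: (@le_trans _ _ (expR K * expR (- K))); [rewrite -expRD subrr expR0|rewrite ler_pM2l ?expR_gt0].
  have g0 : 0 <= (2 * a + 2 * K * c) * e ^+ 2 by rewrite mulr_ge0 ?sqr_ge0// addr_ge0 ?mulr_ge0.
  rewrite /C (_ : _ * expR K * e ^+ 2 * D = (2 * a + 2 * K * c) * e ^+ 2 * (expR K * D)); last by ring.
  by rewrite ler_peMr.
have e2 : 0 <= e ^+ 2 by rewrite sqr_ge0.
have e2e : e ^+ 2 <= e by rewrite expr2 ler_piMr.
split.
  by apply: (le_trans main); rewrite ler_wpM2r//; lra.
have tb : `|tangent p b r| <= 2 * K * e.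
  rewrite /tangent normrM (ger0_norm (p0 r)) -[leRHS]mul1r; apply: ler_pM => //; exact: pmodel_le1.
rewrite -[X in `|X|](subrK (tangent p b r)); apply: (le_trans (ler_normD _ _)).
have : C * e ^+ 2 <= C * e by rewrite ler_wpM2l.
lra.
Qed.

End Model.

(** * Existence and consistency of the minimizer *)

Section Estimator.
Variables (R : realType) (M M0 : nat) (W : 'M[R]_(M, M0)).
Hypothesis M_gt0 : (0 < M)%N.
Hypothesis rkW : \rank (row_mx W (const_mx 1 : 'cV[R]_M)) = M0.+1.
Variable th0 : 'cV[R]_M0.
Notation p0 := (pmodel W th0).

Lemma cvg_dreal_pmodel (phi : R -> R) (p : 'I_M -> R) (U : Type) (F : set_system U)
    {FF : Filter F} (h : U -> 'cV[R]_M0) (th : 'cV[R]_M0) : admissible phi ->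
  (forall r, 0 < p r) ->
  (forall j, (fun u => h u j ord0) @ F --> th j ord0) ->
  (fun u => dreal phi p (pmodel W (h u))) @ F --> dreal phi p (pmodel W th).
Proof.
move=> [_ d1 _ _ _] pp hth.
have lin r : (fun u => (W *m h u) r ord0) @ F --> (W *m th) r ord0.
  rewrite mxE (_ : (fun u => _) = (fun u => \sum_j W r j * h u j ord0)).
    by apply: cvgr_bigsum => j; apply: cvgM; [exact: cvg_cst|exact: hth].
  by apply/funext => u; rewrite mxE.
have ex r : (fun u => expR ((W *m h u) r ord0)) @ F --> expR ((W *m th) r ord0).
  apply: (@cvg_comp _ _ _ (fun u => (W *m h u) r ord0) expR); first exact: lin.
  exact: continuous_expR.
have pc r : (fun u => pmodel W (h u) r) @ F --> pmodel W th r.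
  rewrite /pmodel; apply: cvgM; first exact: ex.
  apply: cvgV; first by rewrite gt_eqF// model_norm_gt0.
  by apply: cvgr_bigsum => s; exact: ex.
rewrite /dreal; apply: cvgr_bigsum => r; apply: cvgM; first exact: pc.
apply: (@cvg_comp _ _ _ (fun u => p r / pmodel W (h u) r) phi).
  apply: cvgM; first exact: cvg_cst.
  by apply: cvgV => //; rewrite gt_eqF// pmodel_gt0.
have cphi : {for p r / pmodel W th r, continuous phi}.
  apply: differentiable_continuous; apply/derivable1_diffP/d1.
  by rewrite divr_gt0// pmodel_gt0.
exact: cphi.
Qed.

Lemma dreal_pmodel_continuous (phi : R -> R) (p : 'I_M -> R) : admissible phi ->
  (forall r, 0 < p r) ->
  continuous (fun t : 'rV[R]_M0 => dreal phi p (pmodel W t^T)).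
Proof.
move=> adm pp x.
apply: (@cvg_dreal_pmodel phi p _ (nbhs x) (nbhs_filter x) (fun t : 'rV[R]_M0 => t^T) x^T) => // j.
rewrite mxE (_ : (fun u : 'rV[R]_M0 => _) = (fun u : 'rV[R]_M0 => u ord0 j)).
  exact: coord_continuous.
by apply/funext => u; rewrite mxE.
Qed.

Lemma wnorm2_ge0 (z : 'I_M -> R) : 0 <= wnorm2 p0 z.
Proof. by apply: sumr_ge0 => r _; rewrite divr_ge0 ?sqr_ge0// ltW// pmodel_gt0. Qed.

Lemma wnorm2_bound : exists2 K : R, 0 < K & forall (z : 'I_M -> R) d, 0 <= d ->
  (forall r, `|z r| <= d) -> wnorm2 p0 z <= K * d ^+ 2.
Proof.
have [m m0 hm] := pos_lower_bound (pmodel_gt0 W M_gt0 th0).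
exists (M%:R / m); first by rewrite divr_gt0// ltr0n.
move=> z d d0 zd; apply: (@le_trans _ _ (\sum_(r < M) d ^+ 2 / m)); last first.
  by rewrite sumr_const card_ord -[leLHS]mulr_natl (_ : M%:R / m * d ^+ 2 = M%:R * (d ^+ 2 / m))//; ring.
apply: ler_sum => r _; apply: ler_pM; rewrite ?sqr_ge0 ?invr_ge0 ?(ltW (pmodel_gt0 _ M_gt0 _ _))//.
  by rewrite -real_normK ?num_real// lerXn2r ?nnegrE.
by rewrite lef_pV2// posrE pmodel_gt0.
Qed.

Lemma entry_le_wnorm2 (z : 'I_M -> R) (t : R) r : 0 <= t -> wnorm2 p0 z <= t ^+ 2 ->
  `|z r| / Num.sqrt (p0 r) <= t /\ `|z r| <= t.
Proof.
move=> t0 zt; have pr := pmodel_gt0 W M_gt0 th0 r.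
have h : z r ^+ 2 / p0 r <= t ^+ 2.
  apply: le_trans zt; rewrite /wnorm2 (bigD1 r)//= lerDl sumr_ge0// => s _.
  by rewrite divr_ge0 ?sqr_ge0// ltW// pmodel_gt0.
have s0 : 0 < Num.sqrt (p0 r) by rewrite sqrtr_gt0.
have h1 : `|z r| / Num.sqrt (p0 r) <= t.
  rewrite -ler_sqr ?nnegrE ?divr_ge0// ?sqrtr_ge0// exprMn exprVn.
  by rewrite sqr_sqrtr ?(ltW pr)// real_normK ?num_real.
split => //; apply: le_trans h1; rewrite ler_pdivlMr// ler_piMr//.
by rewrite -sqrtr1 ler_wsqrtr// pmodel_le1.
Qed.

(** A parameter doing at least as well as [th0] has model probabilities near [p] by [dreal_away],
    hence near [p0]; the inverse bound confines it to a compact box, on which the divergence attains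
    its minimum. Outside the box every value exceeds the one at [th0]. *)
Lemma estimator_close (phi : R -> R) (e : R) : admissible phi -> 0 < e ->
  exists2 d, 0 < d & forall p, (forall r, `|p r - p0 r| <= d) ->
   [/\ forall r, 0 < p r,
     exists th, forall th', dreal phi p (pmodel W th) <= dreal phi p (pmodel W th') &
     forall th, dreal phi p (pmodel W th) <= dreal phi p p0 ->
       forall r, `|pmodel W th r - p0 r| <= e].
Proof.
move=> adm e0; have [_ _ _ _ [_ _ c0]] := adm; set c := derive1n 2 phi 1 in c0.
have [C [d1 [C0 d10 inv]]] := pmodel_inverse_bound M_gt0 th0 rkW.
have [e' [e'0 e'e e'd]] : exists e', [/\ 0 < e', e' <= e / 2 & e' <= d1 / 2].
  by exists (Num.min (e / 2) (d1 / 2)); rewrite lt_min !ge_min !lexx orbT !divr_gt0.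
have [b b0 hb] := @dreal_away R M phi e' adm e'0.
(* Relative accuracy 1 suffices to bound the divergence at [th0] by a multiple of d^2, below the
   threshold [b]. *)
have one1 : 0 < (1 : R) <= 1 by rewrite ltr01 lexx.
have [d2 d20 hd2] := dreal_quadratic adm (pmodel_gt0 W M_gt0 th0) one1.
have [K K0 hK] := wnorm2_bound.
have [d [d0 dd2 de' d1' db]] : exists d, [/\ 0 < d, d <= d2, d <= e', d <= 1 & d <= b / (2 * c * K)].
  exists (Num.min (Num.min d2 e') (Num.min 1 (b / (2 * c * K)))).
  by rewrite !lt_min !ge_min !lexx !orbT d20 e'0 ltr01/= divr_gt0// !mulr_gt0.
exists d => // p pd.
have pd2 r : `|p r - p0 r| <= d2 := le_trans (pd r) dd2.
have p0d2 r : `|p0 r - p0 r| <= d2 by rewrite subrr normr0 ltW.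
have [pp _ quad] := hd2 p p0 pd2 p0d2.
have small : dreal phi p p0 < b.
  have wn : wnorm2 p0 (fun r => p r - p0 r) <= K * d ^+ 2 by apply: hK => //; exact: ltW.
  have c2 : 0 < c / 2 by lra.
  move: quad; rewrite mul1r ler_distl => /andP[_ q2].
  have {}q2 : c / 2 * (2 / c * dreal phi p p0) <= c / 2 * (2 * (K * d ^+ 2)).
    by rewrite ler_pM2l//; lra.
  rewrite (_ : c / 2 * (2 / c * dreal phi p p0) = dreal phi p p0) in q2; last by field; rewrite gt_eqF.
  apply: (le_lt_trans q2).
  have cK : 0 < c * K by rewrite mulr_gt0.
  have : c * K * d ^+ 2 <= c * K * d by rewrite ler_pM2l// expr2 ler_piMr// ltW.
  have : c * K * d <= c * K * (b / (2 * c * K)) by rewrite ler_pM2l.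
  rewrite (_ : c * K * (b / (2 * c * K)) = b / 2); last by field; rewrite !gt_eqF.
  lra.
have near th : dreal phi p (pmodel W th) <= dreal phi p p0 ->
    forall r, `|pmodel W th r - p0 r| <= e' + d.
  move=> hth r.
  have : `|p r - pmodel W th r| < e'.
    rewrite ltNge; apply/negP => far.
    have := hb p (pmodel W th) r pp (pmodel_gt0 W M_gt0 th) (pmodel_le1 W M_gt0 th r) far.
    by move=> /le_trans/(_ hth); rewrite leNgt small.
  have := pd r; rewrite (_ : pmodel W th r - p0 r = (p r - p0 r) - (p r - pmodel W th r)); last by ring.
  by move=> h1 h2; apply: (le_trans (ler_normB _ _)); lra.
split => //.
  pose rho := C * (e' + d).
  pose A : set 'rV[R]_M0 := [set t | forall j, `[(th0 j ord0 - rho)%R, (th0 j ord0 + rho)%R]%classic (t ord0 j)].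
  have rho0 : 0 <= rho by rewrite mulr_ge0 ?(ltW C0)//; lra.
  have A0 : A th0^T.
    by move=> j /=; rewrite in_itv/= mxE; lra.
  have cA : compact A.
    apply: (@rV_compact R M0 (fun j => `[(th0 j ord0 - rho)%R, (th0 j ord0 + rho)%R]%classic)) => j.
    exact: segment_compact.
  have [t tA tmin] := EVT_min_rV (ex_intro _ _ A0) cA
    (continuous_subspaceT (dreal_pmodel_continuous adm pp)).
  exists t^T => th'.
  have [h|h] := leP (dreal phi p (pmodel W th')) (dreal phi p p0); last first.
    apply: le_trans (ltW h); have := tmin th0^T; rewrite trmxK; apply.
    by rewrite inE.
  have := tmin th'^T; rewrite trmxK; apply; rewrite inE => j /=.
  rewrite in_itv/= mxE.
  have e'dd : e' + d <= d1 by lra.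
  by have := inv th' (e' + d) e'dd (near th' h) j; rewrite !mxE ler_distl.
move=> th hth r; apply: (le_trans (near th hth r)); lra.
Qed.


End Estimator.

(** * The tangent space in Pearson's metric *)

Section Geometry.
Variables (R : realType) (M M0 : nat) (W : 'M[R]_(M, M0)).
Hypothesis M_gt0 : (0 < M)%N.
Hypothesis rkW : \rank (row_mx W (const_mx 1 : 'cV[R]_M)) = M0.+1.
Variable th0 : 'cV[R]_M0.
Notation p0 := (pmodel W th0).

Definition sqrtp : 'cV[R]_M := \col_r Num.sqrt (p0 r).
Definition scaled (z : 'I_M -> R) : 'cV[R]_M := \col_r (z r / Num.sqrt (p0 r)).
(** The matrix D_p^(-1/2) Sigma_p W at p = p(th0). *)
Definition scaled_jac : 'M[R]_(M, M0) :=
  \matrix_(r, j) (Num.sqrt (p0 r) * (W r j - \sum_s p0 s * W s j)).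

Let pp r : 0 < p0 r := pmodel_gt0 W M_gt0 th0 r.
Let sp r : 0 < Num.sqrt (p0 r).
Proof. by rewrite sqrtr_gt0. Qed.
Let sq r : Num.sqrt (p0 r) * Num.sqrt (p0 r) = p0 r.
Proof. by rewrite -expr2 sqr_sqrtr// ltW. Qed.

Lemma sqrtp_unit : sqrtp^T *m sqrtp = 1%:M.
Proof.
apply/matrixP => i j; rewrite !ord1 !mxE eqxx -[RHS](pmodel_sum1 W M_gt0 th0).
by apply: eq_bigr => r _; rewrite !mxE sq.
Qed.

Lemma sqrtp_scaled (z : 'I_M -> R) : \sum_r z r = 0 -> sqrtp^T *m scaled z = 0.
Proof.
move=> z0; apply/matrixP => i j; rewrite !ord1 !mxE -[RHS]z0; apply: eq_bigr => r _.
by rewrite !mxE mulrC mulfVK// gt_eqF.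
Qed.

Lemma nsq_scaled (z : 'I_M -> R) : nsq (scaled z) = wnorm2 p0 z.
Proof.
apply: eq_bigr => r _; rewrite !mxE -expr2 exprMn exprVn sqr_sqrtr//.
exact: ltW.
Qed.

Lemma scaled_tangent b : scaled (tangent W p0 b) = scaled_jac *m b.
Proof.
apply/colP => r; rewrite !mxE /tangent.
rewrite (_ : p0 r * _ / _ = Num.sqrt (p0 r) * ((W *m b) r ord0 - \sum_s p0 s * (W *m b) s ord0)); last first.
  by rewrite -{1}sq; field; rewrite gt_eqF.
under [RHS]eq_bigr do rewrite mxE -mulrA.
rewrite -mulr_sumr; congr (_ * _).
under [RHS]eq_bigr do rewrite mulrBl.
rewrite sumrB mxE; congr (_ - _).
under eq_bigr do rewrite mxE mulr_sumr.
rewrite exchange_big; apply: eq_bigr => j _; rewrite mulr_suml.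
by apply: eq_bigr => s _; rewrite mulrA.
Qed.

Lemma sqrtp_jac : sqrtp^T *m scaled_jac = 0.
Proof.
apply/matrixP => i j; rewrite !ord1 !mxE.
under eq_bigr do rewrite !mxE mulrA sq mulrBr.
by rewrite sumrB -mulr_suml pmodel_sum1// mul1r subrr.
Qed.

(** If the scaled Jacobian kills b, then W b equals its own mean [k] in every coordinate;
    independence of the columns of W and the constant vector forces b = 0. *)
Lemma jac_unit : scaled_jac^T *m scaled_jac \in unitmx.
Proof.
rewrite -row_free_unit -kermx_eq0; apply/eqP/row_matrixP => i; rewrite row0.
set v := row i _.
have vk : v *m (scaled_jac^T *m scaled_jac) = 0 by apply/sub_kermxP; exact: row_sub.
pose b := v^T.
have nb : nsq (scaled_jac *m b) = 0.
  have : ((nsq (scaled_jac *m b))%:M : 'M[R]_1) = 0.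
    by rewrite dotcE trmx_mul trmxK -mulmxA [X in v *m X]mulmxA mulmxA vk mul0mx.
  by move=> /matrixP/(_ ord0 ord0); rewrite !mxE eqxx mulr1n.
have Bb0 r : (scaled_jac *m b) r ord0 = 0.
  move: nb; rewrite /nsq /dotc => /eqP; rewrite psumr_eq0; last by move=> s _; rewrite -expr2 sqr_ge0.
  by move=> /allP/(_ r (mem_index_enum _)); rewrite /= mulf_eq0 orbb => /eqP.
have Wb r : (W *m b) r ord0 = \sum_s p0 s * (W *m b) s ord0.
  have := Bb0 r; rewrite -scaled_tangent mxE /tangent; set X := _ - _ => h.
  have h2 : p0 r * X = 0 by rewrite -[LHS](divfK (lt0r_neq0 (sp r))) h mul0r.
  by apply/eqP; rewrite -subr_eq0 -/X; apply/eqP/(mulfI (lt0r_neq0 (pp r))); rewrite h2 mulr0.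
set k := \sum_s _ in Wb.
have : row_full (row_mx W (const_mx 1 : 'cV[R]_M)) by rewrite /row_full rkW addn1.
move=> /row_fullP[L LF].
have z0 : col_mx b ((- k)%:M) = 0.
  rewrite -[LHS]mul1mx -LF -mulmxA mul_row_col (_ : _ + _ = 0) ?mulmx0//.
  by apply/colP => r; rewrite mxE Wb !mxE big_ord1 !mxE eqxx mulr1n mul1r subrr.
by rewrite -[LHS]trmxK -/b; have := congr1 usubmx z0; rewrite col_mxKu => ->; rewrite linear0 trmx0.
Qed.

Definition Qproj : 'M[R]_M := resproj sqrtp scaled_jac.
Definition Qform (z : 'I_M -> R) : R := nsq (Qproj *m scaled z).

Lemma scaledB (y z : 'I_M -> R) : scaled (fun r => y r - z r) = scaled y - scaled z.
Proof. by apply/colP => r; rewrite !mxE mulrBl. Qed.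

Lemma Qform_le (z : 'I_M -> R) b :
  Qform z <= wnorm2 p0 (fun r => z r - tangent W p0 b r).
Proof.
rewrite -nsq_scaled scaledB scaled_tangent.
exact: nsq_resproj_le sqrtp_unit sqrtp_jac jac_unit _ _.
Qed.

Lemma Qform_le_wnorm2 (z : 'I_M -> R) : Qform z <= wnorm2 p0 z.
Proof.
have := Qform_le z 0; rewrite (_ : (fun r => _) = z)//.
apply/funext => r; rewrite /tangent mulmx0 mxE sub0r big1 ?oppr0 ?mulr0 ?subr0//.
by move=> s _; rewrite mxE mulr0.
Qed.

(** The least squares parameter is bounded linearly by the size of [z], so the remainder of the
    model at it is quadratic in that size. *)
Lemma Qform_attained : exists2 K : R, 0 < K & forall (z : 'I_M -> R) t, 0 <= t ->
  \sum_r z r = 0 -> wnorm2 p0 z <= t ^+ 2 ->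
  exists2 b : 'cV[R]_M0, (forall j, `|b j ord0| <= K * t) &
    wnorm2 p0 (fun r => z r - tangent W p0 b r) = Qform z.
Proof.
pose A := invmx (scaled_jac^T *m scaled_jac) *m scaled_jac^T.
pose K := \sum_i \sum_j `|A i j|.
have K0 : 0 <= K by apply: sumr_ge0 => i _; apply: sumr_ge0.
exists (K + 1); first by lra.
move=> z t t0 sz zt; exists (A *m scaled z).
  move=> j; apply: (@le_trans _ _ (K * t)); last by rewrite ler_wpM2r//; lra.
  apply: (@mulmx_entry_bound _ _ _ A _ t K) => // r.
  rewrite mxE normrM (gtr0_norm (_ : 0 < (Num.sqrt (p0 r))^-1)) ?invr_gt0//.
  by have [] := entry_le_wnorm2 M_gt0 r t0 zt.
rewrite -nsq_scaled scaledB scaled_tangent /Qform.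
by rewrite (resproj_lsq _ (sqrtp_scaled sz)).
Qed.

End Geometry.

(** * Quadratic expansion of the statistic at the estimator *)

Section Expansion.
Variables (R : realType) (M M0 : nat) (W : 'M[R]_(M, M0)).
Hypothesis M_gt0 : (0 < M)%N.
Hypothesis rkW : \rank (row_mx W (const_mx 1 : 'cV[R]_M)) = M0.+1.
Variable th0 : 'cV[R]_M0.
Notation p0 := (pmodel W th0).

(** Young's inequality: 2 |x y| is at most e x^2 + y^2 / e. *)
Lemma wnorm2_young (x y : 'I_M -> R) (e : R) : 0 < e ->
  (1 - e) * wnorm2 p0 x - wnorm2 p0 y / e <= wnorm2 p0 (fun r => x r - y r) <=
  (1 + e) * wnorm2 p0 x + (1 + e^-1) * wnorm2 p0 y.
Proof.
move=> e0; rewrite /wnorm2 mulr_suml !mulr_sumr -sumrB -big_split/=.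
apply/andP; split; apply: ler_sum => r _; have pr := pmodel_gt0 W M_gt0 th0 r.
- rewrite -subr_ge0 (_ : _ - _ = (e * (x r - y r / e) ^+ 2 + y r ^+ 2) / p0 r).
    by rewrite divr_ge0 ?(ltW pr)// addr_ge0 ?sqr_ge0// mulr_ge0 ?sqr_ge0// ltW.
  by field; rewrite !gt_eqF.
- rewrite -subr_ge0 (_ : _ - _ = (e * (x r + y r / e) ^+ 2) / p0 r).
    by rewrite divr_ge0 ?(ltW pr)// mulr_ge0 ?sqr_ge0// ltW.
  by field; rewrite !gt_eqF.
Qed.

(* In the next three lemmas [n'] is the squared distance from the data to the fitted
   probabilities, and [N], [Q] are the ones to the true probabilities and to the
   tangent space. *)
Lemma near_min_bound (e n' N : R) : 0 < e <= 1 / 32 -> 0 <= n' -> 0 <= N ->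
  (1 - e) * n' <= (1 + e) * N -> n' <= 2 * N.
Proof.
move=> /andP[e0 e1] n0 N0 h.
have : e * n' <= 1 / 32 * n' by rewrite ler_wpM2r.
have : e * N <= 1 / 32 * N by rewrite ler_wpM2r.
lra.
Qed.

Lemma near_min_bound2 (e n' Q X : R) : 0 < e <= 1 / 32 -> 0 <= Q -> 0 <= X ->
  (1 - e) * n' <= (1 + e) * ((1 + e) * Q + 2 * X) -> n' <= (1 + 7 * e) * Q + 4 * X.
Proof.
move=> /andP[e0 e32] Q0 X0 u3.
have e1 : 0 < 1 - e by lra.
rewrite -(ler_pM2l e1); apply: (le_trans u3).
have eQ : 0 <= e * Q by rewrite mulr_ge0// ltW.
have eQ2 : e * (e * Q) <= 1 / 32 * (e * Q) by rewrite ler_wpM2r.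
have eX : e * X <= 1 / 32 * X by rewrite ler_wpM2r.
lra.
Qed.

Lemma near_min_bound3 (e n' Q N X1 X2 D : R) : 0 < e <= 1 / 32 -> 0 <= Q <= N ->
  0 <= X1 -> 0 <= X2 -> X1 + X2 <= 8 * e * N ->
  (1 - e) * Q - X1 <= n' -> n' <= (1 + 7 * e) * Q + X2 ->
  (1 - e) * n' <= D -> D <= (1 + e) * n' -> `|D - Q| <= 32 * (e * N).
Proof.
move=> /andP[e0 e32] /andP[Q0 QN] X10 X20 KE low up D1 D2.
have eQ : 0 <= e * Q <= e * N by rewrite mulr_ge0 ?(ltW e0)//= ler_pM2l.
have e1 : 0 < 1 - e by lra.
have e1' : 0 < 1 + e by lra.
have l2 : (1 - e) * ((1 - e) * Q - X1) <= (1 - e) * n' by rewrite ler_pM2l.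
have u2 : (1 + e) * n' <= (1 + e) * ((1 + 7 * e) * Q + X2) by rewrite ler_pM2l.
have eQ0 : 0 <= e * Q by case/andP: eQ.
have eQ2 : e * (e * Q) <= 1 / 32 * (e * Q) by rewrite ler_wpM2r.
have eQ3 : 0 <= e * (e * Q) by rewrite mulr_ge0 ?(ltW e0).
have eX1 : 0 <= e * X1 <= 1 / 32 * X1 by rewrite mulr_ge0 ?(ltW e0)//= ler_wpM2r.
have eX2 : 0 <= e * X2 <= 1 / 32 * X2 by rewrite mulr_ge0 ?(ltW e0)//= ler_wpM2r.
rewrite ler_distl; apply/andP; split; lra.
Qed.

(** [phi2] selects the parameter, [phi1] measures the fit. With N the squared distance from [p] to
    [p0], remainders of the model have squared norm O(N^2), and Young's inequality costs a factor 1
    / e; this is at most 8 e N once N is small compared with e^2. *)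
Lemma estimator_expansion (phi1 phi2 : R -> R) (eta : R) :
  admissible phi1 -> admissible phi2 -> 0 < eta <= 1 ->
  exists2 d, 0 < d & forall p, \sum_r p r = 1 -> (forall r, `|p r - p0 r| <= d) ->
   [/\ forall r, 0 < p r,
     exists th, forall th', dreal phi2 p (pmodel W th) <= dreal phi2 p (pmodel W th') &
     forall th, (forall th', dreal phi2 p (pmodel W th) <= dreal phi2 p (pmodel W th')) ->
       (forall r, `|pmodel W th r - p0 r| <= eta) /\
       `|2 / derive1n 2 phi1 1 * dreal phi1 p (pmodel W th) - Qform W th0 (fun r => p r - p0 r)|
        <= eta * wnorm2 p0 (fun r => p r - p0 r)].
Proof.
move=> adm1 adm2 /andP[eta0 eta1].
have [_ _ _ _ [_ _ c10]] := adm1; have [_ _ _ _ [_ _ c20]] := adm2.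
set c1 := derive1n 2 phi1 1 in c10 *; set c2 := derive1n 2 phi2 1 in c20.
pose e := eta / 32.
have e0 : 0 < e by rewrite /e; lra.
have e32 : e <= 1 / 32 by rewrite /e; lra.
have e01 : 0 < e <= 1 by lra.
have e032 : 0 < e <= 1 / 32 by rewrite e0.
have e1p : 0 <= 1 - e by lra.
have e1q : 0 <= 1 + e by lra.
have pp := pmodel_gt0 W M_gt0 th0.
have [d1 d10 hd1] := dreal_quadratic adm1 pp e01.
have [d2 d20 hd2] := dreal_quadratic adm2 pp e01.
have [Ci [di [Ci0 di0 inv]]] := pmodel_inverse_bound M_gt0 th0 rkW.
have [Ce Ce0 expn] := pmodel_expansion W M_gt0 th0.
have [Kw Kw0 hKw] := wnorm2_bound W M_gt0 th0.
have [Ka Ka0 att] := Qform_attained W M_gt0 th0.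
have [eps [eps0 epsd1 epsd2 epse]] : exists eps, [/\ 0 < eps, eps <= d1, eps <= d2 & eps <= eta].
  exists (Num.min (Num.min d1 d2) eta).
  by rewrite !lt_min !ge_min !lexx !orbT d10 d20 eta0.
have [dc dc0 close] := estimator_close M_gt0 rkW th0 adm2 eps0.
(* bounds on the remainders of the tangent approximations at the estimator
   and at the linear least squares parameter, respectively *)
pose K1 := Kw * (Ce * (3 * Ci) ^+ 2) ^+ 2.
pose K2 := Kw * (Ce * Ka ^+ 2) ^+ 2.
have K10 : 0 < K1 by rewrite mulr_gt0// exprn_gt0// mulr_gt0// exprn_gt0// mulr_gt0.
have K20 : 0 < K2 by rewrite mulr_gt0// exprn_gt0// mulr_gt0// exprn_gt0.
pose K := K1 + 4 * K2.
have K0 : 0 < K by rewrite addr_gt0// mulr_gt0.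
(* [t1] will bound t = sqrt N. It keeps both parameters in the range of the local estimates, the
   comparison vector within [eps] of [p0], and K N^2 / e below 8 e N. *)
have [t1 [t10 t1i t1C t1K [t1e t1N]]] : exists t1, [/\ 0 < t1, 3 * t1 <= di, 3 * Ci * t1 <= 1,
    Ka * t1 <= 1 & Ce * (Ka * t1) <= eps /\ K * t1 ^+ 2 <= 8 * e ^+ 2].
  pose t1 := Num.min (Num.min (di / 3) (1 / (3 * Ci))) (Num.min (Num.min (1 / Ka) (eps / (Ce * Ka))) (Num.min 1 (8 * e ^+ 2 / K))).
  have m1 : t1 <= di / 3 by rewrite !ge_min lexx.
  have m2 : t1 <= 1 / (3 * Ci) by rewrite !ge_min lexx !orbT.
  have m3 : t1 <= 1 / Ka by rewrite !ge_min lexx !orbT.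
  have m4 : t1 <= eps / (Ce * Ka) by rewrite !ge_min lexx !orbT.
  have m5 : t1 <= 1 by rewrite !ge_min lexx !orbT.
  have m6 : t1 <= 8 * e ^+ 2 / K by rewrite !ge_min lexx !orbT.
  have m0 : 0 < t1.
    by rewrite !lt_min ltr01 !divr_gt0// ?mulr_gt0// ?exprn_gt0// mulr_gt0.
  have C3 : 0 < 3 * Ci by rewrite mulr_gt0.
  have CK : 0 < Ce * Ka by rewrite mulr_gt0.
  exists t1; split => //.
  - by rewrite mulrC -ler_pdivlMr.
  - by rewrite mulrC -ler_pdivlMr.
  - by rewrite mulrC -ler_pdivlMr.
  - split; first by rewrite mulrA mulrC -ler_pdivlMr.
    apply: (@le_trans _ _ (K * t1)); first by rewrite ler_pM2l// expr2 ler_piMr// ltW.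
    by rewrite mulrC -ler_pdivlMr.
pose d := Num.min (Num.min dc eps) (t1 / (Kw + 1)).
have dd1 : d <= dc by rewrite !ge_min lexx.
have dd2 : d <= eps by rewrite !ge_min lexx !orbT.
have dd3 : d <= t1 / (Kw + 1) by rewrite !ge_min lexx !orbT.
have d0 : 0 < d by rewrite !lt_min dc0 eps0 divr_gt0// addr_gt0.
move: d dd1 dd2 dd3 d0 => d dd1 dd2 dd3 d0.
exists d => // p p1 pd.
have [ppos ex near] := close p (fun r => le_trans (pd r) dd1).
split => // th thmin.
have thnear := near th (thmin th0).
split; first by move=> r; apply: le_trans epse; exact: thnear.
pose z := fun r => p r - p0 r.
have sz : \sum_r z r = 0 by rewrite sumrB p1 pmodel_sum1// subrr.
set N := wnorm2 p0 z.
have N0 : 0 <= N by exact: wnorm2_ge0.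
set t := Num.sqrt N.
have tt0 : 0 <= t by rewrite sqrtr_ge0.
have tN : t ^+ 2 = N by rewrite sqr_sqrtr.
have tt1 : t <= t1.
  rewrite -ler_sqr ?nnegrE ?(ltW t10)// tN.
  apply: (@le_trans _ _ (Kw * d ^+ 2)); first by apply: hKw => //; exact: ltW.
  have Kw1 : 0 < Kw + 1 by rewrite addr_gt0.
  apply: (@le_trans _ _ ((Kw + 1) ^+ 2 * d ^+ 2)).
    rewrite ler_wpM2r ?sqr_ge0//; have := sqr_ge0 Kw; rewrite !expr2; lra.
  rewrite -exprMn lerXn2r ?nnegrE ?mulr_ge0 ?(ltW Kw1) ?(ltW d0) ?(ltW t10)//.
  by rewrite mulrC -ler_pdivlMr.
set Q := Qform W th0 z.
have QN : Q <= N by exact: Qform_le_wnorm2.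
have Q0 : 0 <= Q by exact: nsq_ge0.
have zt : wnorm2 p0 z <= t ^+ 2 by rewrite tN.
have zr r : `|z r| <= t by have [] := entry_le_wnorm2 M_gt0 r tt0 zt.
have pd1 r : `|p r - p0 r| <= d1 := le_trans (pd r) (le_trans dd2 epsd1).
have pd2 r : `|p r - p0 r| <= d2 := le_trans (pd r) (le_trans dd2 epsd2).
have quad1 th' : (forall r, `|pmodel W th' r - p0 r| <= eps) ->
    (1 - e) * wnorm2 p0 (fun r => p r - pmodel W th' r) <= 2 / c1 * dreal phi1 p (pmodel W th')
      <= (1 + e) * wnorm2 p0 (fun r => p r - pmodel W th' r).
  move=> h; have [_ _] := hd1 p (pmodel W th') pd1 (fun r => le_trans (h r) epsd1).
  by rewrite ler_distl -/c1 [(1 - e) * _]mulrBl [(1 + e) * _]mulrDl !mul1r.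
have quad2 th' : (forall r, `|pmodel W th' r - p0 r| <= eps) ->
    (1 - e) * wnorm2 p0 (fun r => p r - pmodel W th' r) <= 2 / c2 * dreal phi2 p (pmodel W th')
      <= (1 + e) * wnorm2 p0 (fun r => p r - pmodel W th' r).
  move=> h; have [_ _] := hd2 p (pmodel W th') pd2 (fun r => le_trans (h r) epsd2).
  by rewrite ler_distl -/c2 [(1 - e) * _]mulrBl [(1 + e) * _]mulrDl !mul1r.
have min2 th' : 2 / c2 * dreal phi2 p (pmodel W th) <= 2 / c2 * dreal phi2 p (pmodel W th').
  by rewrite ler_pM2l ?divr_gt0.
set nh := wnorm2 p0 (fun r => p r - pmodel W th r).
have /andP[D1l D1u] := quad1 th thnear; have /andP[D2l _] := quad2 th thnear.
rewrite -/nh in D1l D1u D2l.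
have nh0 : 0 <= nh by exact: wnorm2_ge0.
(* A crude comparison with [th0] itself: the fitted vector is within 2 t of [p], hence within 3 t of
   [p0], so th - th0 is of order t. *)
have nh2 : nh <= 2 * N.
  have p0near r : `|p0 r - p0 r| <= eps by rewrite subrr normr0 ltW.
  have /andP[_ u] := quad2 th0 p0near; rewrite -/z -/N in u.
  exact: near_min_bound e032 nh0 N0 (le_trans D2l (le_trans (min2 th0) u)).
have low : (1 - e) * Q - K1 * N ^+ 2 / e <= nh.
  pose b := th - th0.
  have nh4 : nh <= (2 * t) ^+ 2 by rewrite exprMn tN (le_trans nh2)// ler_wpM2r// expr2 ler_peMl// ler1n.
  have t20 : 0 <= 2 * t by rewrite mulr_ge0.
  have pth r : `|pmodel W th r - p0 r| <= 3 * t.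
    have [_ h] := entry_le_wnorm2 M_gt0 r t20 nh4.
    rewrite (_ : _ - _ = z r - (p r - pmodel W th r)); last by rewrite /z; ring.
    by apply: (le_trans (ler_normB _ _)); rewrite (_ : 3 * t = t + 2 * t); [apply: lerD|ring].
  have t3 : 3 * t <= di by apply: le_trans t1i; rewrite ler_pM2l.
  have bb := inv th (3 * t) t3 pth.
  have ce01 : 0 <= Ci * (3 * t) <= 1.
    rewrite !mulr_ge0 ?(ltW Ci0)//=; apply: le_trans t1C.
    by rewrite mulrA [Ci * 3]mulrC ler_pM2l// mulr_gt0.
  pose rem r := pmodel W th r - p0 r - tangent W p0 b r.
  have remb r : `|rem r| <= Ce * (Ci * (3 * t)) ^+ 2.
    have [+ _] := expn b _ ce01 bb r.
    by rewrite (_ : th0 + b = th)// /b subrKC.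
  have := hKw rem _ (le_trans (normr_ge0 _) (remb (Ordinal M_gt0))) remb.
  rewrite (_ : Kw * (Ce * (Ci * (3 * t)) ^+ 2) ^+ 2 = K1 * (t ^+ 2) ^+ 2); last by rewrite /K1; ring.
  rewrite tN => remK.
  have /andP[yl _] := wnorm2_young (fun r => z r - tangent W p0 b r) rem e0.
  rewrite (_ : (fun r => _ - rem r) = (fun r => p r - pmodel W th r)) in yl; last first.
    by apply/funext => r; rewrite /rem /z; ring.
  apply: le_trans yl; apply: lerB.
    by rewrite ler_wpM2l ?Qform_le.
  by rewrite ler_wpM2r// invr_ge0 ltW.
have up : nh <= (1 + 7 * e) * Q + 4 * K2 * N ^+ 2 / e.
  have [b bb Qb] := att z t tt0 sz zt.
  have ce01 : 0 <= Ka * t <= 1.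
    rewrite mulr_ge0 ?(ltW Ka0)//=; apply: le_trans t1K; by rewrite ler_pM2l.
  have ex2 := expn b _ ce01 bb.
  have bnear r : `|pmodel W (th0 + b) r - p0 r| <= eps.
    have [_ h] := ex2 r; apply: (le_trans h); apply: le_trans t1e.
    by rewrite ler_pM2l// ler_pM2l.
  pose rem r := pmodel W (th0 + b) r - p0 r - tangent W p0 b r.
  have remb r : `|rem r| <= Ce * (Ka * t) ^+ 2 by have [] := ex2 r.
  have := hKw rem _ (le_trans (normr_ge0 _) (remb (Ordinal M_gt0))) remb.
  rewrite (_ : Kw * (Ce * (Ka * t) ^+ 2) ^+ 2 = K2 * (t ^+ 2) ^+ 2); last by rewrite /K2; ring.
  rewrite tN => remK.
  have /andP[_ yu] := wnorm2_young (fun r => z r - tangent W p0 b r) rem e0.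
  rewrite (_ : (fun r => _ - rem r) = (fun r => p r - pmodel W (th0 + b) r)) in yu; last first.
    by apply/funext => r; rewrite /rem /z; ring.
  rewrite Qb -/Q in yu.
  have /andP[_ u] := quad2 _ bnear.
  have {}u := le_trans D2l (le_trans (min2 (th0 + b)) u).
  set ns := wnorm2 _ _ in u yu.
  have ei : 1 <= e^-1 by rewrite invf_ge1//; case/andP: e01.
  have X0 : 0 <= K2 * N ^+ 2 by rewrite mulr_ge0 ?sqr_ge0// ltW.
  have yu2 : ns <= (1 + e) * Q + 2 * (K2 * N ^+ 2 / e).
    apply: (le_trans yu); rewrite lerD2l.
    apply: (@le_trans _ _ ((1 + e^-1) * (K2 * N ^+ 2))); first by rewrite ler_wpM2l// addr_ge0// (le_trans ler01).
    rewrite [_ / e]mulrC (_ : 2 * (e^-1 * _) = e^-1 * (K2 * N ^+ 2) + e^-1 * (K2 * N ^+ 2)); last by ring.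
    by rewrite mulrDl lerD2r ler_wpM2r.
  have X1 : 0 <= K2 * N ^+ 2 / e by rewrite divr_ge0// ltW.
  set X := K2 * N ^+ 2 / e in yu2 X1.
  have u3 : (1 - e) * nh <= (1 + e) * ((1 + e) * Q + 2 * X).
    by apply: (le_trans u); rewrite ler_wpM2l.
  rewrite (_ : 4 * K2 * N ^+ 2 / e = 4 * X); last by rewrite /X; ring.
  exact: near_min_bound2 u3.
have N20 : 0 <= N ^+ 2 by rewrite sqr_ge0.
have KN : K * N ^+ 2 / e <= 8 * e * N.
  rewrite ler_pdivrMr// expr2 mulrA (_ : 8 * e * N * e = 8 * e ^+ 2 * N); last by ring.
  rewrite ler_wpM2r//; apply: le_trans t1N; rewrite ler_pM2l// -tN.
  by rewrite lerXn2r ?nnegrE ?(ltW t10).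
have K1e : 0 <= K1 * N ^+ 2 / e by rewrite divr_ge0 ?mulr_ge0// ltW.
have K2e : 0 <= 4 * K2 * N ^+ 2 / e by rewrite divr_ge0 ?mulr_ge0// ltW.
have KE : K * N ^+ 2 / e = K1 * N ^+ 2 / e + 4 * K2 * N ^+ 2 / e by rewrite /K; ring.
set X1 := K1 * N ^+ 2 / e in low K1e KE; set X2 := 4 * K2 * N ^+ 2 / e in up K2e KE.
have etaE : eta * N = 32 * (e * N) by rewrite /e; field.
rewrite -/Q -/N etaE; apply: near_min_bound3 low up D1l D1u => //.
  by rewrite Q0.
by rewrite -KE.
Qed.

End Expansion.

(** * Limit law of the quadratic form *)

Section ClusterMoments.
Variables (R : realType) (M M0 : nat) (W : 'M[R]_(M, M0)).
Hypothesis M_gt0 : (0 < M)%N.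
Hypothesis rkW : \rank (row_mx W (const_mx 1 : 'cV[R]_M)) = M0.+1.
Variable th0 : 'cV[R]_M0.
Notation p0 := (pmodel W th0).
Variables (n : nat) (q : cvec M n -> R) (vth : R).
Hypothesis q1 : \sum_v q v = 1.
Hypothesis Eq : forall r, \sum_v q v * (v r : nat)%:R = n%:R * p0 r.
Hypothesis Vq : forall r s, \sum_v q v * (((v r : nat)%:R - n%:R * p0 r) * ((v s : nat)%:R - n%:R * p0 s))
  = vth * n%:R * ((r == s)%:R * p0 r - p0 r * p0 s).

Definition centered (v : cvec M n) (r : 'I_M) : R := (v r : nat)%:R - n%:R * p0 r.

Lemma centered_mean r : \sum_v q v * centered v r = 0.
Proof.
under eq_bigr do rewrite mulrBr.
by rewrite sumrB Eq -mulr_suml q1 mul1r subrr.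
Qed.

Lemma centered_le v r : `|centered v r| <= n%:R.
Proof.
have pr := pmodel_gt0 W M_gt0 th0 r; have pr1 := pmodel_le1 W M_gt0 th0 r.
have v1 : ((v r : nat)%:R : R) <= n%:R by rewrite ler_nat -ltnS.
have v0 : 0 <= ((v r : nat)%:R : R) by [].
have np0 : 0 <= n%:R * p0 r by rewrite mulr_ge0// ltW.
have np1 : n%:R * p0 r <= n%:R by rewrite ler_piMr.
by rewrite /centered ler_norml; lra.
Qed.

(** The scaled covariance is a multiple of I - s s^T with s = [sqrtp], and the rank-one part
    vanishes on vectors orthogonal to s. *)
Lemma scaled_second_moment (u : 'cV[R]_M) : dotc u (sqrtp W th0) = 0 ->
  \sum_v q v * dotc u (scaled W th0 (centered v)) ^+ 2 = vth * n%:R * nsq u.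
Proof.
move=> us.
have sp r : 0 < Num.sqrt (p0 r) by rewrite sqrtr_gt0 pmodel_gt0.
have sq r : Num.sqrt (p0 r) ^+ 2 = p0 r by rewrite sqr_sqrtr// ltW// pmodel_gt0.
pose a r := u r ord0 / Num.sqrt (p0 r).
transitivity (\sum_r \sum_s a r * a s * (vth * n%:R * ((r == s)%:R * p0 r - p0 r * p0 s))).
  under [RHS]eq_bigr => r _ do under eq_bigr => s _ do rewrite -Vq mulr_sumr.
  under [RHS]eq_bigr => r _ do rewrite exchange_big.
  rewrite exchange_big; apply: eq_bigr => v _ /=.
  rewrite /dotc expr2 mulr_suml mulr_sumr; apply: eq_bigr => r _.
  rewrite mulrC mulr_sumr mulr_suml; apply: eq_bigr => s _.
  by rewrite !mxE /a /centered; ring.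
have E r : \sum_s a r * a s * (vth * n%:R * ((r == s)%:R * p0 r - p0 r * p0 s)) =
    vth * n%:R * (u r ord0 * u r ord0) - vth * n%:R * (a r * p0 r) * dotc u (sqrtp W th0).
  rewrite /dotc mulr_sumr.
  under eq_bigr do rewrite mulrBr mulrBr; rewrite sumrB; congr (_ - _).
    rewrite (bigD1 r)//= eqxx mul1r big1 ?addr0; last first.
      by move=> s sr; rewrite eq_sym (negbTE sr) mul0r !mulr0.
    by rewrite /a -{3}sq; field; rewrite gt_eqF.
  apply: eq_bigr => s _; rewrite mxE /a -{2}[p0 s]sq; field.
  by rewrite !gt_eqF.
under eq_bigr do rewrite E us mulr0 subr0.
by rewrite -mulr_sumr.
Qed.

Notation P := (Qproj W th0).
Let PssH := sqrtp_unit W M_gt0 th0.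
Let PsBH := sqrtp_jac W M_gt0 th0.
Let PBBH := jac_unit M_gt0 rkW th0.

Lemma Qproj_fix_sqrtp (u : 'cV[R]_M) : P *m u = u -> dotc u (sqrtp W th0) = 0.
Proof.
move=> Pu; rewrite -Pu -dotc_resproj (resproj_s PssH PsBH).
by rewrite /dotc big1// => r _; rewrite [X in _ * X]mxE mulr0.
Qed.

Lemma projected_second_moment (u : 'cV[R]_M) : P *m u = u ->
  \sum_v q v * dotc u (P *m scaled W th0 (centered v)) ^+ 2 = vth * n%:R * nsq u.
Proof.
move=> Pu; rewrite -(scaled_second_moment (Qproj_fix_sqrtp Pu)).
by apply: eq_bigr => v _; rewrite dotc_resproj -/P Pu.
Qed.

(** The squared norm is a sum over the columns of P, each fixed by P; their squared norms add up to
    the trace. *)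
Lemma projected_norm_moment :
  \sum_v q v * nsq (P *m scaled W th0 (centered v)) = vth * n%:R * (M%:R - 1 - M0%:R).
Proof.
rewrite -(sum_nsq_col_resproj PssH PsBH PBBH) mulr_sumr.
have Pc r : P *m col r P = col r P.
  by rewrite colE mulmxA (resproj_idem PssH PsBH PBBH).
under [RHS]eq_bigr => r _ do rewrite -(scaled_second_moment (Qproj_fix_sqrtp (Pc r))).
rewrite exchange_big; apply: eq_bigr => v _; rewrite -mulr_sumr; congr (_ * _).
rewrite /nsq {1}/dotc; apply: eq_bigr => r _; rewrite -expr2; congr (_ ^+ 2).
rewrite mxE; apply: eq_bigr => s _; congr (_ * _).
by rewrite [RHS]mxE -{1}[Qproj W th0]/(resproj _ _) -resproj_sym mxE.
Qed.

Lemma projected_mean r :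
  \sum_v q v * (P *m scaled W th0 (centered v)) r ord0 = 0.
Proof.
under eq_bigr do rewrite mxE mulr_sumr.
rewrite exchange_big big1//= => s _.
transitivity (P r s / Num.sqrt (p0 s) * \sum_v q v * centered v s); last first.
  by rewrite centered_mean mulr0.
by rewrite mulr_sumr; apply: eq_bigr => v _; rewrite [scaled _ _ _ _ _]mxE; ring.
Qed.

Lemma projected_norm_le (K : R) :
  (forall (z : 'I_M -> R) d, 0 <= d -> (forall r, `|z r| <= d) -> wnorm2 p0 z <= K * d ^+ 2) ->
  forall v, nsq (P *m scaled W th0 (centered v)) <= K * n%:R ^+ 2.
Proof.
move=> hK v; apply: (le_trans (Qform_le_wnorm2 M_gt0 rkW th0 (centered v))).
by apply: hK => // r; exact: centered_le.
Qed.

End ClusterMoments.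

(** * Normalized sums over clusters and their limit *)

Section ClusterSampling.
Variables (R : realType) (M M0 G : nat) (W : 'M[R]_(M, M0)).
Hypothesis M_gt0 : (0 < M)%N.
Hypothesis M0_lt : (M0 < M - 1)%N.
Hypothesis rkW : \rank (row_mx W (const_mx 1 : 'cV[R]_M)) = M0.+1.
Variables (th0 : 'cV[R]_M0) (rho2 : R) (n : 'I_G -> nat) (Ng : nat -> 'I_G -> nat).
Variable q : forall g : 'I_G, cvec M (n g) -> R.
Notation p0 := (pmodel W th0).
Hypothesis n_ge2 : forall g, (2 <= n g)%N.
Hypothesis Ng_sum : forall N, (\sum_(g < G) Ng N g = N)%N.
Hypothesis rho2_ge0 : 0 <= rho2.
Hypothesis q_ge0 : forall g v, 0 <= q (g := g) v.
Hypothesis q_sum1 : forall g, \sum_(v : cvec M (n g)) q v = 1.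
Hypothesis q_mean : forall g (r : 'I_M),
  \sum_(v : cvec M (n g)) q v * (v r : nat)%:R = (n g)%:R * p0 r.
Hypothesis q_cov : forall g (r s : 'I_M),
  \sum_(v : cvec M (n g)) q v *
     (((v r : nat)%:R - (n g)%:R * p0 r) * ((v s : nat)%:R - (n g)%:R * p0 s))
  = (1 + ((n g)%:R - 1) * rho2) * (n g)%:R * ((r == s)%:R * p0 r - p0 r * p0 s).
Notation data N := (dataset M n (Ng N)).

(* the paper's vartheta_{n_g} *)
Definition vth (g : 'I_G) : R := 1 + ((n g)%:R - 1) * rho2.

Lemma n_ge1R g : 1 <= (n g)%:R :> R.
Proof. by rewrite ler1n (leq_trans _ (n_ge2 g)). Qed.

Lemma vth_ge1 g : 1 <= vth g.
Proof. by rewrite /vth lerDl mulr_ge0// subr_ge0 n_ge1R. Qed.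

(* sum_h n_h N_h times the weighted design effect sum_g w_g vartheta_{n_g} *)
Definition SV N : R := \sum_g (n g)%:R * (Ng N g)%:R * vth g.

Lemma Ng_sumR N : \sum_(g < G) (Ng N g)%:R = N%:R :> R.
Proof. by rewrite -natr_sum Ng_sum. Qed.

Lemma ntotE N : (ntot n (Ng N))%:R = \sum_g (n g)%:R * (Ng N g)%:R :> R.
Proof. by rewrite natr_sum; apply: eq_bigr => g _; rewrite natrM. Qed.

Lemma ntot_geN N : N%:R <= (ntot n (Ng N))%:R :> R.
Proof.
rewrite ntotE -Ng_sumR; apply: ler_sum => g _; rewrite ler_peMl//; exact: n_ge1R.
Qed.

Lemma SV_ge_ntot N : (ntot n (Ng N))%:R <= SV N.
Proof.
by rewrite ntotE; apply: ler_sum => g _; rewrite ler_peMr ?vth_ge1// mulr_ge0.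
Qed.

(** A sum stands in for the maximum, as any common upper bound of the cluster sizes will do. *)
Definition nmax : R := \sum_g (n g)%:R.

Lemma n_le_nmax g : (n g)%:R <= nmax.
Proof. by rewrite /nmax (bigD1 g)//= lerDl sumr_ge0. Qed.

Definition zdev N (d : data N) (r : 'I_M) : R := phat R d r - p0 r.

Lemma sum_centered N (d : data N) r : (0 < N)%N ->
  \sum_(i : cluster_ix (Ng N)) centered W th0 (cluster_val i d) r = (ntot n (Ng N))%:R * zdev d r.
Proof.
move=> N0; have nt0 : 0 < (ntot n (Ng N))%:R :> R.
  by apply: lt_le_trans (ntot_geN N); rewrite ltr0n.
rewrite /zdev /phat mulrBr mulrCA divff ?gt_eqF// mulr1.
rewrite /centered sumrB; congr (_ - _).
  by rewrite /Ytot (@sum_cluster G (Ng N) _ (fun g l => (d g l r : nat)%:R)).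
rewrite -mulr_suml; congr (_ * _).
rewrite ntotE -(@sum_cluster G (Ng N) _ (fun g _ => (n g)%:R)).
by apply: eq_bigr => g _; rewrite sumr_const card_ord mulr_natr.
Qed.

(** The quadratic approximation of the statistic, with the estimated design effect replaced by its
    deterministic target [SV] / [ntot]. *)
Definition Ustat N (d : data N) : R :=
  (ntot n (Ng N))%:R ^+ 2 * Qform W th0 (zdev d) / SV N.

Definition xvec N (g : 'I_G) (v : cvec M (n g)) : 'cV[R]_M :=
  (Num.sqrt (SV N))^-1 *: (Qproj W th0 *m scaled W th0 (centered W th0 v)).

Lemma nsqZ (c : R) (u : 'cV[R]_M) : nsq (c *: u) = c ^+ 2 * nsq u.
Proof. by rewrite /nsq /dotc mulr_sumr; apply: eq_bigr => r _; rewrite !mxE; ring. Qed.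

Lemma dotcZr (c : R) (u v : 'cV[R]_M) : dotc u (c *: v) = c * dotc u v.
Proof. by rewrite /dotc mulr_sumr; apply: eq_bigr => r _; rewrite !mxE; ring. Qed.

Lemma SV_gt0 N : (0 < N)%N -> 0 < SV N.
Proof.
move=> N0; apply: lt_le_trans (le_trans (ntot_geN N) (SV_ge_ntot N)).
by rewrite ltr0n.
Qed.

Lemma UstatE N (d : data N) : (0 < N)%N ->
  nsq (\sum_(i : cluster_ix (Ng N)) xvec N (cluster_val i d)) = Ustat d.
Proof.
move=> N0; have S0 := SV_gt0 N0.
have -> : \sum_(i : cluster_ix (Ng N)) xvec N (cluster_val i d) =
   ((Num.sqrt (SV N))^-1 * (ntot n (Ng N))%:R) *: (Qproj W th0 *m scaled W th0 (zdev d)).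
  rewrite -scaler_sumr -mulmx_sumr -scalerA; congr (_ *: _).
  rewrite scalemxAr; congr (_ *m _).
  apply/colP => r; rewrite summxE !mxE mulrA -sum_centered// mulr_suml.
  by apply: eq_bigr => i _; rewrite mxE.
rewrite nsqZ exprMn exprVn sqr_sqrtr ?(ltW S0)// /Ustat /Qform; ring.
Qed.

Lemma Ustat_ge0 N (d : data N) : 0 <= Ustat d.
Proof.
rewrite /Ustat divr_ge0 ?mulr_ge0 ?sqr_ge0 ?nsq_ge0//.
by apply: sumr_ge0 => g _; rewrite mulr_ge0 ?mulr_ge0// (le_trans ler01 (vth_ge1 g)).
Qed.

Let k := (M - M0 - 1)%N.
Let k_gt0 : (0 < k)%N.
Proof. by rewrite /k subn_gt0 ltn_subRL addnC -ltn_subRL. Qed.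
Let kE : k%:R = M%:R - 1 - M0%:R :> R.
Proof.
rewrite /k !natrB//; first by rewrite addrAC.
  by rewrite ltnW// (leq_trans M0_lt)// leq_subr.
by rewrite subn_gt0 (leq_trans M0_lt)// leq_subr.
Qed.

(** The flow starts at a = 1, where [heat] is exp (- l w), and after total time 1 reaches a = 1 + 2
    l, where its value at 0 is the desired transform. *)
Lemma Ustat_laplace (l : R) : 0 < l ->
  (\sum_(d : data N) data_prob d q * expR (- (l * Ustat d)))%R @[N --> \oo]
    --> (1 + 2 * l) `^ (- (k%:R / 2)).
Proof.
move=> l0.
have [C [d0 [C0 d00 lind]]] := @lindeberg_heat R M k l k_gt0 l0.
have [Kw Kw0 hKw] := wnorm2_bound W M_gt0 th0.
have nm0 : 0 <= nmax by apply: sumr_ge0.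
pose A := Kw * nmax ^+ 2 + 1.
have A0 : 0 < A by rewrite ltr_wpDl// mulr_ge0 ?sqr_ge0// ltW.
apply/cvgrPdist_le => e e0.
(* the step size is dl = sqrt (A / N), and N * dl ^ 3 = A * dl *)
pose e1 := Num.min d0 (e / ((C + 1) * A)).
have e10 : 0 < e1 by rewrite lt_min d00 divr_gt0// mulr_gt0// ltr_wpDl.
near=> N.
have NA : A / e1 ^+ 2 <= N%:R by near: N; exact: nbhs_infty_ger.
have N0R : 0 < N%:R :> R by apply: lt_le_trans NA; rewrite divr_gt0// exprn_gt0.
have N0 : (0 < N)%N by rewrite -(ltr0n R).
have S0 := SV_gt0 N0.
pose dl := Num.sqrt (A / N%:R).
have dl2 : dl ^+ 2 = A / N%:R by rewrite sqr_sqrtr// divr_ge0// ltW.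
have dl0 : 0 < dl by rewrite sqrtr_gt0 divr_gt0.
have dle : dl <= e1.
  rewrite -ler_sqr ?nnegrE ?(ltW dl0) ?(ltW e10)// dl2 ler_pdivrMr//.
  by rewrite mulrC -ler_pdivrMr// exprn_gt0.
have dld0 : 0 < dl <= d0 by rewrite dl0 (le_trans dle)// ge_min lexx.
have dle2 : C * (A * dl) <= e.
  have : dl <= e / ((C + 1) * A) by rewrite (le_trans dle)// ge_min lexx orbT.
  have CA : 0 < (C + 1) * A by rewrite mulr_gt0// ltr_wpDl.
  rewrite ler_pdivlMr//; apply: le_trans.
  have := mulr_ge0 (ltW A0) (ltW dl0); lra.
pose c (i : cluster_ix (Ng N)) : R := vth (tag i) * (n (tag i))%:R / SV N.
have sS : (Num.sqrt (SV N))^-1 ^+ 2 = (SV N)^-1 by rewrite exprVn sqr_sqrtr// ltW.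
have csum : \sum_i c i = 1.
  rewrite -mulr_suml -(@sum_cluster G (Ng N) _ (fun g _ => vth g * (n g)%:R)).
  rewrite (eq_bigr (fun g => (n g)%:R * (Ng N g)%:R * vth g)); first by rewrite divff// gt_eqF.
  by move=> g _; rewrite sumr_const card_ord -mulr_natr; ring.
have PP : Qproj W th0 *m Qproj W th0 = Qproj W th0.
  exact: resproj_idem (sqrtp_unit W M_gt0 th0) (sqrtp_jac W M_gt0 th0) (jac_unit M_gt0 rkW th0).
have X1 (i : cluster_ix (Ng N)) r : \sum_v q v * (xvec N (g := tag i) v) r ord0 = 0.
  under eq_bigr do rewrite mxE mulrCA.
  by rewrite -mulr_sumr (projected_mean (q_sum1 (tag i)) (@q_mean (tag i))) mulr0.
have X2 (i : cluster_ix (Ng N)) (u : 'cV[R]_M) (v : cvec M (n (tag i))) :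
    Qproj W th0 *m u = u -> Qproj W th0 *m (u + xvec N v) = u + xvec N v.
  by move=> Pu; rewrite mulmxDr Pu /xvec -scalemxAr mulmxA PP.
have X3 (i : cluster_ix (Ng N)) (u : 'cV[R]_M) : Qproj W th0 *m u = u ->
    \sum_v q v * dotc u (xvec N (g := tag i) v) ^+ 2 = c i * nsq u.
  move=> Pu; under eq_bigr do rewrite dotcZr exprMn sS mulrCA.
  rewrite -mulr_sumr (projected_second_moment M_gt0 (@q_cov (tag i)) Pu) /c /vth.
  by ring.
have X4 (i : cluster_ix (Ng N)) : \sum_v q v * nsq (xvec N (g := tag i) v) = k%:R * c i.
  under eq_bigr do rewrite nsqZ sS mulrCA.
  rewrite -mulr_sumr (projected_norm_moment M_gt0 rkW (@q_cov (tag i))) kE /c /vth.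
  by ring.
have X5 (i : cluster_ix (Ng N)) : 0 <= c i.
  by rewrite divr_ge0 ?(ltW S0)// mulr_ge0// (le_trans ler01 (vth_ge1 _)).
have X6 (i : cluster_ix (Ng N)) (v : cvec M (n (tag i))) : nsq (xvec N v) <= dl ^+ 2.
  rewrite nsqZ sS dl2 mulrC; apply: ler_pM; rewrite ?nsq_ge0 ?invr_ge0 ?(ltW S0)//.
    apply: (le_trans (projected_norm_le M_gt0 rkW hKw v)).
    apply: (@le_trans _ _ (Kw * nmax ^+ 2)); last by rewrite lerDl.
    by rewrite ler_pM2l// lerXn2r ?nnegrE// n_le_nmax.
  by rewrite lef_pV2 ?posrE// (le_trans (ntot_geN N)) ?SV_ge_ntot.
have := lind (data N) (fun d => data_prob d q) (cluster_ix (Ng N))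
  (fun i => cvec M (n (tag i))) (fun i d => cluster_val i d) (fun i v => q v)
  (fun i v => xvec N v) (fun u => Qproj W th0 *m u = u) c dl
  (fun d => data_prob_ge0 q_ge0 d) (data_prob_sum (Ng N) q_sum1)
  (fun i v => q_ge0 v) (fun i => q_sum1 (tag i)) X1 (mulmx0 _ _) X2 X3 X4 X5 X6 dld0.
have res i s : i \notin s -> forall H : 'cV[R]_M -> R,
    \sum_(d : data N) data_prob d q * H (\sum_(j <- s) xvec N (cluster_val j d) + xvec N (cluster_val i d)) =
    \sum_(d : data N) data_prob d q *
      \sum_(v : cvec M (n (tag i))) q v * H (\sum_(j <- s) xvec N (cluster_val j d) + xvec N v).
  move=> nis H.
  exact: (@resample_sum R G M n (Ng N) q q_sum1 i s _
    (fun (j : cluster_ix (Ng N)) (v : cvec M (n (tag j))) => xvec N v) H nis).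
move=> /(_ res (index_enum _) 0 (index_enum_uniq _) (lexx _)).
rewrite csum add0r mulr0 addr0 mulr1 lexx => /(_ isT).
rewrite {2}/heat mulr0 mul0r subr0.
have -> : expR (- (k%:R / 2 * ln (1 + 2 * l))) = (1 + 2 * l) `^ (- (k%:R / 2)).
  by rewrite /powR gt_eqF ?mulNr//; lra.
rewrite distrC.
under eq_bigr do rewrite UstatE// /heat ln1 mulr0 oppr0 sub0r divr1.
move=> /le_trans; apply; apply: le_trans dle2.
have -> : size (index_enum (cluster_ix (Ng N))) = N.
  apply/eqP; rewrite -(eqr_nat R) -(Ng_sumR N) -sum1_size natr_sum.
  rewrite -(@sum_cluster G (Ng N) _ (fun _ _ => 1)).
  by apply/eqP; apply: eq_bigr => g _; rewrite sumr_const card_ord.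
by rewrite exprS dl2 (_ : N%:R * _ = C * (A * dl))//; field; rewrite gt_eqF.
Unshelve. all: by end_near. Qed.


Lemma Ustat_cdf (y : R) :
  (\sum_(d : data N) data_prob d q * (Ustat d <= y)%R%:R)%R @[N --> \oo] --> chi2_cdf k y.
Proof.
have [y0|y0] := leP 0 y.
  apply: (@laplace_cvg_cdf R (fun N => data N) (fun N d => data_prob d q) (fun N d => Ustat d) k) => //.
  - by move=> N d; exact: data_prob_ge0.
  - by move=> N; exact: data_prob_sum.
  - by move=> N d; exact: Ustat_ge0.
  - exact: Ustat_laplace.
rewrite /chi2_cdf y0 (_ : (fun N => _) = cst 0); first exact: cvg_cst.
apply/funext => N; rewrite big1// => d _.
by rewrite leNgt (lt_le_trans y0 (Ustat_ge0 d)) mulr0.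
Qed.

(** * Laws of large numbers and the exceptional event *)

Definition rfreq (g : 'I_G) (r : 'I_M) (v : cvec M (n g)) : R := centered W th0 v r / (n g)%:R.
Definition rvar (g : 'I_G) (r : 'I_M) : R := vth g * (p0 r * (1 - p0 r)) / (n g)%:R.

Lemma n_gt0R g : 0 < (n g)%:R :> R.
Proof. exact: lt_le_trans ltr01 (n_ge1R g). Qed.

Lemma rfreq_mean g r : \sum_(v : cvec M (n g)) q v * rfreq r v = 0.
Proof.
under eq_bigr do rewrite mulrA.
by rewrite -mulr_suml (centered_mean (q_sum1 g) (@q_mean g)) mul0r.
Qed.

Lemma rfreq_le g r (v : cvec M (n g)) : `|rfreq r v| <= 1.
Proof.
have n0 := n_gt0R g.
rewrite /rfreq normrM (gtr0_norm (_ : 0 < (n g)%:R^-1)) ?invr_gt0// ler_pdivrMr// mul1r.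
exact: centered_le.
Qed.

Lemma rfreq_var g r : \sum_(v : cvec M (n g)) q v * (rfreq r v ^+ 2 - rvar g r) = 0.
Proof.
under eq_bigr do rewrite mulrBr; rewrite sumrB -mulr_suml q_sum1 mul1r.
have n0 := n_gt0R g; have := q_cov g r r; rewrite eqxx mul1r => V.
rewrite (_ : \sum_v _ = (\sum_(v : cvec M (n g)) q v * (centered W th0 v r * centered W th0 v r)) / (n g)%:R ^+ 2).
  rewrite [X in X / _]V /rvar /vth; apply/eqP; rewrite subr_eq0; apply/eqP.
  by field; rewrite gt_eqF.
rewrite mulr_suml; apply: eq_bigr => v _; rewrite /rfreq; field; rewrite gt_eqF//.
Qed.

Lemma rvar_bound g r : 0 <= rvar g r <= \sum_g vth g.
Proof.
have p1 := pmodel_le1 W M_gt0 th0 r; have p00 := pmodel_gt0 W M_gt0 th0 r.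
have v1 := vth_ge1 g; have v0 : 0 <= vth g by apply: le_trans v1.
have pp : 0 <= p0 r * (1 - p0 r) <= 1.
  have := mulr_ge0 (ltW p00) (_ : 0 <= 1 - p0 r); rewrite subr_ge0 => /(_ p1) h.
  rewrite h/=; have := sqr_ge0 (p0 r); rewrite expr2; lra.
have /andP[pp0 pp1] := pp.
rewrite /rvar; apply/andP; split; first by apply: divr_ge0 => //; apply: mulr_ge0.
rewrite ler_pdivrMr ?n_gt0R//.
apply: (@le_trans _ _ (vth g)); first by rewrite ler_piMr.
apply: (@le_trans _ _ (\sum_g vth g)).
  by rewrite (bigD1 g)//= lerDl sumr_ge0// => h _; apply: le_trans (vth_ge1 h).
by rewrite ler_peMr ?n_ge1R// sumr_ge0// => h _; apply: le_trans (vth_ge1 h).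
Qed.

(** [K] controls the total deviation at its natural scale sqrt N, for the local expansion. [c]
    controls, at scale N, the group sums that determine the empirical variances in the design
    effect. *)
Definition good (K c : R) N (d : data N) : bool :=
  [forall r, `|(ntot n (Ng N))%:R * zdev d r| <= K * Num.sqrt N%:R] &&
  [forall g, forall r, (`|\sum_(l < Ng N g) rfreq r (d g l)| <= c * N%:R) &&
      (`|\sum_(l < Ng N g) (rfreq r (d g l) ^+ 2 - rvar g r)| <= c * N%:R)].

Lemma union_bound (J : finType) N (a : J -> data N -> bool) :
  \sum_(d : data N) data_prob d q * (~~ [forall j, a j d])%:R <=
  \sum_j \sum_(d : data N) data_prob d q * (~~ a j d)%:R.
Proof.
rewrite exchange_big; apply: ler_sum => d _; rewrite -mulr_sumr ler_wpM2l ?data_prob_ge0//.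
case: (boolP [forall j, a j d]) => [_|/forallPn[j nj]] /=; first by apply: sumr_ge0.
by rewrite (bigD1 j)//= nj lerDl sumr_ge0.
Qed.

Lemma group_chebyshev N g (h : cvec M (n g) -> R) (B c : R) : (0 < N)%N -> 0 < c ->
  \sum_v q v * h v = 0 -> (forall v, h v ^+ 2 <= B) ->
  \sum_(d : data N) data_prob d q * (~~ (`|\sum_(l < Ng N g) h (d g l)| <= c * N%:R))%:R
    <= B / c ^+ 2 / N%:R.
Proof.
move=> N0 c0 Eh hB; have N0R : 0 < N%:R :> R by rewrite ltr0n.
have B0 : 0 <= B.
  apply: le_trans (hB (finfun (fun _ => ord0))); exact: sqr_ge0.
(* [h] extended by 0 to the clusters of other groups; the cast identifies the types inside group
   [g]. *)
pose f (i : cluster_ix (Ng N)) (v : cvec M (n (tag i))) : R :=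
  if eqVneq (tag i) g is EqNotNeq e then h (ecast z (cvec M (n z)) e v) else 0.
have fg (l : 'I_(Ng N g)) v : f (Tagged (fun g => 'I_(Ng N g)) l) v = h v.
  rewrite /f/=; case: eqVneq => [e|/eqP//].
  by rewrite (eq_axiomK e).
have fng i v : tag i != g -> f i v = 0.
  by move=> ne; rewrite /f; case: eqVneq => // e; rewrite e eqxx in ne.
have Ef i : \sum_v q v * f i v = 0.
  have [e|ne] := eqVneq (tag i) g; last first.
    by rewrite big1// => v _; rewrite fng// mulr0.
  case: i e => g' l /= e; move: l; rewrite e => l.
  by under eq_bigr do rewrite fg.
have fB i v : f i v ^+ 2 <= B.
  have [e|ne] := eqVneq (tag i) g; last by rewrite fng// expr0n/=.
  case: i v e => g' l /= v e; move: l v; rewrite e => l v.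
  by rewrite fg.
have sf (d : data N) : \sum_(l < Ng N g) h (d g l) = \sum_i f i (cluster_val i d).
  rewrite -(@sum_cluster G (Ng N) _ (fun g' l => f (Tagged (fun g => 'I_(Ng N g)) l) (d g' l))).
  rewrite (bigD1 g)//= [X in _ = _ + X]big1 ?addr0; last first.
    by move=> g' ne; rewrite big1// => l _; rewrite fng.
  by apply: eq_bigr => l _; rewrite fg.
have cN : 0 < c * N%:R by rewrite mulr_gt0.
have := chebyshev_data q_ge0 q_sum1 Ef fB cN; rewrite Ng_sumR.
under eq_bigr do rewrite -sf ltNge.
move=> /le_trans; apply.
by rewrite le_eqVlt; apply/orP; left; apply/eqP; field; rewrite !gt_eqF.
Qed.

Lemma tight_chebyshev (K : R) N : (0 < N)%N -> 0 < K ->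
  \sum_(d : data N) data_prob d q *
    (~~ [forall r, `|(ntot n (Ng N))%:R * zdev d r| <= K * Num.sqrt N%:R])%:R
  <= M%:R * nmax ^+ 2 / K ^+ 2.
Proof.
move=> N0 K0; have N0R : 0 < N%:R :> R by rewrite ltr0n.
apply: (le_trans (@union_bound _ _ (fun r d => `|(ntot n (Ng N))%:R * zdev d r| <= K * Num.sqrt N%:R))).
apply: (@le_trans _ _ (\sum_(r < M) nmax ^+ 2 / K ^+ 2)); last first.
  by rewrite sumr_const card_ord -[leLHS]mulr_natl mulrA.
apply: ler_sum => r _.
have t0 : 0 < K * Num.sqrt N%:R by rewrite mulr_gt0// sqrtr_gt0.
have Ef (i : cluster_ix (Ng N)) : \sum_(v : cvec M (n (tag i))) q v * centered W th0 v r = 0.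
  exact: (centered_mean (q_sum1 (tag i)) (@q_mean (tag i))).
have fB (i : cluster_ix (Ng N)) (v : cvec M (n (tag i))) : centered W th0 v r ^+ 2 <= nmax ^+ 2.
  rewrite -real_normK ?num_real// lerXn2r ?nnegrE ?sumr_ge0//.
  exact: le_trans (centered_le W M_gt0 th0 v r) (n_le_nmax _).
have := @chebyshev_data R G M n (Ng N) q q_ge0 q_sum1 (fun i v => centered W th0 v r) _ _ Ef fB t0.
rewrite Ng_sumR; under eq_bigr do rewrite sum_centered// ltNge.
move=> /le_trans; apply.
rewrite exprMn sqr_sqrtr ?ler0n// le_eqVlt; apply/orP; left; apply/eqP; field.
by rewrite !gt_eqF.
Qed.

Lemma indicator_nand_le (a b : bool) : (~~ (a && b))%:R <= (~~ a)%:R + (~~ b)%:R :> R.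
Proof. by case: a b => -[] /=; rewrite ?addr0 ?add0r ?lexx// lerDl. Qed.

(** [K] depends on e alone and is chosen before [c]: tightness is uniform in N, while the laws of
    large numbers hold for any [c] once N is large. *)
Lemma bad_event_small (e : R) : 0 < e ->
  exists2 K : R, 0 < K & forall c, 0 < c ->
    \forall N \near \oo, \sum_(d : data N) data_prob d q * (~~ good K c d)%:R <= e.
Proof.
move=> e0.
have A0 : 0 <= M%:R * nmax ^+ 2 by rewrite mulr_ge0 ?sqr_ge0.
(* As K >= 1, the bound with K^2 in the denominator is at most the one with K, hence at most e /
   2. *)
pose K := 2 * (M%:R * nmax ^+ 2) / e + 1.
have K1 : 1 <= K.
  by rewrite lerDr; apply: divr_ge0; [apply: mulr_ge0|exact: ltW].
have K0 : 0 < K by apply: lt_le_trans K1.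
exists K => // c c0.
pose S := \sum_g vth g.
pose B := (1 + S) ^+ 2.
have S0 : 0 <= S by apply: sumr_ge0 => g _; apply: le_trans (vth_ge1 g).
have B1 : 1 <= B by rewrite exprn_ege1// lerDl.
pose X := \sum_(g < G) \sum_(r < M) (2 * B / c ^+ 2).
near=> N.
have NX : 2 * X / e + 1 <= N%:R by near: N; exact: nbhs_infty_ger.
have X0 : 0 <= X.
  apply: sumr_ge0 => g _; apply: sumr_ge0 => r _.
  by apply: divr_ge0; [apply: mulr_ge0 => //; exact: sqr_ge0|exact: sqr_ge0].
have N0R : 0 < N%:R :> R.
  apply: lt_le_trans NX; rewrite ltr_wpDl//; apply: divr_ge0; last exact: ltW.
  exact: mulr_ge0.
have N0 : (0 < N)%N by rewrite -(ltr0n R).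
have H1 := tight_chebyshev N0 K0.
have H1' : M%:R * nmax ^+ 2 / K ^+ 2 <= e / 2.
  rewrite ler_pdivrMr ?exprn_gt0//.
  have : e / 2 * K <= e / 2 * K ^+ 2 by rewrite ler_pM2l ?divr_gt0// expr2 ler_peMr// ltW.
  have : e / 2 * K = M%:R * nmax ^+ 2 + e / 2 by rewrite /K; field; rewrite gt_eqF.
  lra.
pose b2 (d : data N) := [forall g, forall r, (`|\sum_(l < Ng N g) rfreq r (d g l)| <= c * N%:R) &&
      (`|\sum_(l < Ng N g) (rfreq r (d g l) ^+ 2 - rvar g r)| <= c * N%:R)].
have H2 : \sum_(d : data N) data_prob d q * (~~ b2 d)%:R <= X / N%:R.
  apply: (le_trans (@union_bound _ N (fun g d => [forall r, (`|\sum_(l < Ng N g) rfreq r (d g l)| <= c * N%:R) &&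
      (`|\sum_(l < Ng N g) (rfreq r (d g l) ^+ 2 - rvar g r)| <= c * N%:R)]))).
  rewrite /X mulr_suml; apply: ler_sum => g _.
  apply: (le_trans (@union_bound _ N (fun r d => (`|\sum_(l < Ng N g) rfreq r (d g l)| <= c * N%:R) &&
      (`|\sum_(l < Ng N g) (rfreq r (d g l) ^+ 2 - rvar g r)| <= c * N%:R)))).
  rewrite mulr_suml; apply: ler_sum => r _.
  have C1 : \sum_(d : data N) data_prob d q * (~~ (`|\sum_(l < Ng N g) rfreq r (d g l)| <= c * N%:R))%:R
     <= B / c ^+ 2 / N%:R.
    apply: group_chebyshev => //; first exact: rfreq_mean.
    move=> v; rewrite -real_normK ?num_real// (le_trans _ B1)//.
    by rewrite exprn_ile1// rfreq_le.
  have C2 : \sum_(d : data N) data_prob d q *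
      (~~ (`|\sum_(l < Ng N g) (rfreq r (d g l) ^+ 2 - rvar g r)| <= c * N%:R))%:R <= B / c ^+ 2 / N%:R.
    apply: (@group_chebyshev N g (fun v => rfreq r v ^+ 2 - rvar g r)) => //; first exact: rfreq_var.
    move=> v; rewrite -real_normK ?num_real// lerXn2r ?nnegrE ?addr_ge0//.
    apply: (le_trans (ler_normB _ _)); have /andP[rv0 rv1] := rvar_bound g r.
    apply: lerD; last by rewrite ger0_norm.
    by rewrite normrX exprn_ile1// rfreq_le.
  apply: (@le_trans _ _ (B / c ^+ 2 / N%:R + B / c ^+ 2 / N%:R)); last first.
    by rewrite le_eqVlt; apply/orP; left; apply/eqP; field; rewrite !gt_eqF.
  apply: le_trans (lerD C1 C2); rewrite -big_split/=; apply: ler_sum => d _.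
  by rewrite -mulrDr ler_wpM2l ?data_prob_ge0//; exact: indicator_nand_le.
have H2' : X / N%:R <= e / 2.
  rewrite ler_pdivrMr//.
  have : e / 2 * (2 * X / e + 1) <= e / 2 * N%:R by rewrite ler_pM2l// divr_gt0.
  rewrite (_ : e / 2 * (2 * X / e + 1) = X + e / 2); last by field; rewrite gt_eqF.
  by move: e0; lra.
rewrite (_ : e = e / 2 + e / 2); last by field.
apply: (le_trans _ (lerD (le_trans H1 H1') (le_trans H2 H2'))).
rewrite -big_split/=; apply: ler_sum => d _.
by rewrite -mulrDr ler_wpM2l ?data_prob_ge0//; exact: indicator_nand_le.
Unshelve. all: by end_near. Qed.

End ClusterSampling.

(** * Design effect and conclusion *)

Section DesignEffect.
Variables (R : realType) (M M0 G : nat) (W : 'M[R]_(M, M0)).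
Hypothesis M_gt0 : (0 < M)%N.
Hypothesis M_gt1 : (1 < M)%N.
Variables (th0 : 'cV[R]_M0) (rho2 : R) (n : 'I_G -> nat) (Ng : nat -> 'I_G -> nat).
Variable Nstar : 'I_G -> R.
Notation p0 := (pmodel W th0).
Hypothesis n_ge2 : forall g, (2 <= n g)%N.
Hypothesis Ng_sum : forall N, (\sum_(g < G) Ng N g = N)%N.
Hypothesis rho2_ge0 : 0 <= rho2.
Hypothesis Nstar_gt0 : forall g, 0 < Nstar g.
Hypothesis Ng_cvg : forall g, (fun N : nat => (Ng N g)%:R / N%:R) @ \oo --> Nstar g.
Notation data N := (dataset M n (Ng N)).

(** Centring at p0 does not change deviations from the group mean, and the usual variance formula
    then involves exactly the two sums controlled by [good]. *)
Lemma sum_sq_dev N (d : data N) g r : (0 < Ng N g)%N ->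
  \sum_(l < Ng N g) (phat_gl R d l r - phat_g R d g r) ^+ 2 =
  \sum_(l < Ng N g) rfreq W th0 r (d g l) ^+ 2 - (\sum_(l < Ng N g) rfreq W th0 r (d g l)) ^+ 2 / (Ng N g)%:R.
Proof.
move=> N0; have n0 : 0 < (n g)%:R :> R by rewrite ltr0n (leq_trans _ (n_ge2 g)).
have N0R : 0 < (Ng N g)%:R :> R by rewrite ltr0n.
have E (l : 'I_(Ng N g)) : phat_gl R d l r = rfreq W th0 r (d g l) + p0 r.
  by rewrite /phat_gl /rfreq /centered; field; rewrite gt_eqF.
set S := \sum_(l < Ng N g) rfreq W th0 r (d g l).
have Eg : phat_g R d g r = S / (Ng N g)%:R + p0 r.
  rewrite /phat_g (_ : \sum_(l < Ng N g) _ = (n g)%:R * \sum_(l < Ng N g) phat_gl R d l r); last first.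
    by rewrite mulr_sumr; apply: eq_bigr => l _; rewrite /phat_gl mulrC mulfVK// gt_eqF.
  under eq_bigr do rewrite E.
  rewrite big_split/= sumr_const card_ord -/S -[p0 r *+ _]mulr_natl.
  by field; rewrite !gt_eqF.
transitivity (\sum_(l < Ng N g) (rfreq W th0 r (d g l) ^+ 2 - 2 * (S / (Ng N g)%:R) * rfreq W th0 r (d g l) + (S / (Ng N g)%:R) ^+ 2)).
  by apply: eq_bigr => l _; rewrite E Eg; ring.
rewrite big_split/= sumrB -mulr_sumr -/S sumr_const card_ord -[_ *+ Ng N g]mulr_natl.
by field; rewrite gt_eqF.
Qed.

(** Meant for one term of the design effect: rho is N_g / (N_g - 1), u the inverse fitted
    probability and t the empirical variance. *)
Lemma product_perturbation (rho u t u0 s U S D : R) : 0 <= D <= 1 ->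
  `|rho - 1| <= D -> `|u - u0| <= D -> `|t - s| <= D ->
  `|u0| <= U -> `|s| <= S ->
  `|rho * (u * t) - u0 * s| <= D * (2 * (U + 1) + 2 * S + U * S).
Proof.
move=> /andP[D0 D1] hr hu ht hU hS.
have U0 : 0 <= U := le_trans (normr_ge0 _) hU.
have S0 : 0 <= S := le_trans (normr_ge0 _) hS.
have r2 : `|rho| <= 2.
  by rewrite -[rho](subrK 1); apply: (le_trans (ler_normD _ _)); rewrite normr1; lra.
have u2 : `|u| <= U + 1.
  by rewrite -[u](subrK u0); apply: (le_trans (ler_normD _ _)); lra.
rewrite (_ : rho * (u * t) - u0 * s = rho * u * (t - s) + rho * s * (u - u0) + (rho - 1) * (u0 * s)); last by ring.
apply: (le_trans (ler_normD _ _)).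
rewrite (_ : D * _ = (2 * (U + 1) * D + 2 * S * D) + D * (U * S)); last by ring.
apply: lerD; last by rewrite !normrM ler_pM ?mulr_ge0// ler_pM.
apply: (le_trans (ler_normD _ _)).
by apply: lerD; rewrite !normrM ler_pM ?mulr_ge0// ler_pM.
Qed.

(** Each group estimator approaches n_g / (M - 1) times the sum of rvar / p0. That sum is (M - 1)
    vth / n_g, because the numbers 1 - p0 add up to M - 1. The weights sum to 1, so the bound passes
    to the mean over groups. *)
Lemma deff_close (e : R) : 0 < e ->
  exists2 c, 0 < c & \forall N \near \oo, forall (d : data N) K (pth : 'I_M -> R),
    (forall r, `|pth r - p0 r| <= c) -> good W th0 rho2 K c d ->
    `|deff d pth - SV rho2 n Ng N / (ntot n (Ng N))%:R| <= e.
Proof.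
move=> e0.
have [m m0 hm] := pos_lower_bound (pmodel_gt0 W M_gt0 th0).
have vth1 g : 1 <= vth rho2 n g by exact: vth_ge1.
(* Bounds N / N_g in every group, as eventually N_g / N >= Nstar / 2. *)
pose B : R := \sum_g 2 / Nstar g + 1.
have B0 : 0 < B by rewrite ltr_wpDl// sumr_ge0// => g _; rewrite divr_ge0// ltW.
have BN g : 2 / Nstar g <= B.
  rewrite /B (bigD1 g)//= -addrA lerDl addr_ge0//.
  by apply: sumr_ge0 => h _; rewrite divr_ge0// ltW.
pose S : R := \sum_g vth rho2 n g.
have S0 : 0 <= S by apply: sumr_ge0 => g _; apply: le_trans (vth1 g).
pose C3 : R := 2 * (m^-1 + 1) + 2 * S + m^-1 * S.
have mi0 : 0 < m^-1 by rewrite invr_gt0.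
have C30 : 0 < C3.
  rewrite /C3; have := mulr_ge0 (ltW mi0) S0; lra.
(* The three factors deviate by at most c, (2 / m^2) c and (B + B^2) c; [L] adds these up. *)
pose L : R := 1 + B + B ^+ 2 + 2 / m ^+ 2.
have L1 : 1 <= L.
  have : 0 <= 2 / m ^+ 2 by rewrite divr_ge0 ?sqr_ge0.
  have := sqr_ge0 B; rewrite /L; lra.
have nm0 : 0 <= nmax R n by apply: sumr_ge0.
pose Q : R := nmax R n * M%:R * C3 + 1.
have Q0 : 0 < Q by rewrite ltr_wpDl// !mulr_ge0// ltW.
have L0 : 0 < L by apply: lt_le_trans L1.
have [c [c0 cm cL cQ]] : exists c, [/\ 0 < c, c <= m / 2, c * L <= 1 & c * L * Q <= e].
  exists (Num.min (m / 2) (Num.min (1 / L) (e / (L * Q)))); split.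
  - by rewrite !lt_min !divr_gt0// mulr_gt0.
  - by rewrite ge_min lexx.
  - by rewrite -ler_pdivlMr// !ge_min lexx !orbT.
  - by rewrite -mulrA -ler_pdivlMr ?mulr_gt0// !ge_min lexx !orbT.
have cle1 : c <= 1 by apply: le_trans cL; rewrite ler_peMr// ltW.
exists c => //.
have nearg : \forall N \near \oo, forall g, Nstar g / 2 <= (Ng N g)%:R / N%:R.
  apply: filter_forall => g.
  by apply: (cvgr_ge _ (@Ng_cvg g)); rewrite ltr_pdivrMr// ltr_pMr// ltr1n.
near=> N => d K pth pthc gd.
have NgN : forall g, Nstar g / 2 <= (Ng N g)%:R / N%:R by near: N.
(* Hence N_g >= 1 / c + 1, and 1 / (N_g - 1) <= c. *)
have NB : B * (c^-1 + 1) <= N%:R by near: N; exact: nbhs_infty_ger.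
have ci0 : 0 < c^-1 by rewrite invr_gt0.
have N0R : 0 < N%:R :> R by apply: lt_le_trans NB; rewrite mulr_gt0// addr_gt0.
have N0 : (0 < N)%N by rewrite -(ltr0n R).
have NBg g : N%:R <= B * (Ng N g)%:R.
  have := NgN g; rewrite ler_pdivlMr// => h.
  apply: (@le_trans _ _ (2 / Nstar g * (Ng N g)%:R)); last by rewrite ler_wpM2r.
  rewrite -[leLHS]mul1r (_ : 1 * _ = 2 / Nstar g * (Nstar g / 2 * N%:R)).
    by rewrite ler_wpM2l// divr_ge0// ltW.
  by field; rewrite gt_eqF.
have Ngc g : c^-1 + 1 <= (Ng N g)%:R.
  by rewrite -(ler_pM2l B0); apply: le_trans (NBg g).
have Ng0R g : 0 < (Ng N g)%:R :> R by apply: lt_le_trans (Ngc g); rewrite addr_gt0.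
have Ng1R g : 0 < (Ng N g)%:R - 1 :> R by rewrite subr_gt0; apply: lt_le_trans (Ngc g); rewrite ltrDr.
have M1 : 1 <= M%:R - 1 :> R by rewrite lerBrDr -[leLHS]/(2%:R) ler_nat.
have M10 : 0 < M%:R - 1 :> R by apply: lt_le_trans M1.
pose D := c * L.
have D01 : 0 <= D <= 1 by rewrite cL mulr_ge0// ltW.
have group g : `|deff_g d pth g - vth rho2 n g| <= e.
  have n0 : 0 < (n g)%:R :> R by rewrite ltr0n (leq_trans _ (n_ge2 g)).
  have pp r := pmodel_gt0 W M_gt0 th0 r.
  pose rho : R := (Ng N g)%:R / ((Ng N g)%:R - 1).
  pose t r := (\sum_(l < Ng N g) (phat_gl R d l r - phat_g R d g r) ^+ 2) / (Ng N g)%:R.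
  have dE : deff_g d pth g = (n g)%:R / (M%:R - 1) * \sum_r rho * ((pth r)^-1 * t r).
    rewrite /deff_g [in LHS]mulr_sumr [in RHS]mulr_sumr; apply: eq_bigr => r _; rewrite /t /rho.
    set X := \sum_(l < _) _; rewrite -[(pth r)^-1]/((pth r)^-1); set u := (pth r)^-1.
    by field; rewrite !gt_eqF.
  have vE : vth rho2 n g = (n g)%:R / (M%:R - 1) * \sum_r (p0 r)^-1 * rvar W th0 rho2 n g r.
    have -> : \sum_r (p0 r)^-1 * rvar W th0 rho2 n g r = \sum_r (vth rho2 n g / (n g)%:R * (1 - p0 r)).
      by apply: eq_bigr => r _; rewrite /rvar; field; rewrite !gt_eqF.
    rewrite -mulr_sumr sumrB pmodel_sum1// sumr_const card_ord.
    by field; rewrite !gt_eqF.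
  have term r : `|rho * ((pth r)^-1 * t r) - (p0 r)^-1 * rvar W th0 rho2 n g r| <= D * C3.
    apply: product_perturbation => //.
    - rewrite /rho (_ : _ / _ - 1 = ((Ng N g)%:R - 1)^-1); last by field; rewrite gt_eqF.
      rewrite gtr0_norm ?invr_gt0//; apply: (@le_trans _ _ c); last by rewrite ler_peMr// ltW.
      rewrite -[leRHS]invrK lef_pV2 ?posrE//; have := Ngc g; lra.
    - have pm : m / 2 <= pth r by have := pthc r; rewrite ler_distl; have := hm r; lra.
      have pth0 : 0 < pth r by apply: lt_le_trans pm; rewrite divr_gt0.
      rewrite (_ : _ - _ = (p0 r - pth r) / (pth r * p0 r)); last by field; rewrite !gt_eqF.
      have pq : 0 < pth r * p0 r by apply: mulr_gt0.
      rewrite normrM distrC (gtr0_norm (_ : 0 < (pth r * p0 r)^-1)) ?invr_gt0//.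
      apply: ler_pM => //; first by rewrite invr_ge0 ltW.
      apply: (@le_trans _ _ (2 / m ^+ 2)).
        rewrite (_ : 2 / m ^+ 2 = (m / 2 * m)^-1); last by field; rewrite gt_eqF.
        have mm : 0 < m / 2 * m by rewrite mulr_gt0// divr_gt0.
        have m20 : 0 <= m / 2 by rewrite divr_ge0// ltW.
        by rewrite lef_pV2 ?posrE//; apply: ler_pM => //; exact: ltW.
      by rewrite /L lerDr addr_ge0 ?sqr_ge0// addr_ge0// ltW.
    - have /andP[_ /forallP/(_ g)/forallP/(_ r)/andP[g1 g2]] := gd.
      rewrite /t sum_sq_dev; last by rewrite -(ltr0n R).
      set A := \sum_(l < _) rfreq W th0 r (d g l) in g1 *.
      rewrite sumrB sumr_const card_ord -[_ *+ _]mulr_natl in g2.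
      set A2 := \sum_(l < _) _ in g2 *.
      rewrite (_ : _ - _ = (A2 - (Ng N g)%:R * rvar W th0 rho2 n g r) / (Ng N g)%:R - (A / (Ng N g)%:R) ^+ 2); last first.
        by field; rewrite gt_eqF.
      have cB (x : R) : `|x| <= c * N%:R -> `|x / (Ng N g)%:R| <= c * B.
        move=> xc; rewrite normrM (gtr0_norm (_ : 0 < (Ng N g)%:R^-1)) ?invr_gt0// ler_pdivrMr//.
        by apply: (le_trans xc); rewrite -mulrA ler_pM2l.
      apply: (le_trans (ler_normB _ _)).
      apply: (@le_trans _ _ (c * B + c * B ^+ 2)).
        apply: lerD; first exact: cB.
        rewrite normrX; apply: (@le_trans _ _ ((c * B) ^+ 2)).
          by rewrite lerXn2r ?nnegrE ?mulr_ge0 ?(ltW c0) ?(ltW B0)// cB.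
        by rewrite exprMn ler_wpM2r ?sqr_ge0// expr2 ler_piMr// ltW.
      rewrite -mulrDr ler_pM2l// /L.
      have : 0 <= 2 / m ^+ 2 by rewrite divr_ge0 ?sqr_ge0.
      lra.
    - by rewrite gtr0_norm ?invr_gt0// lef_pV2 ?posrE.
    - have /andP[v0 v1] := rvar_bound W M_gt0 th0 n_ge2 rho2_ge0 g r.
      by rewrite ger0_norm.
  have nM : 0 <= (n g)%:R / (M%:R - 1) :> R by apply: divr_ge0 => //; exact: ltW.
  rewrite dE {1}vE -mulrBr -sumrB normrM (ger0_norm nM).
  apply: (@le_trans _ _ ((n g)%:R / (M%:R - 1) * \sum_(r < M) D * C3)).
    rewrite ler_wpM2l//.
    by apply: (le_trans (ler_norm_sum _ _ _)); apply: ler_sum => r _; exact: term.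
  rewrite sumr_const card_ord -[D * C3 *+ M]mulr_natl.
  apply: le_trans cQ; rewrite -/D.
  have DC : 0 <= M%:R * (D * C3).
    by apply: mulr_ge0 => //; apply: mulr_ge0; [case/andP: D01|exact: ltW].
  apply: (@le_trans _ _ (nmax R n * (M%:R * (D * C3)))).
    rewrite ler_wpM2r//; apply: (@le_trans _ _ (n g)%:R).
      by rewrite ler_pdivrMr// ler_peMr.
    exact: n_le_nmax.
  rewrite (_ : D * Q = nmax R n * (M%:R * (D * C3)) + D); last by rewrite /Q; ring.
  by rewrite lerDl; case/andP: D01.
have nt0 : 0 < (ntot n (Ng N))%:R :> R.
  by apply: lt_le_trans (ntot_geN R n_ge2 Ng_sum N).
have w0 g : 0 <= wgt R n (Ng N) g by rewrite /wgt divr_ge0 ?mulr_ge0// ltW.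
have w1 : \sum_g wgt R n (Ng N) g = 1.
  by rewrite /wgt -mulr_suml -ntotE divff// gt_eqF.
have -> : SV rho2 n Ng N / (ntot n (Ng N))%:R = \sum_g wgt R n (Ng N) g * vth rho2 n g.
  by rewrite /SV mulr_suml; apply: eq_bigr => g _; rewrite /wgt; ring.
rewrite /deff -sumrB; apply: (le_trans (ler_norm_sum _ _ _)).
rewrite -[leRHS]mul1r -w1 mulr_suml; apply: ler_sum => g _.
by rewrite -mulrBr normrM (ger0_norm (w0 g)) ler_wpM2l.
Unshelve. all: by end_near. Qed.

End DesignEffect.

Lemma chi2_cdf_shift (R : realType) (k : nat) (x e : R) : (0 < k)%N -> 0 < e ->
  exists2 d, 0 < d & chi2_cdf k (x + d) <= chi2_cdf k x + e /\
                     chi2_cdf k x - e <= chi2_cdf k (x - d).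
Proof.
move=> k0 e0; have neg (y : R) : y < 0 -> chi2_cdf k y = 0 by rewrite /chi2_cdf => ->.
have [x0|x0] := ltP x 0.
  exists (- x / 2); first by lra.
  by rewrite !neg; lra.
have [d d0 hd] := chi2_cdf_continuous k0 x0 e0.
have near (y : R) : 0 <= y -> `|x - y| <= d ->
    chi2_cdf k y - e <= chi2_cdf k x <= chi2_cdf k y + e.
  by move=> y0 yd; rewrite -ler_distl; exact: hd.
have up (d' : R) : 0 < d' -> d' <= d -> chi2_cdf k (x + d') <= chi2_cdf k x + e.
  move=> d'0 d'd; have xd : 0 <= x + d' by lra.
  have dd : `|x - (x + d')| <= d by rewrite opprD addNKr normrN gtr0_norm.
  by have := near _ xd dd; lra.
move: x0; rewrite le_eqVlt => /predU1P[x0|x0].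
  exists d => //; split; first exact: up.
  have -> : chi2_cdf k x = 0 by rewrite -x0 chi2_cdfE// set_itv1 Rintegral_set1 mul0r.
  by rewrite neg; lra.
exists (Num.min d x); first by rewrite lt_min d0.
have m1 : Num.min d x <= d by rewrite ge_min lexx.
have m2 : Num.min d x <= x by rewrite ge_min lexx orbT.
have m0 : 0 < Num.min d x by rewrite lt_min d0.
move: (Num.min d x) m1 m2 m0 => d' m1 m2 m0.
split; first exact: up.
have xd : 0 <= x - d' by lra.
have dd : `|x - (x - d')| <= d by rewrite opprB subrKC gtr0_norm.
by have := near _ xd dd; lra.
Qed.

(** * Comparison of the statistic with its quadratic form, and conclusion *)

Section Limit.
Variables (R : realType) (M M0 G : nat) (W : 'M[R]_(M, M0)).
Hypothesis M_gt1 : (1 < M)%N.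
Hypothesis rkW : \rank (row_mx W (const_mx 1 : 'cV[R]_M)) = M0.+1.
Variables (th0 : 'cV[R]_M0) (rho2 : R) (n : 'I_G -> nat) (Ng : nat -> 'I_G -> nat).
Variable Nstar : 'I_G -> R.
Variable q : forall g : 'I_G, cvec M (n g) -> R.
Variables (phi1 phi2 : R -> R).
Variable thetahat : forall N : nat, dataset M n (Ng N) -> 'cV[R]_M0.
Notation p0 := (pmodel W th0).
Hypothesis n_ge2 : forall g, (2 <= n g)%N.
Hypothesis Ng_sum : forall N, (\sum_(g < G) Ng N g = N)%N.
Hypothesis Nstar_gt0 : forall g, 0 < Nstar g.
Hypothesis Ng_cvg : forall g, (fun N : nat => (Ng N g)%:R / N%:R) @ \oo --> Nstar g.
Hypothesis rho2_ge0 : 0 <= rho2.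
Hypothesis q_supp : forall g v, q (g := g) v != 0 -> (\sum_(r < M) (v r : nat))%N = n g.
Hypothesis adm1 : admissible phi1.
Hypothesis adm2 : admissible phi2.
Notation data N := (dataset M n (Ng N)).
Hypothesis thetahat_min : forall (N : nat) (d : data N),
  (exists th : 'cV[R]_M0, forall th' : 'cV[R]_M0,
     (dphi phi2 (phat R d) (pmodel W th) <= dphi phi2 (phat R d) (pmodel W th'))%E) ->
  forall th' : 'cV[R]_M0,
    (dphi phi2 (phat R d) (pmodel W (thetahat d)) <= dphi phi2 (phat R d) (pmodel W th'))%E.

Let M_gt0 : (0 < M)%N := ltnW M_gt1.

(** Restricted to data of positive probability: other elements of [cvec] need not have entries
    summing to n_g. *)
Lemma phat_sum1 N (d : data N) : (0 < N)%N -> data_prob d q != 0 -> \sum_r phat R d r = 1.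
Proof.
move=> N0 Pd; have nt0 : 0 < (ntot n (Ng N))%:R :> R.
  by apply: lt_le_trans (ntot_geN R n_ge2 Ng_sum N); rewrite ltr0n.
rewrite /phat -mulr_suml (_ : \sum_r Ytot R d r = (ntot n (Ng N))%:R) ?divff ?gt_eqF//.
rewrite /Ytot exchange_big ntotE; apply: eq_bigr => g _.
rewrite exchange_big/= (eq_bigr (fun=> (n g)%:R)).
  by rewrite sumr_const card_ord mulr_natr.
move=> l _; rewrite -natr_sum; congr (_%:R); apply: q_supp.
exact: (@data_prob_neq0 R G M n (Ng N) q d (Tagged (fun g => 'I_(Ng N g)) l)).
Qed.

Lemma quotient_perturbation (a b u v A x y : R) : 1 / 2 <= u -> 1 <= v -> 0 <= b <= A ->
  `|a - b| <= x -> `|u - v| <= y -> `|a / u - b / v| <= 2 * x + 2 * A * y.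
Proof.
move=> u2 v1 /andP[b0 bA] abx uvy.
have u0 : 0 < u by lra.
have v0 : 0 < v by lra.
rewrite (_ : a / u - b / v = (a - b) / u + b * (v - u) / (u * v)); last by field; rewrite !gt_eqF.
have ui : 0 < u^-1 <= 2.
  by rewrite invr_gt0 u0/= -[leRHS]invrK lef_pV2 ?posrE// -div1r.
have vi : 0 < v^-1 <= 1 by rewrite invr_gt0 v0/= invf_le1.
have /andP[ui0 ui2] := ui; have /andP[vi0 vi1] := vi.
apply: (le_trans (ler_normD _ _)); apply: lerD.
  by rewrite normrM (gtr0_norm ui0) mulrC ler_pM// ltW.
rewrite invfM !normrM (ger0_norm b0) (gtr0_norm ui0) (gtr0_norm vi0) distrC.
rewrite (_ : 2 * A * y = A * y * (2 * 1)); last by ring.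
by apply: ler_pM; rewrite ?mulr_ge0 ?(ltW ui0) ?(ltW vi0)//; apply: ler_pM; rewrite ?(ltW ui0) ?(ltW vi0).
Qed.

(** On the good event the total size times the squared distance is at most A = Kw K^2, so the
    relative error [eta] of the expansion becomes an absolute one. The observed proportions also lie
    where a minimizer exists, which is the premise of the hypothesis on [thetahat]. *)
Lemma stat_close (K e : R) : 0 < K -> 0 < e ->
  exists2 c, 0 < c & \forall N \near \oo, forall d : data N,
    data_prob d q != 0 -> good W th0 rho2 K c d ->
    exists2 t : R, (Tstat W phi1 d (thetahat d) *
       ((deff d (pmodel W (thetahat d)))^-1)%:E)%E = t%:E & `|t - Ustat W th0 rho2 d| <= e.
Proof.
move=> K0 e0.
have [Kw Kw0 hKw] := wnorm2_bound W M_gt0 th0.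
pose A := Kw * K ^+ 2.
have A0 : 0 < A by rewrite mulr_gt0// exprn_gt0.
(* The target of the design effect is at least 1, so an error of 1 / 2 keeps the denominator away
   from 0. *)
have [ed [ed0 ed2 edA]] : exists ed, [/\ 0 < ed, ed <= 1 / 2 & A * ed <= e / 4].
  exists (Num.min (1 / 2) (e / 4 / A)).
  rewrite lt_min !divr_gt0// ge_min lexx; split => //.
  by rewrite mulrC -ler_pdivlMr// ge_min lexx orbT.
have [c c0 deffc] := deff_close W M_gt0 M_gt1 th0 n_ge2 Ng_sum rho2_ge0 Nstar_gt0 Ng_cvg ed0.
(* [eta] is chosen after [c], since the fitted probabilities must be within [c] of p0 for the design
   effect to be close. *)
have [eta [eta01 etac etaA]] : exists eta, [/\ 0 < eta <= 1, eta <= c & eta * A <= e / 4].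
  exists (Num.min 1 (Num.min c (e / 4 / A))).
  rewrite !lt_min ltr01 c0 !divr_gt0// !ge_min !lexx !orbT; split => //.
  by rewrite -ler_pdivlMr// !ge_min lexx !orbT.
have [del del0 expa] := estimator_expansion M_gt0 rkW th0 adm1 adm2 eta01.
exists c => //; near=> N => d Pd gd.
have deffN : forall (d : data N) K (pth : 'I_M -> R),
    (forall r, `|pth r - p0 r| <= c) -> good W th0 rho2 K c d ->
    `|deff d pth - SV rho2 n Ng N / (ntot n (Ng N))%:R| <= ed by near: N.
have NK : K ^+ 2 / del ^+ 2 <= N%:R by near: N; exact: nbhs_infty_ger.
have N0R : 0 < N%:R :> R by apply: lt_le_trans NK; rewrite divr_gt0// exprn_gt0.
have N0 : (0 < N)%N by rewrite -(ltr0n R).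
have ntN := ntot_geN R n_ge2 Ng_sum N.
set nt : R := (ntot n (Ng N))%:R in ntN *.
have nt0 : 0 < nt by apply: lt_le_trans ntN.
pose zeta := K * Num.sqrt N%:R / nt.
have zeta0 : 0 <= zeta by rewrite divr_ge0 ?mulr_ge0 ?sqrtr_ge0 ?(ltW K0)// ltW.
have zeta2 : zeta ^+ 2 = K ^+ 2 * N%:R / nt ^+ 2.
  by rewrite /zeta !exprMn exprVn sqr_sqrtr// ler0n.
have zb r : `|zdev W th0 d r| <= zeta.
  have /andP[/forallP/(_ r) + _] := gd; rewrite -/nt normrM (gtr0_norm nt0).
  by rewrite /zeta ler_pdivlMr// mulrC.
have zetadel : zeta <= del.
  rewrite -ler_sqr ?nnegrE ?(ltW del0)// zeta2.
  apply: (@le_trans _ _ (K ^+ 2 / N%:R)).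
    rewrite ler_pdivrMr ?exprn_gt0// -[K ^+ 2 / _ * _]mulrA ler_pM2l ?exprn_gt0//.
    rewrite [N%:R^-1 * _]mulrC ler_pdivlMr// -expr2.
    by apply: lerXn2r; rewrite ?nnegrE// ltW.
  by rewrite ler_pdivrMr// mulrC -ler_pdivrMr ?exprn_gt0.
have p1 := phat_sum1 N0 Pd.
have pd r : `|phat R d r - p0 r| <= del by apply: le_trans zetadel; exact: zb.
have [ppos [thm thmin] main] := expa (phat R d) p1 pd.
have mp th := pmodel_gt0 W M_gt0 th.
have hatmin th' : dreal phi2 (phat R d) (pmodel W (thetahat d)) <= dreal phi2 (phat R d) (pmodel W th').
  have := @thetahat_min N d.
  have ex : exists th : 'cV[R]_M0, forall th' : 'cV[R]_M0,
     (dphi phi2 (phat R d) (pmodel W th) <= dphi phi2 (phat R d) (pmodel W th'))%E.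
    by exists thm => th2; rewrite !dphiE// lee_fin.
  by move=> /(_ ex th'); rewrite !dphiE// lee_fin.
have [pth Dq] := main (thetahat d) hatmin.
set D := 2 / _ * _ in Dq; rewrite -[fun r => _]/(zdev W th0 d) in Dq.
set Qf := Qform W th0 (zdev W th0 d) in Dq.
have wN : nt * wnorm2 p0 (zdev W th0 d) <= A.
  apply: (@le_trans _ _ (nt * (Kw * zeta ^+ 2))); first by rewrite ler_pM2l//; exact: hKw.
  rewrite zeta2 (_ : nt * _ = A * (N%:R / nt)); last by rewrite /A; field; rewrite gt_eqF.
  by rewrite ler_piMr ?(ltW A0)// ler_pdivrMr// mul1r.
have w0 : 0 <= wnorm2 p0 (zdev W th0 d) by exact: wnorm2_ge0.
have Q0 : 0 <= Qf by exact: nsq_ge0.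
have Qw : Qf <= wnorm2 p0 (zdev W th0 d) by exact: Qform_le_wnorm2.
set df := deff d (pmodel W (thetahat d)).
pose v := SV rho2 n Ng N / nt.
have dfv : `|df - v| <= ed by apply: deffN gd => r; apply: le_trans etac; exact: pth.
have v1 : 1 <= v by rewrite ler_pdivlMr// mul1r; exact: SV_ge_ntot.
have df2 : 1 / 2 <= df by move: dfv; rewrite ler_distl; lra.
exists (nt * D / df).
  rewrite /Tstat dphiE// -!EFinM -/nt; congr (_%:E).
  have := adm1 => -[_ _ _ _ [_ _ c10]].
  by rewrite /D; field; rewrite !gt_eqF//; lra.
have -> : Ustat W th0 rho2 d = nt * Qf / v.
  rewrite /Ustat -/nt -/Qf /v.
  have SV0 := SV_gt0 n_ge2 Ng_sum rho2_ge0 N0.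
  by field; rewrite !gt_eqF.
apply: (@le_trans _ _ (2 * (e / 4) + 2 * A * ed)).
  apply: quotient_perturbation => //.
    by rewrite mulr_ge0 ?(ltW nt0)//=; apply: le_trans wN; rewrite ler_pM2l.
  rewrite -mulrBr normrM (gtr0_norm nt0).
  apply: (@le_trans _ _ (nt * (eta * wnorm2 p0 (zdev W th0 d)))); first by rewrite ler_pM2l.
  rewrite mulrCA; apply: le_trans etaA; rewrite ler_wpM2l//.
  by case/andP: eta01 => /ltW.
by move: edA; lra.
Unshelve. all: by end_near. Qed.

End Limit.

Theorem theorem7 (R : realType) (M M0 G : nat) (W : 'M[R]_(M, M0))
  (th0 : 'cV[R]_M0) (rho2 : R) (n : 'I_G -> nat)
  (Ng : nat -> 'I_G -> nat) (Nstar : 'I_G -> R)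
  (q : forall g : 'I_G, cvec M (n g) -> R)
  (phi1 phi2 : R -> R)
  (thetahat : forall N : nat, dataset M n (Ng N) -> 'cV[R]_M0) :
  (3 <= M)%N -> (1 <= M0)%N -> (M0 < M - 1)%N ->
  \rank W = M0 ->
  \rank (row_mx W (const_mx 1 : 'cV[R]_M)) = M0.+1 ->
  (forall g, 2 <= n g)%N -> injective n ->
  (forall N : nat, \sum_(g < G) Ng N g = N)%N ->
  (forall g, 0 < Nstar g <= 1) ->
  (forall g, (fun N : nat => (Ng N g)%:R / N%:R) @ \oo --> Nstar g) ->
  0 <= rho2 ->
  (* law of a cluster vector of group g: pmf q g, supported on vectors
     with nonnegative integer entries summing to n_g *)
  (forall g v, 0 <= q g v) ->
  (forall g, \sum_(v : cvec M (n g)) q g v = 1) ->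
  (forall g v, q g v != 0 -> (\sum_(r < M) (v r : nat))%N = n g) ->
  (* E[Y^(g,l)] = n_g p(theta0) *)
  (forall g (r : 'I_M),
     \sum_(v : cvec M (n g)) q g v * (v r : nat)%:R
     = (n g)%:R * pmodel W th0 r) ->
  (* Var[Y^(g,l)] = (1 + (n_g - 1) rho^2) n_g Sigma_{p(theta0)} *)
  (forall g (r s : 'I_M),
     \sum_(v : cvec M (n g)) q g v *
        (((v r : nat)%:R - (n g)%:R * pmodel W th0 r) *
         ((v s : nat)%:R - (n g)%:R * pmodel W th0 s))
     = (1 + ((n g)%:R - 1) * rho2) * (n g)%:R *
       ((r == s)%:R * pmodel W th0 r - pmodel W th0 r * pmodel W th0 s)) ->
  admissible phi1 -> admissible phi2 ->
  (* hat theta_{phi2} is a minimizer of d_{phi2}(hat p, p(theta))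
     whenever a minimizer exists *)
  (forall (N : nat) (d : dataset M n (Ng N)),
     (exists th : 'cV[R]_M0, forall th' : 'cV[R]_M0,
        (dphi phi2 (phat R d) (pmodel W th) <= dphi phi2 (phat R d) (pmodel W th'))%E) ->
     forall th' : 'cV[R]_M0,
       (dphi phi2 (phat R d) (pmodel W (thetahat N d))
          <= dphi phi2 (phat R d) (pmodel W th'))%E) ->
  (* convergence in law (of the distribution functions, at every point) of
     T^{phi1}(Y, hat theta_{phi2}) / tilde vartheta_{hat n*, N, phi2}
     to chi^2_{M - M0 - 1} *)
  forall x : R,
    (fun N : nat =>
       \sum_(d : dataset M n (Ng N))
          data_prob d q *
          ((Tstat W phi1 d (thetahat N d) *
            ((deff d (pmodel W (thetahat N d)))^-1)%:E <= x%:E)%E)%:R)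
    @ \oo --> chi2_cdf (M - M0 - 1) x.
Proof.
move=> M3 _ M0M _ rkW n_ge2 _ Ng_sum Nst Ng_cvg rho2_ge0 q_ge0 q_sum1 q_supp q_mean q_cov
  adm1 adm2 hat_min x.
have M_gt1 : (1 < M)%N by apply: leq_trans M3.
have M_gt0 : (0 < M)%N by apply: ltnW.
set k := (M - M0 - 1)%N.
have k_gt0 : (0 < k)%N by rewrite /k subn_gt0 ltn_subRL addnC -ltn_subRL.
have Nst0 g : 0 < Nstar g by have /andP[] := Nst g.
apply/cvgrPdist_le => e e0.
have e4 : 0 < e / 4 by lra.
(* Slutsky's argument: shifting x by [dl], the bad event and the limit law of [Ustat] each cost e /
   4. *)
have [dl dl0 [Fu Fl]] := chi2_cdf_shift x k_gt0 e4.
have [K K0 bad] := bad_event_small M_gt0 n_ge2 Ng_sum rho2_ge0 q_ge0 q_sum1 q_mean q_cov e4.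
have [c c0 close] := stat_close M_gt1 rkW th0 n_ge2 Ng_sum Nst0 Ng_cvg rho2_ge0 q_supp adm1 adm2
  hat_min K0 dl0.
have cdf y := Ustat_cdf M_gt0 M0M rkW n_ge2 Ng_sum rho2_ge0 q_ge0 q_sum1 q_mean q_cov y.
have /cvgrPdist_le/(_ _ e4) cdfu := cdf (x + dl).
have /cvgrPdist_le/(_ _ e4) cdfl := cdf (x - dl).
near=> N.
have badN : \sum_(d : dataset M n (Ng N)) data_prob d q * (~~ good W th0 rho2 K c d)%:R <= e / 4.
  by near: N; exact: bad.
have cu : `|chi2_cdf k (x + dl) - \sum_(d : dataset M n (Ng N)) data_prob d q *
    (Ustat W th0 rho2 d <= x + dl)%R%:R| <= e / 4 by near: N.
have cl : `|chi2_cdf k (x - dl) - \sum_(d : dataset M n (Ng N)) data_prob d q *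
    (Ustat W th0 rho2 d <= x - dl)%R%:R| <= e / 4 by near: N.
have closeN : forall d : dataset M n (Ng N), data_prob d q != 0 -> good W th0 rho2 K c d ->
  exists2 t : R, (Tstat W phi1 d (thetahat N d) *
    ((deff d (pmodel W (thetahat N d)))^-1)%:E)%E = t%:E & `|t - Ustat W th0 rho2 d| <= dl.
  by near: N.
set bad_prob := \sum_(d : dataset M n (Ng N)) _ in badN.
set T := \sum_(d : dataset M n (Ng N)) _.
(* On the good event a statistic at most x forces [Ustat] at most x + dl; off it the indicator is
   bounded by 1, the indicator of the bad event. *)
have Tu : T <= \sum_(d : dataset M n (Ng N)) data_prob d q *
    (Ustat W th0 rho2 d <= x + dl)%R%:R + bad_prob.
  rewrite -big_split/=; apply: ler_sum => d _; rewrite -mulrDr.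
  have [->|Pd] := eqVneq (data_prob d q) 0; first by rewrite !mul0r.
  rewrite ler_wpM2l ?data_prob_ge0//.
  have [gd|_] := boolP (good W th0 rho2 K c d); last first.
    by rewrite (@le_trans _ _ 1)// ?lern1 ?leq_b1// lerDr.
  rewrite addr0; have [t -> tU] := closeN d Pd gd; rewrite lee_fin ler_nat.
  case: (leP t x) => // tx; rewrite lt0b.
  by move: tU; rewrite ler_distl; lra.
have Tl : \sum_(d : dataset M n (Ng N)) data_prob d q *
    (Ustat W th0 rho2 d <= x - dl)%R%:R <= T + bad_prob.
  rewrite -big_split/=; apply: ler_sum => d _; rewrite -mulrDr.
  have [->|Pd] := eqVneq (data_prob d q) 0; first by rewrite !mul0r.
  rewrite ler_wpM2l ?data_prob_ge0//.
  have [gd|_] := boolP (good W th0 rho2 K c d); last first.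
    by rewrite (@le_trans _ _ 1)// ?lern1 ?leq_b1// lerDr.
  rewrite addr0; have [t -> tU] := closeN d Pd gd; rewrite lee_fin ler_nat.
  case: (leP (Ustat W th0 rho2 d) (x - dl)) => // tx; rewrite lt0b.
  by move: tU; rewrite ler_distl; lra.
move: cu cl; rewrite !ler_distl => /andP[cu1 cu2] /andP[cl1 cl2].
by apply/andP; split; lra.
Unshelve. all: by end_near. Qed.
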